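(* The system $\mathrm{ACA}_0^\omega + (\mu) + (\mathcal U)$ is $\Pi^1_2$-conservative over $\mathrm{ACA}_0^\omega$, and therefore also conservative over $\mathrm{PA}$. That is: every $\Pi^1_2$ sentence $\forall f^1\exists g^1\,A(f,g)$ (with $A$ arithmetical and not containing $\mu$ or $\mathcal U$) provable in $\mathrm{ACA}_0^\omega + (\mu) + (\mathcal U)$ is provable in $\mathrm{ACA}_0^\omega$; and every sentence of first-order arithmetic provable in $\mathrm{ACA}_0^\omega + (\mu) + (\mathcal U)$ is provable in first-order Peano arithmetic $\mathrm{PA}$.
   Context: **Types.** The finite types are generated by: $0$ is a type; if $\rho,\tau$ are types, so is $\tau(\rho)$ (functions from $\rho$ to $\tau$). $0$ is the type of natural numbers, $1 := 0(0)$, $2 := 0(0(0))$. Superscripts on variables indicate types. **The system $\mathrm{RCA}_0^\omega$.** Many-sorted classical logic with variables and quantifiers for every finite type. The only primitive equality is $=_0$; equality at higher types is defined extensionally ($x =_{\tau(\rho)} y :\equiv \forall z^\rho\, (xz =_\tau yz)$). Constants: $0^0$, successor $S^1$, combinators $\Pi_{\rho,\tau}$, $\Sigma_{\rho,\sigma,\tau}$ of all types (with $\Pi xy = x$, $\Sigma xyz = xz(yz)$, providing $\lambda$-abstraction), and the type-$0$ recursor $R_0$ with $R_0 0 y z =_0 y$, $R_0(x+1)yz =_0 z(R_0xyz)x$. Axioms: equality axioms, the usual successor axioms, the defining equations of the constants, induction for quantifier-free formulas, the extensionality axioms $\forall z^{\tau(\rho)},x^\rho,y^\rho\,(x=_\rho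 y \to zx =_\tau zy)$ for all types, and the schema $\mathrm{QF}\text{-}\mathrm{AC}^{1,0}$: $\forall f^1\exists x^0\, A_{qf}(f,x) \to \exists F^2\forall f^1\, A_{qf}(f,F(f))$ for $A_{qf}$ quantifier-free (parameters of arbitrary type allowed). Addition and multiplication are given by closed terms, so the language of $\mathrm{PA}$ is interpreted in the obvious way. **The system $\mathrm{ACA}_0^\omega$** is $\mathrm{RCA}_0^\omega$ plus $\Pi^0_1$-comprehension: $\forall f\,\exists g^1\,\forall n^0\,(g(n)=0 \leftrightarrow \forall x^0\, f(n,x)=0)$. A formula is arithmetical if all its quantifiers range over type $0$. **$(\mu)$:** $\exists \mu^2\,\forall f^1\,\big(\exists x^0\, f(x)=0 \to f(\mu(f))=0\big)$. **$(\mathcal U)$:** type-$1$ objects $X$ are viewed as characteristic functions of sets, with $n\in X :\equiv X(n)=0$; $X\cap Y$ is the pointwise maximum of $X$ and $Y$; $\overline{X}$ is the complement; $X\in\mathcal U :\equiv \mathcal U(X)=0$. $(\mathcal U)$ is the statement that there is $\mathcal U^2$ such that (1) $\forall X\,(X\in\mathcal U \lor \overline X\in\mathcal U)$; (2) $\forall X,Y\,(X\cap Y\in\mathcal U\to Y\in\mathcal U)$; (3) $\forall X,Y\,(X,Y\in\mathcal U\to X\cap Y\in\mathcal U)$; (4) $\forall X\,(X\in\mathcal U\to\forall n\exists k>n\,(k\in X))$; (5) $\forall X\,(\mathcal U(X)=_0\mathcal U(\lambda n.\min(X(n),1)))$. *)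

(* Defs.v *)
(* Plain Rocq with Stdlib lists.  The formal systems are deeply embedded, with
   well-sorted de Bruijn syntax: a term or formula over the context Gamma has
   its free variables among the positions of Gamma, each of the listed sort. *)
From Stdlib Require Export List.
Export ListNotations.

(** * Many-sorted classical logic with equality at one sort *)

Inductive var {S : Type} : list S -> S -> Type :=
| vz : forall Gamma s, var (s :: Gamma) s
| vs : forall Gamma s t, var Gamma s -> var (t :: Gamma) s.
Arguments vz {S Gamma s}.
Arguments vs {S Gamma s t} _.

Definition vcase {S : Type} {P : S -> Type} {Gamma : list S} {s : S}
    (z : P s) (f : forall u, var Gamma u -> P u) {u : S}
    (v : var (s :: Gamma) u) : P u :=
  match v in var Gamma' u'
    return match Gamma' with
           | [] => unit
           | s' :: Gamma'' => P s' -> (forall w, var Gamma'' w -> P w) -> P u'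
           end
  with
  | vz => fun z _ => z
  | vs v' => fun _ f => f _ v'
  end z f.

(* [num] is the only sort with a primitive equality. *)
Record lang : Type := Lang {
  sort : Type;
  num : sort;
  tm : list sort -> sort -> Type;
  tvar : forall Gamma s, var Gamma s -> tm Gamma s;
  tsub : forall Gamma Delta, (forall s, var Gamma s -> tm Delta s) ->
         forall s, tm Gamma s -> tm Delta s }.
Arguments tm {l} _ _.
Arguments tvar {l Gamma s} _.
Arguments tsub {l Gamma Delta} _ {s} _.

Inductive fm (L : lang) : list (sort L) -> Type :=
| Eq : forall Gamma, tm Gamma (num L) -> tm Gamma (num L) -> fm L Gamma
| Bot : forall Gamma, fm L Gamma
| Imp : forall Gamma, fm L Gamma -> fm L Gamma -> fm L Gamma
| And : forall Gamma, fm L Gamma -> fm L Gamma -> fm L Gamma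
| Or : forall Gamma, fm L Gamma -> fm L Gamma -> fm L Gamma
| All : forall Gamma (s : sort L), fm L (s :: Gamma) -> fm L Gamma
| Ex : forall Gamma (s : sort L), fm L (s :: Gamma) -> fm L Gamma.
Arguments Eq {L Gamma} _ _.
Arguments Bot {L Gamma}.
Arguments Imp {L Gamma} _ _.
Arguments And {L Gamma} _ _.
Arguments Or {L Gamma} _ _.
Arguments All {L Gamma} s _.
Arguments Ex {L Gamma} s _.

Set Implicit Arguments.
Unset Strict Implicit.
Unset Printing Implicit Defensive.

Definition Neg (L : lang) (Gamma : list (sort L)) (A : fm L Gamma) := Imp A Bot.
Definition Iff (L : lang) (Gamma : list (sort L)) (A B : fm L Gamma) :=
  And (Imp A B) (Imp B A).

Section Substitution.
Variable L : lang.
Implicit Types Gamma Delta : list (sort L).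

Definition sub Gamma Delta := forall s, var Gamma s -> tm Delta s.

Definition ids {Gamma} : sub Gamma Gamma := fun _ v => tvar v.
Definition shifts {Gamma} (t : sort L) : sub Gamma (t :: Gamma) :=
  fun _ v => tvar (vs v).
Definition scons {Gamma Delta} {s : sort L} (t : tm Delta s)
    (sigma : sub Gamma Delta) : sub (s :: Gamma) Delta :=
  fun u v => vcase (P := fun w => tm Delta w) t sigma v.
Definition up {Gamma Delta} {s : sort L} (sigma : sub Gamma Delta) :
    sub (s :: Gamma) (s :: Delta) :=
  scons (tvar vz) (fun u v => tsub (shifts s) (sigma u v)).

Fixpoint fsub Gamma (A : fm L Gamma) : forall Delta, sub Gamma Delta -> fm L Delta :=
  match A in fm _ Gamma0 return forall Delta, sub Gamma0 Delta -> fm L Delta with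
  | Eq t u => fun _ sigma => Eq (tsub sigma t) (tsub sigma u)
  | Bot => fun _ _ => Bot
  | Imp B C => fun _ sigma => Imp (fsub B sigma) (fsub C sigma)
  | And B C => fun _ sigma => And (fsub B sigma) (fsub C sigma)
  | Or B C => fun _ sigma => Or (fsub B sigma) (fsub C sigma)
  | All s B => fun _ sigma => All s (fsub B (up sigma))
  | Ex s B => fun _ sigma => Ex s (fsub B (up sigma))
  end.

Definition inst {Gamma} {s : sort L} (A : fm L (s :: Gamma)) (t : tm Gamma s) : fm L Gamma :=
  fsub A (scons t ids).
Definition lift {Gamma} (s : sort L) (A : fm L Gamma) : fm L (s :: Gamma) :=
  fsub A (shifts s).

Fixpoint quantifier_free Gamma (A : fm L Gamma) : Prop :=
  match A with
  | Eq _ _ | Bot => True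
  | Imp B C | And B C | Or B C => quantifier_free B /\ quantifier_free C
  | All _ _ | Ex _ _ => False
  end.

Fixpoint arithmetical Gamma (A : fm L Gamma) : Prop :=
  match A with
  | Eq _ _ | Bot => True
  | Imp B C | And B C | Or B C => arithmetical B /\ arithmetical C
  | All s B | Ex s B => s = num L /\ arithmetical B
  end.

(* Axioms may have free variables, which is the same as postulating their
   universal closures, since [T] is available in every context. *)
Definition theory := forall Gamma, fm L Gamma -> Prop.

(* Classical natural deduction. *)
Inductive prv (T : theory) : forall Gamma, list (fm L Gamma) -> fm L Gamma -> Prop :=
| p_ax : forall Gamma (H : list (fm L Gamma)) A, T Gamma A -> prv T H A
| p_hyp : forall Gamma (H : list (fm L Gamma)) A, In A H -> prv T H A
| p_raa : forall Gamma (H : list (fm L Gamma)) A, prv T (Neg A :: H) Bot -> prv T H A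
| p_impI : forall Gamma (H : list (fm L Gamma)) A B, prv T (A :: H) B -> prv T H (Imp A B)
| p_impE : forall Gamma (H : list (fm L Gamma)) A B,
    prv T H (Imp A B) -> prv T H A -> prv T H B
| p_andI : forall Gamma (H : list (fm L Gamma)) A B,
    prv T H A -> prv T H B -> prv T H (And A B)
| p_andE1 : forall Gamma (H : list (fm L Gamma)) A B, prv T H (And A B) -> prv T H A
| p_andE2 : forall Gamma (H : list (fm L Gamma)) A B, prv T H (And A B) -> prv T H B
| p_orI1 : forall Gamma (H : list (fm L Gamma)) A B, prv T H A -> prv T H (Or A B)
| p_orI2 : forall Gamma (H : list (fm L Gamma)) A B, prv T H B -> prv T H (Or A B)
| p_orE : forall Gamma (H : list (fm L Gamma)) A B C,
    prv T H (Or A B) -> prv T (A :: H) C -> prv T (B :: H) C -> prv T H C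
| p_allI : forall Gamma (H : list (fm L Gamma)) s (A : fm L (s :: Gamma)),
    prv T (map (lift s) H) A -> prv T H (All s A)
| p_allE : forall Gamma (H : list (fm L Gamma)) s (A : fm L (s :: Gamma)) (t : tm Gamma s),
    prv T H (All s A) -> prv T H (inst A t)
| p_exI : forall Gamma (H : list (fm L Gamma)) s (A : fm L (s :: Gamma)) (t : tm Gamma s),
    prv T H (inst A t) -> prv T H (Ex s A)
| p_exE : forall Gamma (H : list (fm L Gamma)) s (A : fm L (s :: Gamma)) B,
    prv T H (Ex s A) -> prv T (A :: map (lift s) H) (lift s B) -> prv T H B.

Definition sentence := fm L [].
Definition provable (T : theory) (A : sentence) : Prop := prv T [] A.

Definition induction_axiom Gamma (zero : tm Gamma (num L))
    (succ : tm (num L :: Gamma) (num L)) (A : fm L (num L :: Gamma)) : fm L Gamma :=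
  Imp (And (inst A zero)
           (All (num L) (Imp A (fsub A (scons succ (shifts (num L)))))))
      (All (num L) A).

End Substitution.

Arguments theory L : clear implicits.
Arguments sentence L : clear implicits.
Arguments ids {L Gamma} _ _.
Arguments shifts {L Gamma} t _ _.

(** * Finite types and the language of RCA_0^omega *)

(* [Arr rho tau] is tau(rho), the type of functions from rho to tau. *)
Inductive ty : Type := N | Arr (rho tau : ty).
Declare Scope ty_scope.
Delimit Scope ty_scope with ty.
Bind Scope ty_scope with ty.
Notation "rho ~> tau" := (Arr rho tau) (at level 60, right associativity) : ty_scope.
Notation T1 := (N ~> N)%ty.
Notation T2 := ((N ~> N) ~> N)%ty.

Inductive wtm (Gamma : list ty) : ty -> Type :=
| Var : forall rho, var Gamma rho -> wtm Gamma rho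
| Zero : wtm Gamma N
| Succ : wtm Gamma (N ~> N)
| Pi : forall rho tau, wtm Gamma (rho ~> tau ~> rho)
| Sigma : forall rho sigma tau,
    wtm Gamma ((rho ~> sigma ~> tau) ~> (rho ~> sigma) ~> rho ~> tau)
| Rec : wtm Gamma (N ~> N ~> (N ~> N ~> N) ~> N)
| App : forall rho tau, wtm Gamma (rho ~> tau) -> wtm Gamma rho -> wtm Gamma tau.
Arguments Var {Gamma rho} _.
Arguments Zero {Gamma}.
Arguments Succ {Gamma}.
Arguments Pi {Gamma rho tau}.
Arguments Sigma {Gamma rho sigma tau}.
Arguments Rec {Gamma}.
Arguments App {Gamma rho tau} _ _.

Fixpoint wsub (Gamma Delta : list ty) (sg : forall s, var Gamma s -> wtm Delta s)
    (s : ty) (t : wtm Gamma s) : wtm Delta s :=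
  match t with
  | Var v => sg _ v
  | Zero => Zero
  | Succ => Succ
  | Pi => Pi
  | Sigma => Sigma
  | Rec => Rec
  | App t u => App (wsub sg t) (wsub sg u)
  end.

Definition Lomega : lang := @Lang ty N wtm (@Var) wsub.

Declare Scope tm_scope.
Delimit Scope tm_scope with tm.
Notation "t @ u" := (App t u) (at level 40, left associativity) : tm_scope.
Local Open Scope tm_scope.

Notation v0 := (Var vz).
Notation v1 := (Var (vs vz)).
Notation v2 := (Var (vs (vs vz))).
Notation v3 := (Var (vs (vs (vs vz)))).

(* Lambda-abstraction of the last-bound variable, by combinators. *)
Fixpoint lam (Gamma : list ty) (rho tau : ty) (t : wtm (rho :: Gamma) tau) :
    wtm Gamma (rho ~> tau) :=
  match t in wtm _ tau' return wtm Gamma (rho ~> tau') with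
  | Var v => vcase (P := fun u => wtm Gamma (rho ~> u))
               (Sigma @ Pi @ @Pi _ rho rho) (fun _ v' => Pi @ Var v') v
  | Zero => Pi @ Zero
  | Succ => Pi @ Succ
  | Pi => Pi @ Pi
  | Sigma => Pi @ Sigma
  | Rec => Pi @ Rec
  | App t u => Sigma @ lam t @ lam u
  end.

Definition one {Gamma} : wtm Gamma N := Succ @ Zero.
Definition add {Gamma} : wtm Gamma (N ~> N ~> N) :=
  lam (lam (Rec @ v0 @ v1 @ lam (lam (Succ @ v1)))).
Definition mul {Gamma} : wtm Gamma (N ~> N ~> N) :=
  lam (lam (Rec @ v0 @ Zero @ lam (lam (add @ v1 @ v3)))).
Definition pred {Gamma} : wtm Gamma (N ~> N) :=
  lam (Rec @ v0 @ Zero @ lam (lam v0)).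
(* Truncated subtraction. *)
Definition monus {Gamma} : wtm Gamma (N ~> N ~> N) :=
  lam (lam (Rec @ v0 @ v1 @ lam (lam (pred @ v1)))).
Definition tmax {Gamma} : wtm Gamma (N ~> N ~> N) :=
  lam (lam (add @ v1 @ (monus @ v0 @ v1))).
Definition tmin {Gamma} : wtm Gamma (N ~> N ~> N) :=
  lam (lam (monus @ v1 @ (monus @ v1 @ v0))).

(* Sets are type-1 objects, with 0 as the value "true". *)
Definition cap {Gamma} : wtm Gamma (T1 ~> T1 ~> T1) :=
  lam (lam (lam (tmax @ (v2 @ v0) @ (v1 @ v0)))).
Definition compl {Gamma} : wtm Gamma (T1 ~> T1) :=
  lam (lam (monus @ one @ (v1 @ v0))).
Definition normalize {Gamma} : wtm Gamma (T1 ~> T1) :=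
  lam (lam (tmin @ (v1 @ v0) @ one)).

Definition wfm (Gamma : list ty) : Type := fm Lomega Gamma.
Definition eq0 {Gamma} (t u : wtm Gamma N) : wfm Gamma := @Eq Lomega Gamma t u.
(* n < k is rendered by the closed-term equation (n + 1) - k = 0. *)
Definition lt0 {Gamma} (t u : wtm Gamma N) : wfm Gamma :=
  eq0 (monus @ (Succ @ t) @ u) Zero.
Definition mem {Gamma} (n : wtm Gamma N) (X : wtm Gamma T1) : wfm Gamma :=
  eq0 (X @ n) Zero.
Definition memU {Gamma} (X : wtm Gamma T1) (U : wtm Gamma T2) : wfm Gamma :=
  eq0 (U @ X) Zero.
Definition AllT {Gamma} (rho : ty) (A : wfm (rho :: Gamma)) : wfm Gamma :=
  @All Lomega Gamma rho A.
Definition ExT {Gamma} (rho : ty) (A : wfm (rho :: Gamma)) : wfm Gamma :=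
  @Ex Lomega Gamma rho A.
Arguments AllT {Gamma} rho%_ty A.
Arguments ExT {Gamma} rho%_ty A.

Definition wshift (Gamma : list ty) (rho tau : ty) (t : wtm Gamma tau) :
    wtm (rho :: Gamma) tau :=
  wsub (fun _ v => Var (vs v)) t.

Fixpoint eqt (tau : ty) : forall Gamma, wtm Gamma tau -> wtm Gamma tau -> fm Lomega Gamma :=
  match tau with
  | N => fun Gamma x y => eq0 x y
  | Arr rho sigma => fun Gamma x y =>
      AllT rho (eqt (wshift rho x @ v0) (wshift rho y @ v0))
  end.

(** * The systems *)

(* The rule x =_0 y -> A(x) -> A(y) follows from the extensionality axioms. *)
Inductive RCA0w : theory Lomega :=
| eq_refl_ax : forall Gamma (x : wtm Gamma N), RCA0w (eq0 x x)
| eq_sym_ax : forall Gamma (x y : wtm Gamma N), RCA0w (Imp (eq0 x y) (eq0 y x))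
| eq_trans_ax : forall Gamma (x y z : wtm Gamma N),
    RCA0w (Imp (eq0 x y) (Imp (eq0 y z) (eq0 x z)))
| succ_nonzero : forall Gamma (x : wtm Gamma N), RCA0w (Neg (eq0 (Succ @ x) Zero))
| succ_inj : forall Gamma (x y : wtm Gamma N),
    RCA0w (Imp (eq0 (Succ @ x) (Succ @ y)) (eq0 x y))
| Pi_ax : forall Gamma rho tau (x : wtm Gamma rho) (y : wtm Gamma tau),
    RCA0w (eqt (Pi @ x @ y) x)
| Sigma_ax : forall Gamma rho sigma tau (x : wtm Gamma (rho ~> sigma ~> tau))
      (y : wtm Gamma (rho ~> sigma)) (z : wtm Gamma rho),
    RCA0w (eqt (Sigma @ x @ y @ z) (x @ z @ (y @ z)))
| Rec_zero : forall Gamma (y : wtm Gamma N) (z : wtm Gamma (N ~> N ~> N)),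
    RCA0w (eq0 (Rec @ Zero @ y @ z) y)
| Rec_succ : forall Gamma (x y : wtm Gamma N) (z : wtm Gamma (N ~> N ~> N)),
    RCA0w (eq0 (Rec @ (Succ @ x) @ y @ z) (z @ (Rec @ x @ y @ z) @ x))
| QF_induction : forall Gamma (A : wfm (N :: Gamma)), quantifier_free A ->
    RCA0w (@induction_axiom Lomega Gamma Zero (Succ @ v0) A)
| extensionality : forall Gamma rho tau (z : wtm Gamma (rho ~> tau)) (x y : wtm Gamma rho),
    RCA0w (Imp (eqt x y) (eqt (z @ x) (z @ y)))
| QF_AC10 : forall Gamma (A : wfm (N :: T1 :: Gamma)), quantifier_free A ->
    RCA0w (Imp (AllT T1 (ExT N A))
               (ExT T2 (AllT T1
                  (fsub A (scons (L := Lomega) (Delta := T1 :: T2 :: Gamma) (v1 @ v0)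
                          (scons (L := Lomega) (Delta := T1 :: T2 :: Gamma) v0
                             (fun _ v => Var (vs (vs v))))))))).

Definition Pi01_CA {Gamma} : wfm Gamma :=
  AllT (N ~> N ~> N) (ExT T1 (AllT N
    (Iff (eq0 (v1 @ v0) Zero) (AllT N (eq0 (v3 @ v1 @ v0) Zero))))).

Definition mu_ax {Gamma} : wfm Gamma :=
  ExT T2 (AllT T1
    (Imp (ExT N (eq0 (v1 @ v0) Zero)) (eq0 (v0 @ (v1 @ v0)) Zero))).

(* In the five clauses the head of the context is U. *)
Definition U_ultra {Gamma} : wfm (T2 :: Gamma) :=
  AllT T1 (Or (memU v0 v1) (memU (compl @ v0) v1)).
Definition U_upward {Gamma} : wfm (T2 :: Gamma) :=
  AllT T1 (AllT T1
    (Imp (memU (cap @ v1 @ v0) v2) (memU v0 v2))).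
Definition U_inter {Gamma} : wfm (T2 :: Gamma) :=
  AllT T1 (AllT T1
    (Imp (And (memU v1 v2) (memU v0 v2)) (memU (cap @ v1 @ v0) v2))).
Definition U_infinite {Gamma} : wfm (T2 :: Gamma) :=
  AllT T1 (Imp (memU v0 v1)
    (AllT N (ExT N (And (lt0 v1 v0) (mem v0 v2))))).
Definition U_normal {Gamma} : wfm (T2 :: Gamma) :=
  AllT T1 (eq0 (v1 @ v0) (v1 @ (normalize @ v0))).

Definition U_ax {Gamma} : wfm Gamma :=
  ExT T2
    (And U_ultra (And U_upward (And U_inter (And U_infinite U_normal)))).

Inductive ACA0w : theory Lomega :=
| ACA0w_base : forall Gamma (A : wfm Gamma), RCA0w A -> ACA0w A
| ACA0w_CA : forall Gamma, ACA0w (@Pi01_CA Gamma).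

Inductive ACA0w_mu_U : theory Lomega :=
| mu_U_base : forall Gamma (A : wfm Gamma), ACA0w A -> ACA0w_mu_U A
| mu_U_mu : forall Gamma, ACA0w_mu_U (@mu_ax Gamma)
| mu_U_U : forall Gamma, ACA0w_mu_U (@U_ax Gamma).

(** * First-order Peano arithmetic *)

Inductive ptm (Gamma : list unit) : unit -> Type :=
| PVar : forall s, var Gamma s -> ptm Gamma s
| PZero : ptm Gamma tt
| PSucc : ptm Gamma tt -> ptm Gamma tt
| PAdd : ptm Gamma tt -> ptm Gamma tt -> ptm Gamma tt
| PMul : ptm Gamma tt -> ptm Gamma tt -> ptm Gamma tt.
Arguments PVar {Gamma s} _.
Arguments PZero {Gamma}.

Fixpoint psub (Gamma Delta : list unit) (sg : forall s, var Gamma s -> ptm Delta s)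
    (s : unit) (t : ptm Gamma s) : ptm Delta s :=
  match t with
  | PVar v => sg _ v
  | PZero => PZero
  | PSucc t => PSucc (psub sg t)
  | PAdd t u => PAdd (psub sg t) (psub sg u)
  | PMul t u => PMul (psub sg t) (psub sg u)
  end.

Definition LPA : lang := @Lang unit tt ptm (@PVar) psub.

Definition peq (Gamma : list unit) (t u : ptm Gamma tt) : fm LPA Gamma := @Eq LPA Gamma t u.

Inductive PA : theory LPA :=
| pa_refl : forall Gamma (x : ptm Gamma tt), PA (peq x x)
| pa_sym : forall Gamma (x y : ptm Gamma tt), PA (Imp (peq x y) (peq y x))
| pa_trans : forall Gamma (x y z : ptm Gamma tt),
    PA (Imp (peq x y) (Imp (peq y z) (peq x z)))
| pa_congS : forall Gamma (x y : ptm Gamma tt), PA (Imp (peq x y) (peq (PSucc x) (PSucc y)))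
| pa_congD : forall Gamma (x x' y y' : ptm Gamma tt),
    PA (Imp (peq x x') (Imp (peq y y') (peq (PAdd x y) (PAdd x' y'))))
| pa_congM : forall Gamma (x x' y y' : ptm Gamma tt),
    PA (Imp (peq x x') (Imp (peq y y') (peq (PMul x y) (PMul x' y'))))
| pa_nonzero : forall Gamma (x : ptm Gamma tt), PA (Neg (peq (PSucc x) PZero))
| pa_inj : forall Gamma (x y : ptm Gamma tt), PA (Imp (peq (PSucc x) (PSucc y)) (peq x y))
| pa_add0 : forall Gamma (x : ptm Gamma tt), PA (peq (PAdd x PZero) x)
| pa_addS : forall Gamma (x y : ptm Gamma tt),
    PA (peq (PAdd x (PSucc y)) (PSucc (PAdd x y)))
| pa_mul0 : forall Gamma (x : ptm Gamma tt), PA (peq (PMul x PZero) PZero)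
| pa_mulS : forall Gamma (x y : ptm Gamma tt),
    PA (peq (PMul x (PSucc y)) (PAdd (PMul x y) x))
| pa_ind : forall Gamma (A : fm LPA (tt :: Gamma)),
    PA (@induction_axiom LPA Gamma PZero (PSucc (PVar vz)) A).

(* The variables of PA range over type 0; + and * become the closed terms
   [add] and [mul]. *)
Definition ctxN (Gamma : list unit) : list ty := map (fun _ => N) Gamma.

Fixpoint tr_var (Gamma : list unit) (s : unit) (v : var Gamma s) : var (ctxN Gamma) N :=
  match v in var G _ return var (ctxN G) N with
  | vz => vz
  | vs v' => vs (tr_var v')
  end.

Fixpoint tr_tm (Gamma : list unit) (s : unit) (t : ptm Gamma s) : wtm (ctxN Gamma) N :=
  match t with
  | PVar v => Var (tr_var v)
  | PZero => Zero
  | PSucc t => Succ @ tr_tm t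
  | PAdd t u => add @ tr_tm t @ tr_tm u
  | PMul t u => mul @ tr_tm t @ tr_tm u
  end.

Fixpoint tr_fm (Gamma : list unit) (A : fm LPA Gamma) : fm Lomega (ctxN Gamma) :=
  match A in fm _ G return fm Lomega (ctxN G) with
  | @Eq _ G t u => @eq0 (ctxN G) (tr_tm t) (tr_tm u)
  | Bot => Bot
  | Imp B C => Imp (tr_fm B) (tr_fm C)
  | And B C => And (tr_fm B) (tr_fm C)
  | Or B C => Or (tr_fm B) (tr_fm C)
  | @All _ G s B => @All Lomega (ctxN G) N (tr_fm B)
  | @Ex _ G s B => @Ex Lomega (ctxN G) N (tr_fm B)
  end.

(* Main.v *)
(* The proof is semantic.  By the completeness theorem it suffices to turn a
   countable model of ACA_0^omega (respectively of PA) into a model of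
   ACA_0^omega + (mu) + (U) with the same numbers and the same functions of
   type 1 (respectively the same numbers).  Let S be the set of functions of type 1
   (respectively of definable functions), a countable model of ACA_0.  Interpret every type as a
   set with distinguished families indexed by the numbers: for type 0 these are the
   elements of S, and a map is admissible when it sends distinguished
   families to distinguished families.  These spaces form a cartesian closed
   category whose object of type 1 is S itself, so extensionality holds and
   no term can define a function outside S.  A functional of type 2 is
   admissible as soon as it maps each sequence coded in S to a function in S.  Arithmetical
   comprehension gives this for mu and for least witnesses, hence QF-AC.  For U take the filter
   generated by a decreasing sequence of sets in S which is cohesive for every
   sequence of sets coded in S; it exists because S is countable. *)
Require Import Defs.
From Stdlib Require Import ssreflect Classical ClassicalEpsilon
  FunctionalExtensionality PropExtensionality ProofIrrelevance Eqdep PeanoNat Lia Cantor Ring.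

Set Implicit Arguments.
Unset Strict Implicit.
Unset Printing Implicit Defensive.

(** * Syntax and semantics *)

(** The numbers of the given model may be nonstandard, and only they and S survive in the new one.
    The obstacle is [U]. A type-2 object must do more than map S into the numbers: terms feed it
    sequences, and n ↦ U(f n) must again lie in S. Membership in a filter generated by an external
    chain is not an arithmetical condition, so a filter that merely decides each single set need not
    be admissible. If one member of the chain decides a whole coded sequence, then n ↦ U(f n)
    becomes arithmetical in that member; this uniformity is what cohesiveness is for. The chain has
    external length omega and stays outside the model, but each member is a set of S, so every
    cohesive set has to be built by arithmetical comprehension inside a possibly nonstandard model.
    In the completeness proof no constants are added to the languages: the fresh variables of a
    growing chain of contexts act as Henkin constants. *)

Lemma var_cons_ind (S : Type) (G : list S) (s : S)
    (P : forall u, var (s :: G) u -> Prop) :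
  P s vz -> (forall u (v : var G u), P u (vs v)) -> forall u v, P u v.
Proof.
move=> Pz Ps u v.
refine (match v as v' in var G' u' return
  (match G' return (var G' u' -> Prop) with
   | [] => fun _ => True
   | s' :: G'' => fun w => forall (Q : forall u, var (s' :: G'') u -> Prop),
       Q s' vz -> (forall u (v : var G'' u), Q u (vs v)) -> Q u' w
   end v') with vz => _ | vs _ => _ end P Pz Ps).
- by move=> Q Qz _.
- by move=> Q _ Qs; apply: Qs.
Qed.

Lemma var_nil_elim (S : Type) (s : S) (v : var [] s) : False.
Proof.
exact (match v in var G _ return match G with [] => False | _ => True end with
       | vz => I | vs _ => I end).
Qed.

Definition enil {S : Type} {P : S -> Type} : forall u, var [] u -> P u :=
  fun u v => False_rect _ (var_nil_elim v).

Definition econs {S : Type} {P : S -> Type} {G : list S} {s : S} (x : P s)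
    (r : forall u, var G u -> P u) : forall u, var (s :: G) u -> P u :=
  fun u v => vcase x r v.

Lemma env_cons_ext (S : Type) (P : S -> Type) (G : list S) (s : S)
    (f g : forall u, var (s :: G) u -> P u) :
  f s vz = g s vz -> (forall u (v : var G u), f u (vs v) = g u (vs v)) -> f = g.
Proof.
move=> ez es.
apply: functional_extensionality_dep => u; apply: functional_extensionality_dep => v.
by move: u v; apply: var_cons_ind.
Qed.

Lemma env_nil_ext (S : Type) (P : S -> Type) (f g : forall u : S, var [] u -> P u) : f = g.
Proof.
apply: functional_extensionality_dep => u; apply: functional_extensionality_dep => v.
by case: (var_nil_elim v).
Qed.

Lemma env_ext (S : Type) (P : S -> Type) (G : list S) (f g : forall u : S, var G u -> P u) :
  (forall u v, f u v = g u v) -> f = g.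
Proof.
move=> e.
by apply: functional_extensionality_dep => u; apply: functional_extensionality_dep => v.
Qed.

(** A context is finite, so the thresholds of its variables have a common bound; their sum is
    used. *)
Lemma var_eventually (S : Type) (G : list S) (P : forall u, var G u -> nat -> Prop) :
  (forall u v, exists n, forall k, n <= k -> P u v k) ->
  exists n, forall k, n <= k -> forall u v, P u v k.
Proof.
elim: G P => [|s G IH] P ev; first by exists 0 => k _ u v; case: (var_nil_elim v).
have [n1 h1] := IH (fun u v => P u (vs v)) (fun u v => ev u (vs v)).
have [n2 h2] := ev s vz.
exists (n1 + n2) => k hk.
apply: var_cons_ind => [|u v]; [apply: h2 | apply: h1]; lia.
Qed.

(** [lang] carries no laws for substitution. These three are what composition of substitutions in
    formulas rests on. *)
Class lawful (L : lang) : Prop := {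
  tsub_tvar : forall G D (sg : @sub L G D) s (v : var G s), tsub sg (tvar v) = sg s v;
  tsub_ids : forall G s (t : @tm L G s), tsub ids t = t;
  tsub_tsub : forall G D E (sg : @sub L G D) (tau : @sub L D E) s (t : tm G s),
    tsub tau (tsub sg t) = tsub (fun u v => tsub tau (sg u v)) t }.

Section Syntax.
Context {L : lang} {HL : lawful L}.
Implicit Types G D E : list (sort L).

Lemma tsub_ext G D (sg tau : @sub L G D) s (t : tm G s) :
  (forall u v, sg u v = tau u v) -> tsub sg t = tsub tau t.
Proof. by move=> /env_ext ->. Qed.

Lemma fsub_ext G D (sg tau : @sub L G D) (A : fm L G) :
  (forall u v, sg u v = tau u v) -> fsub A sg = fsub A tau.
Proof. by move=> /env_ext ->. Qed.

Lemma up_ids G s : @up L G G s ids = ids.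
Proof. by apply: env_cons_ext => // u v; rewrite /up /scons /= tsub_tvar. Qed.

Lemma fsub_ids G (A : fm L G) : fsub A ids = A.
Proof.
elim: A => //=.
- by move=> ? t u; rewrite !tsub_ids.
- by move=> ? A IA B IB; rewrite IA IB.
- by move=> ? A IA B IB; rewrite IA IB.
- by move=> ? A IA B IB; rewrite IA IB.
- by move=> ? s A IA; rewrite up_ids IA.
- by move=> ? s A IA; rewrite up_ids IA.
Qed.

Lemma up_comp G D E s (sg : @sub L G D) (tau : @sub L D E) :
  (fun u (v : var (s :: G) u) => tsub (up tau) (up sg v)) =
  up (fun u v => tsub tau (sg u v)).
Proof.
apply: env_cons_ext => [|u v]; rewrite /up /scons /=; first by rewrite tsub_tvar.
rewrite !tsub_tsub; apply: tsub_ext => w x; by rewrite tsub_tvar.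
Qed.

Lemma fsub_fsub G (A : fm L G) : forall D E (sg : @sub L G D) (tau : @sub L D E),
  fsub (fsub A sg) tau = fsub A (fun u v => tsub tau (sg u v)).
Proof.
elim: A => //=.
- by move=> ? t u D E sg tau; rewrite !tsub_tsub.
- by move=> ? A IA B IB D E sg tau; rewrite IA IB.
- by move=> ? A IA B IB D E sg tau; rewrite IA IB.
- by move=> ? A IA B IB D E sg tau; rewrite IA IB.
- by move=> ? s A IA D E sg tau; rewrite IA up_comp.
- by move=> ? s A IA D E sg tau; rewrite IA up_comp.
Qed.

Lemma prv_weaken (T : theory L) G (H H' : list (fm L G)) A :
  prv T H A -> incl H H' -> prv T H' A.
Proof.
move=> p; elim: p H' => {G H A}.
- by move=> G H A ax H' i; apply: p_ax.
- by move=> G H A h H' i; apply: p_hyp; apply: i.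
- by move=> G H A _ IH H' i; apply: p_raa; apply: IH => x [->|/i]; [left|right].
- by move=> G H A B _ IH H' i; apply: p_impI; apply: IH => x [->|/i]; [left|right].
- by move=> G H A B _ IA _ IB H' i; apply: p_impE (IA _ i) (IB _ i).
- by move=> G H A B _ IA _ IB H' i; apply: p_andI; [apply: IA|apply: IB].
- by move=> G H A B _ IH H' i; apply: p_andE1 (IH _ i).
- by move=> G H A B _ IH H' i; apply: p_andE2 (IH _ i).
- by move=> G H A B _ IH H' i; apply: p_orI1 (IH _ i).
- by move=> G H A B _ IH H' i; apply: p_orI2 (IH _ i).
- move=> G H A B C _ IH _ I1 _ I2 H' i; apply: (p_orE (IH _ i)).
  + by apply: I1 => x [->|/i]; [left|right].
  + by apply: I2 => x [->|/i]; [left|right].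
- by move=> G H s A _ IH H' i; apply: p_allI; apply: IH; apply: incl_map.
- by move=> G H s A t _ IH H' i; apply: p_allE (IH _ i).
- by move=> G H s A t _ IH H' i; apply: p_exI (IH _ i).
- move=> G H s A B _ I1 _ I2 H' i; apply: (p_exE (I1 _ i)).
  apply: I2 => x [->|h]; [by left|right]; by apply: incl_map h.
Qed.

Lemma prv_mono (T T' : theory L) G (H : list (fm L G)) A :
  (forall G (A : fm L G), T G A -> T' G A) -> prv T H A -> prv T' H A.
Proof.
move=> TT'; elim=> {G H A}; try by econstructor; eauto.
Qed.

Lemma prv_cut (T : theory L) G (Th H : list (fm L G)) A :
  (forall B, In B Th -> prv T [] B) -> prv T (Th ++ H) A -> prv T H A.
Proof.
elim: Th A => [|B Th IH] A //= hTh p.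
apply: (p_impE (A := B)); last by apply: prv_weaken (hTh B (or_introl eq_refl)) _ => ? [].
apply: IH; first by move=> C hC; apply: hTh; right.
exact: p_impI.
Qed.

Definition pure : theory L := fun _ _ => False.

End Syntax.

(** Evaluation is abstract, subject only to the substitution laws, and the primitive equality may be
    any relation. A model made of terms therefore needs no quotient; identity is restored afterwards
    by [collapse]. *)
Record model (L : lang) := Model {
  dom : sort L -> Type;
  ev : forall G s, tm G s -> (forall u, var G u -> dom u) -> dom s;
  eqv : dom (num L) -> dom (num L) -> Prop;
  ev_tvar : forall G s (v : var G s) r, ev (tvar v) r = r s v;
  ev_tsub : forall G D (sg : @sub L G D) s (t : tm G s) r,
    ev (tsub sg t) r = ev t (fun u v => ev (sg u v) r) }.
Arguments ev {L m G s} _ _.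
Arguments eqv {L m} _ _.

Definition env {L} (M : model L) (G : list (sort L)) := forall u, var G u -> dom M u.

Fixpoint sat {L} (M : model L) G (A : fm L G) : env M G -> Prop :=
  match A in fm _ G0 return env M G0 -> Prop with
  | Eq t u => fun r => eqv (ev t r) (ev u r)
  | Bot => fun _ => False
  | Imp B C => fun r => sat B r -> sat C r
  | And B C => fun r => sat B r /\ sat C r
  | Or B C => fun r => sat B r \/ sat C r
  | All s B => fun r => forall x : dom M s, sat B (econs x r)
  | Ex s B => fun r => exists x : dom M s, sat B (econs x r)
  end.

Section Semantics.
Context {L : lang} (M : model L).
Implicit Types G D : list (sort L).

Lemma ev_up G D s (sg : @sub L G D) (x : dom M s) (r : env M D) :
  (fun u (v : var (s :: G) u) => ev (up sg v) (econs x r)) =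
  econs x (fun u v => ev (sg u v) r).
Proof.
apply: env_cons_ext => [|u v]; rewrite /up /scons /=; first by rewrite ev_tvar.
rewrite ev_tsub /=; congr (ev _ _).
by apply: env_ext => w y; rewrite ev_tvar.
Qed.

Lemma sat_fsub G (A : fm L G) : forall D (sg : @sub L G D) (r : env M D),
  sat (fsub A sg) r <-> sat A (fun u v => ev (sg u v) r).
Proof.
elim: A => //=.
- by move=> ? t u D sg r; rewrite !ev_tsub.
- by move=> ? A IA B IB D sg r; rewrite IA IB.
- by move=> ? A IA B IB D sg r; rewrite IA IB.
- by move=> ? A IA B IB D sg r; rewrite IA IB.
- by move=> ? s A IA D sg r; split=> h x; move: (h x); rewrite IA ev_up.
- by move=> ? s A IA D sg r; split=> -[x]; rewrite ?IA => h; exists x; move: h; rewrite ?IA ev_up.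
Qed.

Lemma sat_lift G s (A : fm L G) (x : dom M s) (r : env M G) :
  sat (lift s A) (econs x r) <-> sat A r.
Proof.
rewrite /lift sat_fsub; suff -> : (fun u v => ev (shifts s u v) (econs x r)) = r by [].
by apply: env_ext => u v; rewrite /shifts ev_tvar.
Qed.

Lemma sat_inst G s (A : fm L (s :: G)) (t : tm G s) (r : env M G) :
  sat (inst A t) r <-> sat A (econs (ev t r) r).
Proof.
rewrite /inst sat_fsub.
suff -> : (fun u v => ev (scons t ids v) r) = econs (ev t r) r by [].
by apply: env_cons_ext => // u v; rewrite /scons /ids /= ev_tvar.
Qed.

Lemma soundness (T : theory L) :
  (forall G (A : fm L G), T G A -> forall r : env M G, sat A r) ->
  forall G (H : list (fm L G)) A, prv T H A ->
  forall r : env M G, (forall B, In B H -> sat B r) -> sat A r.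
Proof.
move=> ax.
have hcons G (B : fm L G) H (r : env M G) : sat B r -> (forall C, In C H -> sat C r) ->
    forall C, In C (B :: H) -> sat C r by move=> hB hH C [<-|/hH].
have hlift G (H : list (fm L G)) s x (r : env M G) : (forall C, In C H -> sat C r) ->
    forall C, In C (map (lift s) H) -> sat C (econs x r).
  by move=> hH C /in_map_iff[B [<- /hH hB]]; apply/sat_lift.
move=> G H A; elim=> {G H A} /=.
- by move=> G H A /ax h r _; apply: h.
- by move=> G H A h r hH; apply: hH.
- by move=> G H A _ IH r hH; apply: NNPP => nA; apply: (IH r); apply: hcons.
- by move=> G H A B _ IH r hH hA; apply: IH; apply: hcons.
- by move=> G H A B _ IA _ IB r hH; apply: IA => //; apply: IB.
- by move=> G H A B _ IA _ IB r hH; split; [apply: IA|apply: IB].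
- by move=> G H A B _ IH r hH; case: (IH r hH).
- by move=> G H A B _ IH r hH; case: (IH r hH).
- by move=> G H A B _ IH r hH; left; apply: IH.
- by move=> G H A B _ IH r hH; right; apply: IH.
- by move=> G H A B C _ IH _ I1 _ I2 r hH; case: (IH r hH) => h; [apply: I1|apply: I2]; apply: hcons.
- by move=> G H s A _ IH r hH x; apply: IH; apply: hlift.
- by move=> G H s A t _ IH r hH; apply/sat_inst; apply: IH.
- by move=> G H s A t _ IH r hH; exists (ev t r); apply/sat_inst; apply: IH.
- move=> G H s A B _ I1 _ I2 r hH; have [x hx] := I1 r hH.
  by apply/(sat_lift _ x); apply: I2; apply: hcons => //; apply: hlift.
Qed.

End Semantics.

(** * The completeness theorem *)

Definition countable (X : Type) : Prop :=
  exists f : nat -> option X, forall x, exists n, f n = Some x.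

(** * Families along a chain, considered from some stage on *)

Section Germs.
Variables (F : nat -> Type) (sh : forall k, F k -> F (S k)) (dflt : forall k, F k).

(** Such a family represents an element of the direct limit of the [F k] along [sh]; only a tail of
    it counts. *)
Definition coherent (x : forall k, F k) : Prop :=
  exists n, forall k, n <= k -> x (S k) = sh (x k).
End Germs.

(** The chain is generalised in the induction: dropping stage 0 turns [S n] into [n], and the
    dropped stage receives the default value. *)
Lemma germ_extend (F : nat -> Type) (sh : forall k, F k -> F (S k))
    (dflt : forall k, F k) n (t : F n) :
  exists x : forall k, F k, x n = t /\ forall k, n <= k -> x (S k) = sh k (x k).
Proof.
elim: n F sh dflt t => [|n IH] F sh dflt t.
  by exists (nat_rect F t sh).
have [x [xn xS]] := IH (fun k => F (S k)) (fun k => sh (S k)) (fun k => dflt (S k)) t.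
exists (fun k => match k with 0 => dflt 0 | S k => x k end); split=> // -[|k] hk; first lia.
apply: xS; lia.
Qed.

(** Once coherent, a family is determined by its value at one stage. Pairs of a stage and an index
    of an element at that stage therefore enumerate all families up to eventual equality. *)
Lemma germ_enum (F : nat -> Type) (sh : forall k, F k -> F (S k)) (dflt : forall k, F k) :
  (forall k, countable (F k)) ->
  exists g : nat -> forall k, F k, (forall i, coherent sh (g i)) /\
    forall x, coherent sh x -> exists i n, forall k, n <= k -> g i k = x k.
Proof.
move=> cF.
have {cF} [f hf] : exists f : forall k, nat -> option (F k), forall k x, exists n, f k n = Some x.
  exists (fun k => epsilon (inhabits (fun _ => None))
    (fun f : nat -> option (F k) => forall x, exists n, f n = Some x)) => k.
  by apply: (epsilon_spec (inhabits (fun _ => None)) _ (cF k)).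
pose ext n (t : F n) := proj1_sig (constructive_indefinite_description _ (germ_extend sh dflt t)).
have extP n t : ext n t n = t /\ forall k, n <= k -> ext n t (S k) = sh k (ext n t k).
  exact: proj2_sig (constructive_indefinite_description _ (germ_extend sh dflt t)).
exists (fun i => let n := fst (of_nat i) in
  ext n (match f n (snd (of_nat i)) with Some x => x | None => dflt n end)); split.
  by move=> i; exists (fst (of_nat i)); apply: (proj2 (extP _ _)).
move=> x [n hn]; have [j hj] := hf n (x n).
exists (to_nat (n, j)), n; rewrite cancel_of_to /= hj.
have [e0 eS] := extP n (x n).
by elim=> [|k IH] hk; [have ? : n = 0 by lia|]; [subst|
  case: (Nat.eq_dec n (S k)) => [?|ne]; [subst|rewrite eS ?hn ?IH //; lia]].
Qed.

Section Completeness.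
Context {L : lang} {HL : lawful L}.
Variables (es : nat -> sort L) (es_surj : forall s, exists i, es i = s)
  (dterm : forall G s, @tm L G s)
  (ctm : forall G s, countable (@tm L G s)) (cfm : forall G, countable (fm L G)).

Definition stage_sort k : sort L := es (fst (of_nat k)).
Fixpoint stage k : list (sort L) :=
  match k with 0 => [] | S k => stage_sort k :: stage k end.

Definition fclosed G (A : fm L []) : fm L G := fsub A enil.

Lemma fclosed_nil A : fclosed [] A = A.
Proof. by rewrite -[RHS]fsub_ids; apply: fsub_ext => u v; case: (var_nil_elim v). Qed.

Lemma lift_fclosed G s A : lift s (fclosed G A) = fclosed (s :: G) A.
Proof. by rewrite /lift /fclosed fsub_fsub; apply: fsub_ext => u v; case: (var_nil_elim v). Qed.

Variable T : theory L.

(* Consistency of [H] with the theorems of [T] that are sentences; their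
   instances are used over the empty theory because [T] itself need not be
   closed under substitution. *)
Definition con G (H : list (fm L G)) : Prop :=
  forall Th, (forall B, In B Th -> provable T B) -> ~ prv pure (map (fclosed G) Th ++ H) Bot.

Lemma con_not_both G (H : list (fm L G)) A : con H -> In A H -> In (Neg A) H -> False.
Proof.
move=> c h nh; apply: (c []) => //=.
by apply: p_impE (p_hyp _ nh) (p_hyp _ h).
Qed.

(** A fresh variable could cause a contradiction only if its sort were empty. The contradiction is
    generalised over the variable and instantiated at the term [dterm]. *)
Lemma con_lift G s (H : list (fm L G)) : con H -> con (map (lift s) H).
Proof.
move=> c Th hTh p; apply: (c Th hTh).
have -> : Bot = inst (s := s) Bot (dterm G s) by [].
apply: p_allE; apply: p_allI; apply: prv_weaken p _.
rewrite map_app map_map; apply: incl_app; last by apply: incl_appr.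
apply: incl_appl => x /in_map_iff[y [<- hy]]; apply/in_map_iff; exists y.
by rewrite lift_fclosed.
Qed.

Lemma con_add G (H : list (fm L G)) A : con H -> con (A :: H) \/ con (Neg A :: H).
Proof.
move=> c; apply: NNPP => /not_or_and[n1 n2].
have [Th1 m1] := not_all_ex_not _ _ n1.
have [h1 q1] := imply_to_and _ _ m1; have {}q1 := NNPP _ q1.
have [Th2 m2] := not_all_ex_not _ _ n2.
have [h2 q2] := imply_to_and _ _ m2; have {}q2 := NNPP _ q2.
apply: (c (Th1 ++ Th2)); first by move=> B; rewrite in_app_iff => -[hB|hB]; [apply: h1|apply: h2].
rewrite map_app; apply: (p_impE (A := Neg A)); apply: p_impI.
- apply: prv_weaken q2 _ => x; rewrite /= !in_app_iff /=; tauto.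
- apply: prv_weaken q1 _ => x; rewrite /= !in_app_iff /=; tauto.
Qed.

Lemma con_witness G (H : list (fm L G)) s B :
  con (Ex s B :: H) -> con (B :: map (lift s) (Ex s B :: H)).
Proof.
move=> c Th hTh p; apply: (c Th hTh).
apply: (p_exE (s := s) (A := B)); first by apply: p_hyp; apply/in_app_iff; right; left.
apply: prv_weaken p _; rewrite /= map_app map_map.
rewrite (map_ext _ _ (fun B => lift_fclosed G s B)) => x; rewrite /= !in_app_iff /=; tauto.
Qed.

Lemma Ex_inj G s (B B' : fm L (s :: G)) : Ex s B = Ex s B' -> B = B'.
Proof. by move=> e; injection e => e'; do 2 apply inj_pair2 in e'. Qed.

(** One step settles one formula. If that formula is an accepted existential over the very sort [s]
    of the new variable, this variable becomes its witness; an existential over another sort has to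
    wait for a stage of its own sort. *)
Lemma henkin_step G s (H : list (fm L G)) (A : fm L G) : con H ->
  exists H' : list (fm L (s :: G)),
    con H' /\ incl (map (lift s) H) H' /\
    (In (lift s A) H' \/ In (lift s (Neg A)) H') /\
    forall B, A = Ex s B -> In (lift s A) H' -> In B H'.
Proof.
move=> c; case: (con_add A c) => cA; last first.
  exists (map (lift s) (Neg A :: H)); split; first exact: con_lift.
  split; first by move=> x h; right.
  split; first by right; left.
  move=> B _ h; case: (con_not_both (con_lift cA) h); by left.
case: (classic (exists B, A = Ex s B)) => [[B eA]|nB].
  subst A; exists (B :: map (lift s) (Ex s B :: H)); split; first exact: con_witness.
  split; first by move=> x h; right; right.
  split; first by left; right; left.
  by move=> B' /Ex_inj <- _; left.
exists (map (lift s) (A :: H)); split; first exact: con_lift.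
split; first by move=> x h; right.
split; first by left; left.
by move=> B eA; case: nB; exists B.
Qed.

Variables (A0 : fm L []) (nA0 : ~ provable T A0).

Lemma con_init : con [Neg A0].
Proof.
move=> Th hTh p; apply: nA0; apply: p_raa.
apply: (prv_cut (Th := Th)).
  by move=> B hB; apply: hTh.
move: p; rewrite (map_ext _ id fclosed_nil) map_id.
by apply: prv_mono.
Qed.

Definition fshift k (A : fm L (stage k)) : fm L (stage (S k)) := lift (stage_sort k) A.
Definition tshift s k (t : tm (stage k) s) : tm (stage (S k)) s :=
  tsub (shifts (stage_sort k)) t.

Lemma fm_enum : exists e : forall k, fm L (stage k),
  forall a, coherent fshift a ->
  forall s m, exists k, m <= k /\ stage_sort k = s /\ e k = a k.
Proof.
have [g [_ hg]] := germ_enum fshift (fun k => Bot) (fun k => cfm (stage k)).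
exists (fun k => g (fst (of_nat (snd (of_nat k)))) k) => a ca s m.
have [i [n hn]] := hg a ca; have [j hj] := es_surj s.
(* [j] selects the sort and [i] the formula. The padding [m + n] makes the stage later than [m] and
   than the point from which [g i] agrees with [a]. *)
exists (to_nat (j, to_nat (i, m + n))); rewrite /stage_sort !cancel_of_to /=.
have b1 := to_nat_non_decreasing j (to_nat (i, m + n)).
have b2 := to_nat_non_decreasing i (m + n).
by do 2 (split; first lia || exact: hj); apply: hn; lia.
Qed.

Lemma henkin_chain : exists H : forall k, list (fm L (stage k)),
  In (Neg A0) (H 0) /\ (forall k, con (H k)) /\
  (forall k A, In A (H k) -> In (fshift A) (H (S k))) /\
  (forall a, coherent fshift a -> forall m, exists k, m <= k /\
     (In (a (S k)) (H (S k)) \/ In (Neg (a (S k))) (H (S k)))) /\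
  (forall a, coherent fshift a -> forall s m, exists k, m <= k /\ stage_sort k = s /\
     forall B, a k = Ex (stage_sort k) B -> In (fshift (a k)) (H (S k)) -> In B (H (S k))).
Proof.
have [e he] := fm_enum.
pose St k := {H : list (fm L (stage k)) | con H}.
pose P k (H : list (fm L (stage k))) (H' : list (fm L (stage (S k)))) :=
  incl (map (@fshift k) H) H' /\
  (In (fshift (e k)) H' \/ In (fshift (Neg (e k))) H') /\
  forall B, e k = Ex (stage_sort k) B -> In (fshift (e k)) H' -> In B H'.
have step k (H : St k) : exists H' : St (S k), P k (proj1_sig H) (proj1_sig H').
  case: H => H c; have [H' [c' h]] := henkin_step (stage_sort k) (e k) c.
  by exists (exist _ H' c').
pose nxt k H := proj1_sig (constructive_indefinite_description _ (@step k H)).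
have nxtP k H : P k (proj1_sig H) (proj1_sig (nxt k H)).
  exact: proj2_sig (constructive_indefinite_description _ (@step k H)).
pose H := nat_rect St (exist _ [Neg A0] con_init) nxt.
exists (fun k => proj1_sig (H k)); split; first by left.
split; first by move=> k; apply: proj2_sig.
split.
  by move=> k A h; case: (nxtP k (H k)) => i _; apply: i; apply: in_map.
split=> a ca.
- move=> m; have [n hn] := ca; have [k [mk [_ ek]]] := he a ca (es 0) (m + n).
  exists k; split; first lia.
  case: (nxtP k (H k)) => _ [h _]; rewrite ek in h; rewrite hn; [lia|exact: h].
- move=> s m; have [k [mk [es' ek]]] := he a ca s m.
  exists k; do 2 (split=> //); move=> B eB; rewrite -ek => h.
  by case: (nxtP k (H k)) => _ [_]; apply=> //; rewrite ek.
Qed.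

(* An element of the term model is a family of terms indexed by the stages, not a
   class of such families, so that substitution acts stagewise and the laws of
   [model] hold strictly. *)
Definition gdom s := {x : forall k, tm (stage k) s | coherent (tshift (s := s)) x}.
Definition at_stage k G (r : forall u, var G u -> gdom u) : sub G (stage k) :=
  fun u v => proj1_sig (r u v) k.

Lemma at_stage_shift G (r : forall u, var G u -> gdom u) :
  exists n, forall k, n <= k -> forall u (v : var G u), at_stage (S k) r v = tshift (at_stage k r v).
Proof.
apply: (var_eventually (P := fun u v k => at_stage (S k) r v = tshift (at_stage k r v))) => u v.
by case: (proj2_sig (r u v)) => n hn; exists n.
Qed.

Lemma coherent_ev G s (t : tm G s) (r : forall u, var G u -> gdom u) :
  coherent (tshift (s := s)) (fun k => tsub (at_stage k r) t).
Proof.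
have [n hn] := at_stage_shift r; exists n => k hk.
by rewrite /tshift tsub_tsub; apply: tsub_ext => u v; rewrite (hn k hk).
Qed.

Lemma coherent_fsub G (A : fm L G) (r : forall u, var G u -> gdom u) :
  coherent fshift (fun k => fsub A (at_stage k r)).
Proof.
have [n hn] := at_stage_shift r; exists n => k hk.
by rewrite /fshift /lift fsub_fsub; apply: fsub_ext => u v; rewrite (hn k hk).
Qed.

Definition gev G s (t : tm G s) (r : forall u, var G u -> gdom u) : gdom s :=
  exist _ (fun k => tsub (at_stage k r) t) (coherent_ev t r).

Lemma gdom_eq s (x y : gdom s) : (forall k, proj1_sig x k = proj1_sig y k) -> x = y.
Proof.
case: x y => x cx [y cy] /= h.
have e : x = y by apply: functional_extensionality_dep.
by subst y; congr exist; apply: proof_irrelevance.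
Qed.

Section Truth.
Variable H : forall k, list (fm L (stage k)).

Definition henkin_model : model L.
Proof.
refine (@Model L gdom gev (fun x y => exists n, forall k, n <= k ->
  In (@Eq L (stage k) (proj1_sig x k) (proj1_sig y k)) (H k)) _ _).
- by move=> G s v r; apply: gdom_eq => k /=; rewrite tsub_tvar.
- by move=> G D sg s t r; apply: gdom_eq => k /=; rewrite tsub_tsub.
Defined.

Hypotheses (Hcon : forall k, con (H k))
  (Hlift : forall k A, In A (H k) -> In (fshift A) (H (S k)))
  (Hdec : forall a, coherent fshift a -> forall m, exists k, m <= k /\
     (In (a (S k)) (H (S k)) \/ In (Neg (a (S k))) (H (S k))))
  (Hwit : forall a, coherent fshift a -> forall s m, exists k, m <= k /\ stage_sort k = s /\
     forall B, a k = Ex (stage_sort k) B -> In (fshift (a k)) (H (S k)) -> In B (H (S k))).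

Definition holds (a : forall k, fm L (stage k)) :=
  exists n, forall k, n <= k -> In (a k) (H k).

Lemma holds_from a : coherent fshift a -> (forall n, exists k, n <= k /\ In (a k) (H k)) -> holds a.
Proof.
move=> [n hn] h; have [k [hk hin]] := h n; exists k => j.
elim: j => [|j IH] hj; first by (have e : k = 0 by lia); subst k.
case: (Nat.eq_dec k (S j)) => [?|ne]; first by subst.
rewrite hn; [lia|]; apply: Hlift; apply: IH; lia.
Qed.

Lemma holds_dec a : coherent fshift a -> holds a \/ holds (fun k => Neg (a k)).
Proof.
move=> ca; have cna : coherent fshift (fun k => Neg (a k)).
  by case: ca => n hn; exists n => k hk; rewrite hn.
case: (classic (exists n, forall k, n <= k -> ~ In (a k) (H k))) => [[n hn]|h].
- right; apply: holds_from => // m.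
  have [k [hk [h|h]]] := Hdec ca (n + m).
  + by exfalso; apply: (hn (S k) _ h); lia.
  + by exists (S k); split=> //; lia.
- left; apply: holds_from => // m; apply: NNPP => nh; apply: h; exists m => k hk hin.
  by apply: nh; exists k.
Qed.

Lemma holds_contra a : holds a -> holds (fun k => Neg (a k)) -> False.
Proof.
move=> [n hn] [m hm].
by apply: (con_not_both (Hcon (k := n + m)) (hn _ _) (hm _ _)); lia.
Qed.

(** The finite lists [H k] are not deductively closed. But every coherent formula is eventually
    decided, and consistency rules out the negation of a derivable one. *)
Lemma holds_prv a : coherent fshift a ->
  (exists n, forall k, n <= k -> prv pure (H k) (a k)) -> holds a.
Proof.
move=> ca [n hn]; case: (holds_dec ca) => // -[m hm].
case: (Hcon (k := n + m) (Th := [])) => //=.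
by apply: p_impE (p_hyp _ (hm _ _)) (hn _ _); lia.
Qed.

Lemma holds_thm B : provable T B -> holds (fun k => fclosed (stage k) B).
Proof.
move=> pB.
have cB : coherent fshift (fun k => fclosed (stage k) B).
  by exists 0 => k _; rewrite /fshift lift_fclosed.
case: (holds_dec cB) => // -[m hm].
case: (Hcon (k := m) (Th := [B])) => [C [<-|[]] //|] /=.
apply: p_impE (p_hyp _ _) (p_hyp _ _); last by left.
by right; apply: hm.
Qed.

Lemma holds_eventually_eq a b : (exists n, forall k, n <= k -> a k = b k) -> holds a -> holds b.
Proof. by move=> [n hn] [m hm]; exists (n + m) => k hk; rewrite -hn; [lia|apply: hm; lia]. Qed.

Definition Th G (A : fm L G) (r : env henkin_model G) := holds (fun k => fsub A (at_stage k r)).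

Lemma not_all_prv G s (B : fm L (s :: G)) : prv pure [Neg (All s B)] (Ex s (Neg B)).
Proof.
(* Weakening [B] past the fresh variable and instantiating at that same variable gives [B] back, so
   the eigenvariable can witness the existential. *)
have self : inst (fsub B (up (shifts s))) (tvar vz) = B.
  rewrite /inst fsub_fsub -[RHS]fsub_ids; apply: fsub_ext.
  by apply: var_cons_ind => [|u v]; rewrite /up /scons /= !tsub_tvar.
apply: p_raa; apply: (p_impE (A := All s B)); first by apply: p_hyp; right; left.
apply: p_allI => /=; apply: p_raa.
apply: (p_impE (A := lift s (Ex s (Neg B)))); first by apply: p_hyp; right; left.
apply: (p_exI (t := tvar vz)).
apply: p_hyp; left; by rewrite -[in LHS]self.
Qed.

Lemma inst_at_stage G s (B : fm L (s :: G)) (r : env henkin_model G) (x : gdom s) k :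
  inst (fsub B (up (at_stage k r))) (proj1_sig x k) = fsub B (at_stage k (econs x r)).
Proof.
rewrite /inst fsub_fsub; apply: fsub_ext.
apply: var_cons_ind => [|u v]; rewrite /up /scons /= ?tsub_tvar //.
rewrite tsub_tsub -[RHS]tsub_ids; apply: tsub_ext => w y; by rewrite tsub_tvar.
Qed.

Lemma Th_ex_witness G s (B : fm L (s :: G)) (r : env henkin_model G) :
  Th (Ex s B) r -> exists x : gdom s, Th B (econs x r).
Proof.
move=> [n hn]; have cE := coherent_fsub (Ex s B) r; have [m hm] := at_stage_shift r.
have [k [hk [es' hw]]] := Hwit cE s (n + m); subst s.
(* The witness is the variable added in passing from stage [k] to [S k], carried to later stages by
   weakening. *)
have [x [x0 xS]] := germ_extend (tshift (s := stage_sort k)) (fun k => dterm _ _)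
  (n := S k) (tvar vz).
have cx : coherent (tshift (s := stage_sort k)) x by exists (S k).
exists (exist _ x cx); apply: holds_from; first exact: coherent_fsub.
suff base : In (fsub B (at_stage (S k) (econs (exist _ x cx) r))) (H (S k)).
  move=> j; have [i hi] := coherent_fsub B (econs (exist _ x cx) r).
  case: (holds_dec (coherent_fsub B (econs (exist _ x cx) r))) => [[l hl]|[l hl]].
    by exists (l + j); split; [lia|apply: hl; lia].
  exfalso.
  have pers : forall p, S k <= p -> In (fsub B (at_stage p (econs (exist _ x cx) r))) (H p).
    elim=> [|p IH] hp; first lia.
    case: (Nat.eq_dec (S k) (S p)) => [e|ne]; first by case: e => ?; subst p.
    have -> : fsub B (at_stage (S p) (econs (exist _ x cx) r)) =
      fshift (fsub B (at_stage p (econs (exist _ x cx) r))).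
      rewrite /fshift /lift fsub_fsub; apply: fsub_ext.
      apply: var_cons_ind => [|u v]; first by apply: xS; lia.
      by apply: hm; lia.
    apply: Hlift; apply: IH; lia.
  by apply: (con_not_both (Hcon (k := S k + l)) (pers _ _) (hl _ _)); lia.
suff -> : fsub B (at_stage (S k) (econs (exist _ x cx) r)) = fsub B (up (at_stage k r)).
  by apply: hw => //; apply: Hlift; apply: hn; lia.
apply: fsub_ext; apply: var_cons_ind => [|u v] //.
by apply: hm; lia.
Qed.

Lemma truth_lemma G (A : fm L G) (r : env henkin_model G) : sat A r <-> Th A r.
Proof.
have dec G' (B : fm L G') r' : Th B r' \/ Th (Neg B) r' := holds_dec (coherent_fsub B r').
have prv1 G' (B C : fm L G') r' : Th B r' ->
    (forall k, prv pure [fsub B (at_stage k r')] (fsub C (at_stage k r'))) -> Th C r'.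
  move=> [n hn] p; apply: holds_prv; first exact: coherent_fsub.
  exists n => k hk; apply: prv_weaken (p k) _ => x [<-|[]]; exact: hn.
have prv2 G' (B C D : fm L G') r' : Th B r' -> Th C r' ->
    (forall k, prv pure [fsub B (at_stage k r'); fsub C (at_stage k r')] (fsub D (at_stage k r'))) ->
    Th D r'.
  move=> [n hn] [m hm] p; apply: holds_prv; first exact: coherent_fsub.
  exists (n + m) => k hk; apply: prv_weaken (p k) _ => x [<-|[<-|[]]]; [apply: hn|apply: hm]; lia.
elim: A r => {G} /=.
- by [].
- move=> G r; split=> // -[n hn]; case: (Hcon (k := n) (Th := [])) => //=.
  by apply: p_hyp; apply: hn.
- move=> G A IA B IB r; rewrite IA IB; split.
  + move=> h; case: (dec _ A r) => [/h hB|nA].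
    * by apply: prv1 hB _ => k; apply: p_impI; apply: p_hyp; right; left.
    * apply: prv1 nA _ => k; apply: p_impI; apply: p_raa.
      by apply: (p_impE (A := fsub A (at_stage k r))); apply: p_hyp; right; [right|]; left.
  + move=> h hA; apply: prv2 h hA _ => k /=.
    by apply: (p_impE (A := fsub A (at_stage k r))); apply: p_hyp; [left|right;left].
- move=> G A IA B IB r; rewrite IA IB; split.
  + by move=> [hA hB]; apply: prv2 hA hB _ => k; apply: p_andI; apply: p_hyp; [left|right;left].
  + move=> h; split; apply: prv1 h _ => k /=.
    * by apply: p_andE1; apply: p_hyp; left.
    * by apply: p_andE2; apply: p_hyp; left.
- move=> G A IA B IB r; rewrite IA IB; split.
  + move=> [h|h]; apply: prv1 h _ => k /=; first by apply: p_orI1; apply: p_hyp; left.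
    by apply: p_orI2; apply: p_hyp; left.
  + move=> h; case: (dec _ A r) => [hA|nA]; first by left.
    right; apply: prv2 h nA _ => k /=.
    apply: p_orE; first by apply: p_hyp; left.
    * apply: p_raa; apply: (p_impE (A := fsub A (at_stage k r))); apply: p_hyp.
      -- by do 3 right; left.
      -- by right; left.
    * by apply: p_hyp; left.
- move=> G s A IA r; split.
  (* Witnesses exist only for existentials, so the negation of a universal formula is first turned
     into the existence of a counterexample. *)
  + move=> h; case: (dec _ (All s A) r) => // nh.
    have : Th (Ex s (Neg A)) r by apply: prv1 nh _ => k; apply: not_all_prv.
    move=> /Th_ex_witness[x hx]; case: (holds_contra (a := fun k => fsub A (at_stage k (econs x r)))) => //.
    by apply/IA; apply: h.
  + move=> [n hn] x; apply/IA; apply: holds_prv; first exact: coherent_fsub.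
    exists n => k hk; rewrite -inst_at_stage; apply: p_allE; apply: p_hyp; exact: hn.
- move=> G s A IA r; split.
  + move=> [x /IA[n hn]]; apply: holds_prv; first exact: (coherent_fsub (Ex s A)).
    exists n => k hk; apply: (p_exI (t := proj1_sig x k)); rewrite inst_at_stage.
    by apply: p_hyp; apply: hn.
  + by move=> /Th_ex_witness[x hx]; exists x; apply/IA.
Qed.

End Truth.

(** Axioms may have free variables while [con] speaks of provable sentences; universal closures link
    the two. *)
Fixpoint close G : fm L G -> fm L [] :=
  match G with
  | [] => fun A => A
  | s :: G' => fun A => close (All s A)
  end.

Lemma close_prv G (A : fm L G) : prv T [] A -> prv T [] (close A).
Proof. by elim: G A => //= s G IH A p; apply: IH; apply: p_allI. Qed.

Lemma sat_close (M : model L) G (A : fm L G) (r0 : env M []) :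
  sat (close A) r0 -> forall r : env M G, sat A r.
Proof.
elim: G A => [|s G IH] A /= h r; first by rewrite (env_nil_ext r r0).
have := IH _ h (fun u v => r u (vs v)) (r s vz) => /=.
by congr (sat _ _); apply: env_cons_ext.
Qed.

(** Families that differ only at early stages satisfy the same formulas, so the enumeration reaches
    each element only up to indistinguishability. After an extensional collapse this becomes an
    enumeration of the elements themselves. *)
Theorem completeness : exists M : model L,
  (forall G (A : fm L G), T A -> forall r : env M G, sat A r) /\
  ~ sat A0 (enil : env M []) /\
  (forall s, exists e : nat -> dom M s, forall x, exists i, forall G (A : fm L (s :: G)) (r : env M G),
     sat A (econs x r) <-> sat A (econs (e i) r)).
Proof.
have [H [H0 [Hcon [Hlift [Hdec Hwit]]]]] := henkin_chain.
have truth G A r := @truth_lemma H Hcon Hlift Hdec Hwit G A r.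
have from0 A : In A (H 0) -> Th (H := H) A enil.
  move=> h; exists 0 => k _.
  have -> : fsub A (at_stage k enil) = fclosed (stage k) A.
    by congr (fsub A _); apply: env_nil_ext.
  elim: k => [|k IH]; first by rewrite fclosed_nil.
  rewrite -lift_fclosed; exact: Hlift.
exists (henkin_model H); split; [|split].
- move=> G A TA r; apply: (sat_close (r0 := enil)).
  apply/truth.
  have pA : provable T (close A) by apply: close_prv; apply: p_ax.
  have := holds_thm Hcon Hlift Hdec pA; apply: holds_eventually_eq; exists 0 => k _.
  by apply: fsub_ext => u v; case: (var_nil_elim v).
- by move=> h; apply: (proj2 (truth [] (Neg A0) enil) (from0 (Neg A0) H0)).
- move=> s; have [g [cg hg]] := germ_enum (tshift (s := s)) (fun k => dterm _ _)
    (fun k => ctm (stage k) s).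
  exists (fun i => exist _ (g i) (cg i)) => x.
  have [i [n hn]] := hg _ (proj2_sig x); exists i => G A r.
  rewrite !truth; split; apply: holds_eventually_eq; exists n => k hk; apply: fsub_ext;
    apply: var_cons_ind => // ; [symmetry|]; exact: hn.
Qed.

End Completeness.

(** * Countability of the two languages *)

Local Opaque to_nat of_nat.

Lemma countable_of_inj (X : Type) (f : X -> nat) :
  (forall x y, f x = f y -> x = y) -> countable X.
Proof.
move=> inj.
exists (fun n => match excluded_middle_informative (exists x, f x = n) with
  | left h => Some (proj1_sig (constructive_indefinite_description _ h))
  | right _ => None end) => x; exists (f x).
case: excluded_middle_informative => [h|[]]; last by exists x.
by case: constructive_indefinite_description => y /= /inj ->.
Qed.

Lemma surj_of_countable (X : Type) (x0 : X) : countable X ->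
  exists f : nat -> X, forall x, exists n, f n = x.
Proof.
move=> [f hf]; exists (fun n => match f n with Some x => x | None => x0 end) => x.
by have [n hn] := hf x; exists n; rewrite hn.
Qed.

Lemma inj_of_countable (X : Type) : countable X ->
  exists f : X -> nat, forall x y, f x = f y -> x = y.
Proof.
move=> [f hf].
pose g x := proj1_sig (constructive_indefinite_description _ (hf x)).
have gP x : f (g x) = Some x by exact: proj2_sig (constructive_indefinite_description _ (hf x)).
by exists g => x y e; move: (gP x); rewrite e gP => -[].
Qed.

Lemma to_nat_inj2 a b c d : to_nat (a, b) = to_nat (c, d) -> a = c /\ b = d.
Proof. by move=> e; have := to_nat_inj _ _ e => -[]. Qed.

Section FormulaCode.
Context {L : lang}.
Variables (cs : sort L -> nat) (cs_inj : forall s s', cs s = cs s' -> s = s')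
  (ct : forall G, tm G (num L) -> nat) (ct_inj : forall G (t u : tm G (num L)), ct t = ct u -> t = u).

Fixpoint fm_code G (A : fm L G) : nat :=
  match A with
  | Eq t u => to_nat (0, to_nat (ct t, ct u))
  | Bot => to_nat (1, 0)
  | Imp B C => to_nat (2, to_nat (fm_code B, fm_code C))
  | And B C => to_nat (3, to_nat (fm_code B, fm_code C))
  | Or B C => to_nat (4, to_nat (fm_code B, fm_code C))
  | All s B => to_nat (5, to_nat (cs s, fm_code B))
  | Ex s B => to_nat (6, to_nat (cs s, fm_code B))
  end.

Lemma fm_code_inj G (A B : fm L G) : fm_code A = fm_code B -> A = B.
Proof.
have split_pair a b c d : to_nat (a, b) = to_nat (c, d) -> a = c /\ b = d := @to_nat_inj2 a b c d.
elim: A B => {G} [G t u|G|G A IA B IB|G A IA B IB|G A IA B IB|G s A IA|G s A IA] C;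
  destruct C => /= /split_pair[e1 e2]; try discriminate e1; move=> {e1} //;
  move: e2 => /split_pair[e1 e2].
- by rewrite (ct_inj e1) (ct_inj e2).
- by rewrite (IA _ e1) (IB _ e2).
- by rewrite (IA _ e1) (IB _ e2).
- by rewrite (IA _ e1) (IB _ e2).
- by have e := cs_inj e1; subst; rewrite (IA _ e2).
- by have e := cs_inj e1; subst; rewrite (IA _ e2).
Qed.
End FormulaCode.

Lemma fm_countable (L : lang) : countable (sort L) ->
  (forall G, countable (@tm L G (num L))) -> forall G, countable (fm L G).
Proof.
move=> /inj_of_countable[cs hcs] ctm G.
pose ct G := proj1_sig (constructive_indefinite_description _ (inj_of_countable (ctm G))).
have ctP G' : forall t u, ct G' t = ct G' u -> t = u.
  exact: proj2_sig (constructive_indefinite_description _ (inj_of_countable (ctm G'))).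
exact: countable_of_inj (fm_code_inj hcs ctP (G := G)).
Qed.

Fixpoint var_code (S : Type) (G : list S) s (v : var G s) : nat :=
  match v with vz => 0 | vs v => Datatypes.S (var_code v) end.

Lemma var_code_inj (S : Type) (G : list S) s (v : var G s) s' (v' : var G s') :
  var_code v = var_code v' -> existT (var G) s v = existT (var G) s' v'.
Proof.
elim: v s' v' => {G s} [G s|G s t v IH]; apply: var_cons_ind => //= u w [e].
exact: (f_equal (fun p => existT (var (t :: G)) (projT1 p) (vs (projT2 p))) (IH _ _ e)).
Qed.

#[export] Instance Lomega_lawful : lawful Lomega.
Proof.
split=> //.
- by move=> G s t; elim: t => //= ? ? t IHt u IHu; rewrite IHt IHu.
- by move=> G D E sg tau s t; elim: t => //= ? ? t IHt u IHu; rewrite IHt IHu.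
Qed.

#[export] Instance LPA_lawful : lawful LPA.
Proof.
split=> //.
- by move=> G s; elim=> //= [t ->|t -> u ->|t -> u ->].
- by move=> G D E sg tau s; elim=> //= [t ->|t -> u ->|t -> u ->].
Qed.

Fixpoint ty_code (t : ty) : nat :=
  match t with N => 0 | Arr r s => S (to_nat (ty_code r, ty_code s)) end.

Lemma ty_code_inj s t : ty_code s = ty_code t -> s = t.
Proof.
by elim: s t => [|r IHr s IHs] [|r' s'] //= [/to_nat_inj2[/IHr -> /IHs ->]].
Qed.

Fixpoint wtm_code G s (t : wtm G s) : nat :=
  match t with
  | Var v => to_nat (0, var_code v)
  | Zero => to_nat (1, 0)
  | Succ => to_nat (2, 0)
  | @Pi _ r s => to_nat (3, to_nat (ty_code r, ty_code s))
  | @Sigma _ r s t => to_nat (4, to_nat (ty_code r, to_nat (ty_code s, ty_code t)))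
  | Rec => to_nat (5, 0)
  | App t u => to_nat (6, to_nat (wtm_code t, wtm_code u))
  end.

(** Stated for dependent pairs because an application hides the type of its argument: equal codes
    must yield equal hidden types before the subterms can be compared at all. *)
Lemma wtm_code_inj G s (t : wtm G s) s' (t' : wtm G s') :
  wtm_code t = wtm_code t' -> existT (wtm G) s t = existT (wtm G) s' t'.
Proof.
elim: t s' t' => {s} [s v|||r s|r s t||r s t IHt u IHu] s' t'; destruct t' => /= /to_nat_inj2[e1 e2];
  try discriminate e1; move=> {e1} //.
- exact: (f_equal (fun p => existT (wtm G) (projT1 p) (Var (projT2 p))) (var_code_inj e2)).
- by move: e2 => /to_nat_inj2[/ty_code_inj -> /ty_code_inj ->].
- by move: e2 => /to_nat_inj2[/ty_code_inj -> /to_nat_inj2[/ty_code_inj -> /ty_code_inj ->]].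
- move: e2 => /to_nat_inj2[/IHt e1 /IHu e2].
  have [er es] : r = rho /\ s = tau by case: (f_equal (@projT1 _ _) e1).
  subst; have a1 := inj_pair2 _ _ _ _ _ e1; have a2 := inj_pair2 _ _ _ _ _ e2.
  by rewrite a1 a2.
Qed.

Lemma wtm_countable G s : countable (wtm G s).
Proof.
apply: (countable_of_inj (f := @wtm_code G s)) => t u /wtm_code_inj; exact: inj_pair2.
Qed.

Fixpoint ptm_code G s (t : ptm G s) : nat :=
  match t with
  | PVar v => to_nat (0, var_code v)
  | PZero => to_nat (1, 0)
  | PSucc t => to_nat (2, ptm_code t)
  | PAdd t u => to_nat (3, to_nat (ptm_code t, ptm_code u))
  | PMul t u => to_nat (4, to_nat (ptm_code t, ptm_code u))
  end.

Lemma ptm_code_inj G s (t : ptm G s) s' (t' : ptm G s') :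
  ptm_code t = ptm_code t' -> existT (ptm G) s t = existT (ptm G) s' t'.
Proof.
elim: t s' t' => {s} [s v||t IHt|t IHt u IHu|t IHt u IHu] s' t'; destruct t' => /= /to_nat_inj2[e1 e2];
  try discriminate e1; move=> {e1} //.
- exact: (f_equal (fun p => existT (ptm G) (projT1 p) (PVar (projT2 p))) (var_code_inj e2)).
- by rewrite (inj_pair2 _ _ _ _ _ (IHt _ _ e2)).
- move: e2 => /to_nat_inj2[e1 e2].
  by rewrite (inj_pair2 _ _ _ _ _ (IHt _ _ e1)) (inj_pair2 _ _ _ _ _ (IHu _ _ e2)).
- move: e2 => /to_nat_inj2[e1 e2].
  by rewrite (inj_pair2 _ _ _ _ _ (IHt _ _ e1)) (inj_pair2 _ _ _ _ _ (IHu _ _ e2)).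
Qed.

Lemma ptm_countable G s : countable (ptm G s).
Proof.
apply: (countable_of_inj (f := @ptm_code G s)) => t u /ptm_code_inj; exact: inj_pair2.
Qed.

Fixpoint some_wtm G (s : ty) : wtm G s :=
  match s with N => Zero | Arr r t => App Pi (some_wtm G t) end.

Definition some_ptm G (s : unit) : ptm G s := match s with tt => PZero end.

Theorem Lomega_completeness (T : theory Lomega) A : ~ provable T A -> exists M : model Lomega,
  (forall G (B : fm Lomega G), T G B -> forall r : env M G, sat B r) /\
  ~ sat A (enil : env M []) /\
  (forall s, exists e : nat -> dom M s, forall x, exists i,
     forall G (B : fm Lomega (s :: G)) (r : env M G),
       sat B (econs x r) <-> sat B (econs (e i) r)).
Proof.
have cty : countable (sort Lomega) := countable_of_inj ty_code_inj.
have [es hes] := surj_of_countable (N : sort Lomega) cty.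
apply: (completeness hes some_wtm wtm_countable).
by apply: fm_countable => // G; apply: wtm_countable.
Qed.

Lemma LPA_sort_countable : countable (sort LPA).
Proof. by apply: (countable_of_inj (f := fun _ => 0)) => -[] []. Qed.
Lemma LPA_fm_countable G : countable (fm LPA G).
Proof.
by apply: fm_countable => [|D]; [apply: LPA_sort_countable|apply: ptm_countable].
Qed.

Theorem LPA_completeness (T : theory LPA) A : ~ provable T A -> exists M : model LPA,
  (forall G (B : fm LPA G), T G B -> forall r : env M G, sat B r) /\
  ~ sat A (enil : env M []) /\
  (forall s, exists e : nat -> dom M s, forall x, exists i,
     forall G (B : fm LPA (s :: G)) (r : env M G),
       sat B (econs x r) <-> sat B (econs (e i) r)).
Proof.
have [es hes] := surj_of_countable (tt : sort LPA) LPA_sort_countable.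
exact: (completeness hes some_ptm ptm_countable LPA_fm_countable).
Qed.

(** * Countable models of ACA_0 *)

(* A countable model of ACA_0 presented by its numbers and functions; the value
   [z] of a function stands for true. *)
Record aca := Aca {
  nn : Type;
  z : nn;
  sc : nn -> nn;
  Fn : (nn -> nn) -> Prop;
  pr : nn -> nn -> nn;
  p1 : nn -> nn;
  p2 : nn -> nn;
  p1_pr : forall a b, p1 (pr a b) = a;
  p2_pr : forall a b, p2 (pr a b) = b;
  Fn_const : forall a, Fn (fun _ => a);
  Fn_id : Fn (fun n => n);
  Fn_comp : forall f g, Fn f -> Fn g -> Fn (fun n => f (g n));
  Fn_sc : Fn sc;
  Fn_pr : forall f g, Fn f -> Fn g -> Fn (fun n => pr (f n) (g n));
  Fn_p1 : Fn p1;
  Fn_p2 : Fn p2;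
  sc_z : forall n, sc n <> z;
  sc_inj : forall m n, sc m = sc n -> m = n;
  Fn_ind : forall f, Fn f -> f z = z -> (forall n, f n = z -> f (sc n) = z) ->
    forall n, f n = z;
  Fn_eq : forall f g, Fn f -> Fn g -> exists h, Fn h /\ forall n, h n = z <-> f n = g n;
  Fn_imp : forall f g, Fn f -> Fn g ->
    exists h, Fn h /\ forall n, h n = z <-> (f n = z -> g n = z);
  Fn_all : forall f, Fn f -> exists h, Fn h /\ forall n, h n = z <-> forall m, f (pr n m) = z;
  Fn_fun : forall f, Fn f -> (forall n, exists m, f (pr n m) = z) ->
    exists h, Fn h /\ forall n, f (pr n (h n)) = z;
  Fn_rec : forall f g, Fn f -> Fn g -> exists h, Fn h /\ forall a, h (pr a z) = f a /\
    forall n, h (pr a (sc n)) = g (pr (pr a n) (h (pr a n)));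
  Fn_countable : exists e : nat -> nn -> nn, (forall i, Fn (e i)) /\
    forall f, Fn f -> exists i, e i = f }.
Arguments z {_}.

(* A type with distinguished N-indexed families ("curves"), as in
   quasi-Borel spaces. *)
Record qspace (M : aca) := Qspace {
  qcar :> Type;
  cur : (nn M -> qcar) -> Prop;
  cur_const : forall x, cur (fun _ => x);
  cur_comp : forall c f, cur c -> Fn f -> cur (fun n => c (f n)) }.
Arguments cur {M} q _.

(** * Definable predicates and arithmetic inside a model of ACA_0 *)

Section Definability.
Variable M : aca.
Local Notation nn := (nn M).
Local Notation z := (@z M).
Implicit Types X : qspace M.

Definition qnum : qspace M := Qspace (@Fn_const M) (@Fn_comp M).

Definition qprod (X : qspace M) : qspace M.
Proof.
refine (@Qspace M (X * nn) (fun c => cur X (fun n => fst (c n)) /\ Fn (fun n => snd (c n))) _ _).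
- by move=> x; split; [apply: cur_const|apply: Fn_const].
- move=> c f [h1 h2] hf; split; first exact: (cur_comp h1 hf).
  exact: (Fn_comp h2 hf).
Defined.

Definition Mor (X : qspace M) (t : X -> nn) : Prop := forall c, cur X c -> Fn (fun n => t (c n)).
(** A predicate on objects of any type is tested only along curves, where it must cut out a set of
    S. Arithmetical comprehension thereby becomes available for predicates of higher-type
    objects. *)
Definition Def (X : qspace M) (P : X -> Prop) : Prop :=
  forall c, cur X c -> exists h, Fn h /\ forall n, h n = z <-> P (c n).

Lemma Mor_id : Mor (X := qnum) (fun x => x).
Proof. by move=> c. Qed.
Lemma Mor_const X a : Mor (X := X) (fun _ => a).
Proof. by move=> c _; apply: Fn_const. Qed.
Lemma Mor_snd X : Mor (X := qprod X) (fun p => snd p).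
Proof. by move=> c []. Qed.
Lemma Mor_fst X (t : X -> nn) : Mor t -> Mor (X := qprod X) (fun p => t (fst p)).
Proof. by move=> h c [hc _]; apply: (h _ hc). Qed.
Lemma Mor_fn X f (t : X -> nn) : Fn f -> Mor t -> Mor (fun x => f (t x)).
Proof. by move=> hf h c hc; apply: (Fn_comp hf (h _ hc)). Qed.
Lemma Mor_pr X (t u : X -> nn) : Mor t -> Mor u -> Mor (fun x => pr (t x) (u x)).
Proof. by move=> ht hu c hc; apply: (Fn_pr (ht _ hc) (hu _ hc)). Qed.

Lemma Def_ext X (P Q : X -> Prop) : (forall x, P x <-> Q x) -> Def P -> Def Q.
Proof. by move=> e d c hc; have [h [hf hP]] := d c hc; exists h; split=> // n; rewrite hP. Qed.
Lemma Def_eq X (t u : X -> nn) : Mor t -> Mor u -> Def (fun x => t x = u x).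
Proof. by move=> ht hu c hc; apply: Fn_eq (ht _ hc) (hu _ hc). Qed.
Lemma Def_imp X (P Q : X -> Prop) : Def P -> Def Q -> Def (fun x => P x -> Q x).
Proof.
move=> hP hQ c hc; have [f [hf fP]] := hP c hc; have [g [hg gQ]] := hQ c hc.
have [h [hh e]] := Fn_imp hf hg; exists h; split=> // n; by rewrite e fP gQ.
Qed.
Lemma Def_False X : Def (X := X) (fun _ => False).
Proof.
move=> c _; exists (fun _ => sc z); split; first exact: Fn_const.
by move=> n; split=> // /sc_z.
Qed.
Lemma Def_not X (P : X -> Prop) : Def P -> Def (fun x => ~ P x).
Proof. by move=> h; apply: Def_imp h (@Def_False X). Qed.
Lemma Def_and X (P Q : X -> Prop) : Def P -> Def Q -> Def (fun x => P x /\ Q x).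
Proof.
move=> hP hQ; apply: (Def_ext (P := fun x => ~ (P x -> ~ Q x))); first by move=> x; tauto.
by apply: Def_not; apply: Def_imp => //; apply: Def_not.
Qed.
Lemma Def_or X (P Q : X -> Prop) : Def P -> Def Q -> Def (fun x => P x \/ Q x).
Proof.
move=> hP hQ; apply: (Def_ext (P := fun x => ~ P x -> Q x)); first by move=> x; tauto.
by apply: Def_imp => //; apply: Def_not.
Qed.
Lemma Def_iff X (P Q : X -> Prop) : Def P -> Def Q -> Def (fun x => P x <-> Q x).
Proof. by move=> hP hQ; apply: Def_and; apply: Def_imp. Qed.
Lemma Def_all X (P : X -> nn -> Prop) :
  Def (X := qprod X) (fun p => P (fst p) (snd p)) -> Def (fun x => forall n, P x n).
Proof.
move=> d c hc.
(* Reindexing by pairs gives a single curve that runs through all points of [c] together with all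
   values of the quantified number. *)
have hc' : cur (qprod X) (fun n => (c (p1 n), p2 n)).
  by split; [apply: (cur_comp hc); apply: Fn_p1|apply: Fn_p2].
have [f [hf fP]] := d _ hc'; have [h [hh e]] := Fn_all hf; exists h; split=> // n.
rewrite e; split=> k m; first by have := proj1 (fP _) (k m); rewrite /= p1_pr p2_pr.
by apply/fP; rewrite /= p1_pr p2_pr.
Qed.
Lemma Def_ex X (P : X -> nn -> Prop) :
  Def (X := qprod X) (fun p => P (fst p) (snd p)) -> Def (fun x => exists n, P x n).
Proof.
move=> d; apply: (Def_ext (P := fun x => ~ forall n, ~ P x n)).
  move=> x; split=> [h|[n hn] h]; last exact: (h n).
  by apply: NNPP => h'; apply: h => n hn; apply: h'; exists n.
by apply: Def_not; apply: Def_all; apply: Def_not.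
Qed.
Lemma Def_comp X (P : nn -> Prop) (t : X -> nn) :
  Def (X := qnum) P -> Mor t -> Def (fun x => P (t x)).
Proof. by move=> hP ht c hc; apply: (hP (fun n => t (c n))); apply: ht. Qed.
(** Choice inside S yields some function of witnesses along a curve; uniqueness of the witness
    identifies it with [t]. *)
Lemma Mor_choice X (P : X -> nn -> Prop) (t : X -> nn) :
  Def (X := qprod X) (fun p => P (fst p) (snd p)) ->
  (forall x, P x (t x)) -> (forall x m, P x m -> m = t x) -> Mor t.
Proof.
move=> d ex un c hc.
have hc' : cur (qprod X) (fun n => (c (p1 n), p2 n)).
  by split; [apply: (cur_comp hc); apply: Fn_p1|apply: Fn_p2].
have [f [hf fP]] := d _ hc'.
have [|h [hh e]] := Fn_fun hf.
  by move=> n; exists (t (c n)); apply/fP; rewrite /= p1_pr p2_pr.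
suff -> : (fun n => t (c n)) = h by [].
apply: functional_extensionality => n; symmetry; apply: un.
by have := proj1 (fP _) (e n); rewrite /= p1_pr p2_pr.
Qed.

Lemma nn_ind (P : nn -> Prop) : Def (X := qnum) P -> P z -> (forall n, P n -> P (sc n)) ->
  forall n, P n.
Proof.
move=> d Pz Ps; have [f [hf fP]] := d _ (Fn_id M) => n.
by apply/fP; apply: Fn_ind hf _ _ n => [|n /fP h]; apply/fP => //; apply: Ps.
Qed.

(** [aca] has no addition of its own; it is obtained from recursion with the first summand as
    parameter. The two equations are all that is used of the function picked by [epsilon]. *)
Definition add_spec (h : nn -> nn) : Prop :=
  Fn h /\ forall a, h (pr a z) = a /\ forall n, h (pr a (sc n)) = sc (h (pr a n)).
Lemma add_ex : exists h, add_spec h.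
Proof.
have [|h [hh e]] := Fn_rec (Fn_id M) (g := fun n => sc (p2 n)).
  by apply: Fn_comp; [apply: Fn_sc|apply: Fn_p2].
by exists h; split=> // a; case: (e a) => -> e'; split=> // n; rewrite e' p2_pr.
Qed.
Definition plus (a b : nn) : nn := epsilon (inhabits (fun n => n)) add_spec (pr a b).
Lemma plus_spec : add_spec (epsilon (inhabits (fun n => n)) add_spec).
Proof. exact: (epsilon_spec (inhabits (fun n => n)) _ add_ex). Qed.
Lemma plus_z a : plus a z = a.
Proof. exact: (proj1 (proj2 plus_spec a)). Qed.
Lemma plus_sc a n : plus a (sc n) = sc (plus a n).
Proof. exact: (proj2 (proj2 plus_spec a)). Qed.
Lemma Mor_plus X (t u : X -> nn) : Mor t -> Mor u -> Mor (fun x => plus (t x) (u x)).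
Proof. by move=> ht hu; apply: Mor_fn; [case: plus_spec|apply: Mor_pr]. Qed.
Lemma Mor_sc X (t : X -> nn) : Mor t -> Mor (fun x => sc (t x)).
Proof. by move=> ht; apply: Mor_fn => //; apply: Fn_sc. Qed.
Lemma Mor_p1 X (t : X -> nn) : Mor t -> Mor (fun x => p1 (t x)).
Proof. by move=> ht; apply: Mor_fn => //; apply: Fn_p1. Qed.
Lemma Mor_p2 X (t : X -> nn) : Mor t -> Mor (fun x => p2 (t x)).
Proof. by move=> ht; apply: Mor_fn => //; apply: Fn_p2. Qed.

Definition le (a b : nn) : Prop := exists k, plus a k = b.
Definition lt (a b : nn) : Prop := le (sc a) b.

Ltac mor := first [apply: Mor_id | apply: Mor_const
  | by (let h := fresh in move=> ? /= h; decompose [and] h; assumption)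
  | apply: Mor_sc; mor | apply: Mor_p1; mor | apply: Mor_p2; mor
  | apply: Mor_plus; mor | apply: Mor_pr; mor | apply: Mor_fn; [assumption|mor] ].

Lemma Def_le X (t u : X -> nn) : Mor t -> Mor u -> Def (fun x => le (t x) (u x)).
Proof.
move=> ht hu; apply: Def_ex; apply: Def_eq; last exact: Mor_fst.
by apply: Mor_plus; [apply: Mor_fst|apply: Mor_snd].
Qed.
Lemma Def_lt X (t u : X -> nn) : Mor t -> Mor u -> Def (fun x => lt (t x) (u x)).
Proof. by move=> ht hu; apply: Def_le => //; apply: Mor_sc. Qed.

Ltac def := first [apply: Def_False
  | apply: Def_not; def | apply: Def_imp; def | apply: Def_and; def | apply: Def_or; def
  | apply: Def_iff; def
  | apply: Def_le; mor | apply: Def_lt; mor | apply: Def_all; def | apply: Def_ex; def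
  | apply: Def_eq; mor | apply: Def_comp; [assumption|mor] ].

Lemma plus_zl a : plus z a = a.
Proof. by elim/nn_ind: a => [||n e]; [def|rewrite plus_z|rewrite plus_sc e]. Qed.
Lemma plus_scl a b : plus (sc a) b = sc (plus a b).
Proof. by elim/nn_ind: b => [||n e]; [def|rewrite !plus_z|rewrite !plus_sc e]. Qed.
Lemma plus_assoc a b c : plus a (plus b c) = plus (plus a b) c.
Proof. by elim/nn_ind: c => [||n e]; [def|rewrite !plus_z|rewrite !plus_sc e]. Qed.
Lemma nn_case a : a = z \/ exists b, a = sc b.
Proof. elim/nn_ind: a => [||n _]; [def|by left|by right; exists n]. Qed.
Lemma plus_eq_l a k : plus a k = a -> k = z.
Proof.
elim/nn_ind: a => [||n IH]; [def|by rewrite plus_zl|].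
by rewrite plus_scl => /sc_inj.
Qed.

Lemma le_refl a : le a a.
Proof. by exists z; rewrite plus_z. Qed.
Lemma le_trans a b c : le a b -> le b c -> le a c.
Proof. by move=> [k <-] [l <-]; exists (plus k l); rewrite plus_assoc. Qed.
Lemma le_z a : le z a.
Proof. by exists a; rewrite plus_zl. Qed.
Lemma le_sc a : le a (sc a).
Proof. by exists (sc z); rewrite plus_sc plus_z. Qed.
Lemma le_scr a b : le a (sc b) <-> le a b \/ a = sc b.
Proof.
split=> [[k]|[h| ->]]; last exact: le_refl; last exact: le_trans h (le_sc b).
case: (nn_case k) => [->|[l ->]]; first by rewrite plus_z; right.
by rewrite plus_sc => /sc_inj <-; left; exists l.
Qed.
Lemma le_sc2 a b : le (sc a) (sc b) <-> le a b.
Proof.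
split=> [[k]|[k <-]]; last by exists k; rewrite plus_scl.
by rewrite plus_scl => /sc_inj <-; exists k.
Qed.
Lemma lt_irr a : ~ lt a a.
Proof.
move=> [k]; rewrite plus_scl -plus_sc => /plus_eq_l; exact: sc_z.
Qed.
Lemma lt_z a : ~ lt a z.
Proof. by move=> [k]; rewrite plus_scl => /sc_z. Qed.
Lemma lt_sc a b : lt a (sc b) <-> lt a b \/ a = b.
Proof.
rewrite /lt le_scr; split=> -[h|h]; [by left|by right; apply: sc_inj|by left|by right; rewrite h].
Qed.
Lemma le_lt a b : le a b \/ lt b a.
Proof.
elim/nn_ind: b => [||b [h|h]].
- def.
- by case: (nn_case a) => [->|[b ->]]; [left; apply: le_refl|right; rewrite /lt le_sc2; apply: le_z].
- by left; apply: le_trans h (le_sc b).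
- case: h => k <-; case: (nn_case k) => [->|[l ->]]; [left|right].
    by rewrite plus_z; apply: le_refl.
  by exists l; rewrite plus_scl -plus_scl plus_scl plus_sc plus_scl.
Qed.
Lemma lt_le a b : lt a b -> le a b.
Proof. exact: le_trans (le_sc a). Qed.
Lemma le_antisym a b : le a b -> le b a -> a = b.
Proof.
move=> [k <-]; case: (nn_case k) => [->|[l ->]]; first by rewrite plus_z.
by rewrite plus_sc -plus_scl => h; case: (@lt_irr a); apply: le_trans h; exists l.
Qed.
Lemma ub2 a b : exists c, le a c /\ le b c.
Proof. by case: (le_lt a b) => [h|/lt_le h]; [exists b|exists a]; split=> //; apply: le_refl. Qed.

Lemma least (P : nn -> Prop) : Def (X := qnum) P -> (exists n, P n) ->
  exists n, P n /\ forall m, lt m n -> ~ P m.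
Proof.
move=> d [n hn]; apply: NNPP => no.
have h : forall k m, lt m k -> ~ P m.
  elim/nn_ind=> [|m /lt_z //|k IH m]; first by def.
  rewrite lt_sc => -[|->]; first exact: IH.
  by move=> Pk; apply: no; exists k.
exact: (h (sc n) n (le_refl _)).
Qed.

(** Infinite and finite mean unbounded and bounded in the order of the model, which may be
    nonstandard. *)
Definition Inf (P : nn -> Prop) : Prop := forall n, exists k, lt n k /\ P k.
Definition almost (P Q : nn -> Prop) : Prop := exists b, forall m, P m -> le b m -> Q m.

(** * Cohesive sets by arithmetical comprehension *)

Section Cohesive.
Variables (X : nn -> nn) (hX : @Fn M X) (Y : nn -> Prop) (hY : Def (X := qnum) Y).

(** [X] codes a sequence of sets. A pattern of membership in its first [n] sets is represented by
    any number realising the pattern, which avoids coding finite binary sequences in the model. *)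
Let bit i m : Prop := X (pr i m) = z.
Let agree n x y : Prop := forall i, lt i n -> (bit i x <-> bit i y).
Let good n x : Prop := forall b, exists y, lt b y /\ Y y /\ agree n x y.
(* [x] is good below [n], and its first [n] bits are as large as possible in
   the lexicographic order among good elements. *)
Let lgood n x : Prop := good n x /\
  forall i, lt i n -> ~ bit i x -> ~ exists w, agree i w x /\ bit i w /\ good (sc i) w.

Lemma agree_sym n x y : agree n x y -> agree n y x.
Proof. by move=> h i hi; rewrite h. Qed.
Lemma agree_trans n x y w : agree n x y -> agree n y w -> agree n x w.
Proof. by move=> h h' i hi; rewrite h // h'. Qed.
Lemma agree_le m n x y : le m n -> agree n x y -> agree m x y.
Proof. by move=> l h i hi; apply: h; apply: le_trans hi l. Qed.
Lemma agree_sc n x y : agree n x y -> (bit n x <-> bit n y) -> agree (sc n) x y.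
Proof. by move=> h e i; rewrite lt_sc => -[/h|->]. Qed.
Lemma good_agree n x y : agree n x y -> good n x -> good n y.
Proof.
move=> a g b; have [w [l [Yw h]]] := g b; exists w; do 2 split=> //.
by apply: agree_trans h; apply: agree_sym.
Qed.
Lemma good_le m n x : le m n -> good n x -> good m x.
Proof.
move=> l g b; have [y [h [Yy a]]] := g b; exists y; do 2 split=> //; exact: agree_le a.
Qed.
Lemma lgood_agree n x y : agree n x y -> lgood n x -> lgood n y.
Proof.
move=> a [g h]; split; first exact: good_agree a g.
move=> i hi nb [w [aw [bw gw]]]; apply: (h i hi); first by rewrite (a i hi).
exists w; split=> //; apply: agree_trans aw _; apply: agree_sym; apply: agree_le a; exact: lt_le.
Qed.
Lemma lgood_le m n x : le m n -> lgood n x -> lgood m x.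
Proof.
move=> l [g h]; split; first exact: good_le g.
by move=> i hi; apply: h; apply: le_trans l.
Qed.
(** At the first bit where the two patterns differ, the number with the bit off is beaten by the
    other one, against maximality. *)
Lemma lgood_unique n x y : lgood n x -> lgood n y -> agree n x y.
Proof.
move=> lx ly.
suff h : forall i, le i n -> agree i x y by apply: h; apply: le_refl.
elim/nn_ind=> [|_ i /lt_z //|i IH hi].
  rewrite /agree /bit; def.
have a : agree i x y by apply: IH; apply: lt_le.
apply: agree_sc => //; split=> b; apply: NNPP => nb.
- by case: ly => _ /(_ i hi nb); case; exists x; do 2 split=> //; case: lx => gx _; apply: good_le gx.
- case: lx => _ /(_ i hi nb); case; exists y; split; first exact: agree_sym.
  by split=> //; case: ly => gy _; apply: good_le gy.
Qed.
(** A maximal pattern of length [n] is extended by bit [n] on if that is still good. Otherwise,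
    beyond some bound no element of [Y] with the pattern has the bit on, so the extension with the
    bit off is good. *)
Lemma lgood_ex : Inf Y -> forall n, exists x, lgood n x.
Proof.
move=> infY; elim/nn_ind => [||n [x lx]].
  rewrite /lgood /good /agree /bit; def.
  exists z; split; last by move=> i /lt_z.
  by move=> b; have [y [h Yy]] := infY b; exists y; do 2 split=> //; move=> i /lt_z.
case: (classic (exists w, agree n w x /\ bit n w /\ good (sc n) w)).
  move=> [w [a [bw gw]]]; exists w; split=> // i; rewrite lt_sc => -[hi|->] // nb.
  by case: (lgood_agree (agree_sym a) lx) => _; apply.
move=> no.
have [b hb] : exists b, forall y, lt b y -> Y y -> agree n x y -> ~ bit n y.
  apply: NNPP => nob; apply: no.
  have inf : forall b, exists y, lt b y /\ Y y /\ agree n x y /\ bit n y.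
    move=> b; apply: NNPP => h; apply: nob; exists b => y l Yy a by_; apply: h.
    by exists y.
  have [w [_ [Yw [aw bw]]]] := inf z; exists w; split; first exact: agree_sym.
  split=> // b; have [y [l [Yy [a by_]]]] := inf b; exists y; do 2 split=> //.
  apply: agree_sc => //; apply: agree_trans (agree_sym aw) a.
have [gx _] := lx; have [w [lw [Yw aw]]] := gx b; have nw := hb w lw Yw aw.
exists w; split.
  move=> c; have [d [bd cd]] := ub2 b c; have [y [l [Yy a]]] := gx d.
  have lb : lt b y by apply: le_trans l; rewrite le_sc2.
  exists y; split; first by apply: le_trans l; rewrite le_sc2.
  split=> //; apply: agree_sc; first exact: agree_trans (agree_sym aw) a.
  by split=> h; [case: nw|case: (hb y lb Yy a)].
move=> i; rewrite lt_sc => -[hi|-> _]; first by apply: (proj2 (lgood_agree aw lx)).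
move=> [v [av [bv gv]]]; apply: no; exists v; split=> //.
exact: agree_trans av (agree_sym aw).
Qed.

(** The lexicographic rule singles out one pattern per length, up to the choice of the number
    representing it. Everything is thus arithmetical in [X] and [Y], and no infinite sequence of
    choices has to be formed. *)
Lemma cohesive : Inf Y -> exists Z : nn -> Prop, Def (X := qnum) Z /\ Inf Z /\
  (forall m, Z m -> Y m) /\
  forall i, almost Z (fun m => X (pr i m) = z) \/ almost Z (fun m => X (pr i m) <> z).
Proof.
move=> infY; have ex := lgood_ex infY.
(* The conjunct [le n m] pushes the least element of [C n] upwards with [n]; this makes the set of
   least elements unbounded. *)
pose C n m := Y m /\ lgood n m /\ le n m.
have Cex n b : exists m, C n m /\ lt b m.
  have [x lx] := ex n; have [g _] := lx; have [c [nc bc]] := ub2 n b.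
  have [y [l [Yy a]]] := g c; exists y; split; last by apply: le_trans l; rewrite le_sc2.
  split=> //; split; first exact: lgood_agree a lx.
  by apply: le_trans nc _; apply: lt_le.
have dC n : Def (X := qnum) (C n) by rewrite /C /lgood /good /agree /bit; def.
(* The least elements of the decreasing sets [C n]: all but finitely many of
   them lie in any given [C n]. *)
exists (fun m => exists n, C n m /\ forall j, lt j m -> ~ C n j); split; [|split; [|split]].
- rewrite /C /lgood /good /agree /bit; def.
- move=> b; have [m [Cm hm]] : exists m, C (sc b) m /\ forall j, lt j m -> ~ C (sc b) j.
    by apply: least => //; have [m [Cm _]] := Cex (sc b) z; exists m.
  by exists m; split; [case: Cm => _ []|exists (sc b)].
- by move=> m [n [[]]].
- move=> i; have [x lx] := ex (sc i); have [m0 [Cm0 _]] := Cex (sc i) z.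
  (* If [m] is least in [C n] with [n] at most [i], then [m0] lies in [C n] as well, so [m] cannot
     exceed [m0]. Past [m0] only larger [n] occur, where bit [i] is already fixed. *)
  have key : forall m, (exists n, C n m /\ forall j, lt j m -> ~ C n j) -> le (sc m0) m ->
      (bit i m <-> bit i x).
    move=> m [n [[_ [ln _]] hj]] lm.
    suff li : le (sc i) n.
      by apply: (lgood_unique (lgood_le li ln) lx); apply: le_refl.
    case: (le_lt (sc i) n) => // l; case: (hj m0 lm).
    case: Cm0 => Y0 [l0 e0]; split=> //; split; first exact: lgood_le (lt_le l) l0.
    by apply: le_trans e0; apply: lt_le.
  case: (classic (bit i x)) => bx; [left|right]; exists (sc m0) => m Zm lm.
  + by apply/(key m Zm lm).
  + by move=> h; apply: bx; apply/(key m Zm lm).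
Qed.
End Cohesive.

Lemma Inf_all : Inf (fun _ => True).
Proof. by move=> n; exists (sc n); split=> //; apply: le_refl. Qed.

(** The recursion runs in the metatheory along an external enumeration of S: stage [i] makes the
    chain cohesive for the sequence coded by the function number [i]. *)
Lemma generic_chain : exists Y : nat -> nn -> Prop,
  (forall i, Def (X := qnum) (Y i) /\ Inf (Y i)) /\
  (forall i m, Y (S i) m -> Y i m) /\
  forall A : nn -> nn, Fn A -> exists i, forall n,
    almost (Y i) (fun m => A (pr n m) = z) \/ almost (Y i) (fun m => A (pr n m) <> z).
Proof.
have [e [he ce]] := Fn_countable M.
pose St := {Y : nn -> Prop | Def (X := qnum) Y /\ Inf Y}.
pose R i (Y Z : nn -> Prop) := (forall m, Z m -> Y m) /\
  forall n, almost Z (fun m => e i (pr n m) = z) \/ almost Z (fun m => e i (pr n m) <> z).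
have step i (Y : St) : exists Z : St, R i (proj1_sig Y) (proj1_sig Z).
  case: Y => Y [dY infY]; have [Z [dZ [infZ h]]] := cohesive (he i) dY infY.
  by exists (exist _ Z (conj dZ infZ)).
pose nxt i Y := proj1_sig (constructive_indefinite_description _ (@step i Y)).
have nxtP i Y : R i (proj1_sig Y) (proj1_sig (nxt i Y)).
  exact: proj2_sig (constructive_indefinite_description _ (@step i Y)).
have dT : Def (X := qnum) (fun _ => True).
  by apply: (Def_ext (P := fun _ => ~ False)); [tauto|def].
pose Y := nat_rect (fun _ => St) (exist _ _ (conj dT Inf_all)) nxt.
exists (fun i => proj1_sig (Y i)); split; first by move=> i; exact: (proj2_sig (Y i)).
split; first by move=> i; apply: (proj1 (nxtP i (Y i))).
move=> A /ce[i <-]; exists (S i); exact: (proj2 (nxtP i (Y i))).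
Qed.
End Definability.

(** * The functional model *)

Section FunctionalModel.
Variable M : aca.
Local Notation nn := (nn M).
Local Notation z := (@z M).
Implicit Types X Y : qspace M.

(** The reparametrisation [f] closes the curves under change of index. It also allows [c] to be
    applied to arguments that depend on more than the index of [c], which currying requires. *)
Definition qexp X Y : qspace M.
Proof.
refine (@Qspace M {f : X -> Y | forall c, cur X c -> cur Y (fun n => f (c n))}
  (fun c => forall f d, Fn f -> cur X d -> cur Y (fun n => proj1_sig (c (f n)) (d n))) _ _).
- by move=> [f hf] g d _; apply: hf.
- by move=> c f hc hf g d hg hd; apply: (hc (fun n => f (g n))) => //; apply: Fn_comp.
Defined.

Definition qapp X Y (f : qexp X Y) (x : X) : Y := proj1_sig f x.
Definition qfun X Y (f : X -> Y) (h : forall c, cur X c -> cur Y (fun n => f (c n))) :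
  qexp X Y := exist _ f h.

Lemma qexp_eq X Y (f g : qexp X Y) : (forall x, qapp f x = qapp g x) -> f = g.
Proof.
case: f g => f hf [g hg] e.
have e' : f = g by apply: functional_extensionality.
by subst g; congr exist; apply: proof_irrelevance.
Qed.

Lemma cur_app X Y c d : cur (qexp X Y) c -> cur X d -> cur Y (fun n => qapp (c n) (d n)).
Proof. by move=> hc hd; apply: (hc (fun n => n) d (Fn_id M) hd). Qed.

Fixpoint qs (s : ty) : qspace M :=
  match s with N => qnum M | Arr r s => qexp (qs r) (qs s) end.
Arguments qs : simpl never.

Definition ap s t (f : qs (s ~> t)) (x : qs s) : qs t := qapp (f : qexp (qs s) (qs t)) x.

Definition rec_spec (y : nn) (F : qs (N ~> N ~> N)) (h : nn -> nn) : Prop :=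
  Fn h /\ h z = y /\ forall n, h (sc n) = ap (ap F (h n : qs N)) (n : qs N).
Definition rec (y : nn) (F : qs (N ~> N ~> N)) : nn -> nn :=
  epsilon (inhabits (fun n => n)) (rec_spec y F).

(** For the recursor to be admissible, recursion must stay in S when start value and step functional
    vary along a curve. The index of the curve serves as the parameter of recursion in S, and
    induction in the model shows that the result agrees with [rec]. *)
Lemma rec_curve (x y : nn -> nn) (F : nn -> qs (N ~> N ~> N)) : Fn y -> cur (qs _) F ->
  (forall a, rec_spec (y a) (F a) (rec (y a) (F a))) /\ (Fn x -> Fn (fun a => rec (y a) (F a) (x a))).
Proof.
move=> hy hF.
(* [k] stands for [pr (pr a n) v]: the index [a] on the curve, the position [n] of the recursion and
   the previous value [v]. *)
pose g k := ap (ap (F (p1 (p1 k))) (p2 k : qs N)) (p2 (p1 k) : qs N).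
have hg : Fn g.
  apply: (cur_app (X := qnum M) (Y := qnum M)); last first.
    by apply: Fn_comp; [apply: Fn_p2|apply: Fn_p1].
  apply: (cur_app (X := qnum M) (Y := qexp (qnum M) (qnum M))); last exact: Fn_p2.
  by apply: (cur_comp hF); apply: Fn_comp; apply: Fn_p1.
have [h [hh e]] := Fn_rec hy hg.
have spec a : rec_spec (y a) (F a) (fun n => h (pr a n)).
  split; first by apply: Fn_comp => //; apply: Fn_pr; [apply: Fn_const|apply: Fn_id].
  by case: (e a) => -> e'; split=> // n; rewrite e' /g !(p1_pr, p2_pr).
have spec' a : rec_spec (y a) (F a) (rec (y a) (F a)).
  by apply: (epsilon_spec (inhabits (fun n => n))); exists (fun n => h (pr a n)).
split=> // hx; suff -> : (fun a => rec (y a) (F a) (x a)) = (fun a => h (pr a (x a))).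
  by apply: Fn_comp => //; apply: Fn_pr => //; apply: Fn_id.
apply: functional_extensionality => a; move: (x a) => n.
have [f1 [a1 b1]] := spec' a; have [f2 [a2 b2]] := spec a.
apply: (@nn_ind M (fun n => rec (y a) (F a) n = h (pr a n))) => [||k ek].
- by apply: Def_eq => c hc; [apply: Fn_comp f1 hc|apply: Fn_comp f2 hc].
- by rewrite a1 a2.
- by rewrite b1 b2 ek.
Qed.

Lemma rec_z y F : rec y F z = y.
Proof. by case: (rec_curve (fun n => n) (Fn_const y) (cur_const F)) => /(_ z)[_ []]. Qed.
Lemma rec_sc y F n : rec y F (sc n) = ap (ap F (rec y F n : qs N)) (n : qs N).
Proof. by case: (rec_curve (fun n => n) (Fn_const y) (cur_const F)) => /(_ z)[_ []]. Qed.
Lemma Fn_rec_curve x y F : Fn x -> Fn y -> cur (qs _) F -> Fn (fun a => rec (y a) (F a) (x a)).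
Proof. by move=> hx hy hF; case: (rec_curve x hy hF) => _; apply. Qed.

Definition qSucc : qexp (qnum M) (qnum M) := @qfun (qnum M) (qnum M) (@sc M) (fun c hc => Fn_comp (Fn_sc M) hc).

Definition qPi X Y : qexp X (qexp Y X).
Proof.
refine (@qfun X (qexp Y X) (fun x => @qfun Y X (fun _ => x) (fun c _ => cur_const x)) _).
by move=> c hc f d hf _; apply: (cur_comp hc).
Defined.

Lemma cur_sigma X Y W (x : nn -> qexp X (qexp Y W)) (y : nn -> qexp X Y) w :
  cur _ x -> cur _ y -> cur _ w ->
  cur W (fun n => qapp (qapp (x n) (w n)) (qapp (y n) (w n))).
Proof. by move=> hx hy hw; apply: cur_app; apply: cur_app. Qed.

Definition qSigma X Y W : qexp (qexp X (qexp Y W)) (qexp (qexp X Y) (qexp X W)).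
Proof.
unshelve refine (@qfun _ _ (fun x => @qfun _ _ (fun y =>
  @qfun X W (fun w => qapp (qapp x w) (qapp y w)) _) _) _).
- by move=> w hw; apply: cur_sigma => //; apply: cur_const.
- move=> y hy f w hf hw; apply: cur_sigma => //; first exact: cur_const.
  exact: (cur_comp hy).
- move=> x hx f y hf hy g w hg hw; apply: cur_sigma => //; last exact: (cur_comp hy).
  by apply: (cur_comp (cur_comp hx hf)).
Defined.

Definition qRec : qs (N ~> N ~> (N ~> N ~> N) ~> N).
Proof.
unshelve refine (@qfun (qnum M) _ (fun x => @qfun (qnum M) _ (fun y =>
  @qfun (qs (N ~> N ~> N)) (qnum M) (fun F => rec y F x) _) _) _).
- by move=> F hF; apply: Fn_rec_curve => //; apply: Fn_const.
- move=> y hy f F hf hF; apply: Fn_rec_curve => //; first exact: Fn_const.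
  exact: (Fn_comp hy).
- move=> x hx f y hf hy g F hg hF; apply: Fn_rec_curve => //; last exact: (Fn_comp hy).
  by apply: (Fn_comp (Fn_comp hx hf)).
Defined.

Fixpoint fev G s (t : wtm G s) (r : forall u, var G u -> qs u) : qs s :=
  match t in wtm _ s return qs s with
  | Var v => r _ v
  | Zero => z
  | Succ => qSucc
  | Pi => qPi _ _
  | Sigma => qSigma _ _ _
  | Rec => qRec
  | App t u => ap (fev t r) (fev u r)
  end.

Definition fmodel : model Lomega.
Proof.
refine (@Model Lomega qs fev eq _ _) => //.
move=> G D sg s t r; elim: t => //= ? ? t IHt u IHu; by rewrite IHt IHu.
Defined.

Local Notation "x ;; r" := (@econs ty (dom fmodel) _ _ x r) (at level 60, right associativity).

Local Notation "x ;0 r" := (@econs ty (dom fmodel) _ N x r) (at level 60, right associativity).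

Lemma fev_shift G s u (t : wtm G s) (x : qs u) (r : env fmodel G) : fev (wshift u t) (x ;; r) = fev t r.
Proof. exact: (ev_tsub (m := fmodel) (fun s v => Var (vs v)) t (x ;; r)). Qed.

Lemma lam_beta G s u (t : wtm (u :: G) s) (r : env fmodel G) x :
  ap (fev (lam t) r) x = fev t (x ;; r).
Proof.
elim: t => //= [s' v|a b t IHt t' IHt'].
- by move: s' v; apply: var_cons_ind.
- by rewrite -IHt -IHt'.
Qed.

(** Elements of an exponential are actual functions, so extensional equality is identity; the
    extensionality axioms then hold trivially. *)
Lemma sat_eqt s : forall G (t u : wtm G s) (r : env fmodel G), sat (eqt t u) r <-> fev t r = fev u r.
Proof.
elim: s => [|s1 _ s2 IH] G t u r //=; split=> [h|e x].
- apply: qexp_eq => x; have := proj1 (IH _ _ _ _) (h x).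
  by rewrite /= !fev_shift.
- by apply/IH; rewrite /= !fev_shift e.
Qed.

Definition qenv (G : list ty) : qspace M.
Proof.
refine (@Qspace M (env fmodel G) (fun c => forall u v, cur (qs u) (fun n => c n u v)) _ _).
- by move=> r u v; apply: cur_const.
- by move=> c f hc hf u v; apply: (cur_comp (hc u v) hf).
Defined.

Lemma cur_econs G s (c : nn -> qs s) (r : nn -> env fmodel G) : cur (qs s) c -> cur (qenv G) r ->
  cur (qenv (s :: G)) (fun n => c n ;; r n).
Proof. by move=> hc hr; apply: var_cons_ind => [|u v]; [apply: hc|apply: hr]. Qed.

Lemma fev_curve G s (t : wtm G s) (r : nn -> env fmodel G) : cur (qenv G) r ->
  cur (qs s) (fun n => fev t (r n)).
Proof.
move=> hr; elim: t => [a v|||a b|a b c||a b t IHt u IHu].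
- exact: hr.
- exact: (cur_const (z : qs N)).
- exact: (cur_const (qSucc : qs (N ~> N))).
- exact: (cur_const (qPi _ _ : qs (a ~> b ~> a))).
- exact: (cur_const (qSigma _ _ _ : qs ((a ~> b ~> c) ~> (a ~> b) ~> a ~> c))).
- exact: (cur_const qRec).
- exact: (cur_app IHt IHu).
Qed.

(** Terms send curves of environments to curves, whatever the types of the parameters. Both
    quantifier-free induction and quantifier-free choice with higher-type parameters reduce to
    this. *)
Lemma Def_sat G (A : wfm G) : quantifier_free A -> Def (X := qenv G) (fun r => sat (M := fmodel) A r).
Proof.
elim: A => {G} [G t u|G|G A IA B IB|G A IA B IB|G A IA B IB|//|//] /= q.
- by apply: Def_eq => c hc; [apply: (fev_curve t hc)|apply: (fev_curve u hc)].
- exact: Def_False.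
- by case: q => ? ?; apply: Def_imp; [apply: IA|apply: IB].
- by case: q => ? ?; apply: Def_and; [apply: IA|apply: IB].
- by case: q => ? ?; apply: Def_or; [apply: IA|apply: IB].
Qed.

Lemma Def_cur X Y (P : Y -> Prop) (f : X -> Y) : Def (X := Y) P ->
  (forall c, cur X c -> cur Y (fun n => f (c n))) -> Def (X := X) (fun x => P (f x)).
Proof. by move=> hP hf c hc; apply: (hP _ (hf c hc)). Qed.

Definition least_such (P : nn -> Prop) (n : nn) : Prop := P n /\ forall m, lt m n -> ~ P m.
Definition mu_op (P : nn -> Prop) : nn := epsilon (inhabits z) (least_such P).

Lemma mu_op_spec P : Def (X := qnum M) P -> (exists n, P n) -> least_such P (mu_op P).
Proof. by move=> d /(least d) ex; apply: epsilon_spec. Qed.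

Lemma least_such_unique P m n : least_such P m -> least_such P n -> m = n.
Proof.
move=> [Pm hm] [Pn hn]; apply: le_antisym.
- by case: (le_lt m n) => // /hm.
- by case: (le_lt n m) => // /hn.
Qed.

Lemma Def_slice X (P : X -> nn -> Prop) x :
  Def (X := qprod X) (fun p => P (fst p) (snd p)) -> Def (X := qnum M) (P x).
Proof.
move=> d; refine (Def_cur (X := qnum M) (Y := qprod X) (f := fun n => (x, n)) d _) => c hc.
by split=> //; apply: cur_const.
Qed.

(** Being the least witness is arithmetical in [P] and determines the value, so unique choice
    applies. Both the choice functionals and mu are obtained this way. *)
Lemma Mor_mu X (P : X -> nn -> Prop) : Def (X := qprod X) (fun p => P (fst p) (snd p)) ->
  (forall x, exists n, P x n) -> Mor (fun x => mu_op (P x)).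
Proof.
move=> d ex; apply: (Mor_choice (P := fun x => least_such (P x))).
- rewrite /least_such; apply: Def_and => //; apply: Def_all; apply: Def_imp.
    by apply: Def_lt => c /= [[h1 h2] h3].
  apply: Def_not; apply: (Def_cur (X := qprod (qprod X)) (Y := qprod X) (f := fun p => (fst (fst p), snd p)) d).
  by move=> c [[h1 h2] h3].
- by move=> x; apply: mu_op_spec => //; apply: Def_slice.
- by move=> x m h; apply: least_such_unique h _; apply: mu_op_spec => //; apply: Def_slice.
Qed.

Lemma fmodel_AC G (A : wfm (N :: T1 :: G)) (r : env fmodel G) : quantifier_free A ->
  (forall f : qs T1, exists x : nn, sat (M := fmodel) A (x ;0 f ;; r)) ->
  exists F : qs T2, forall f : dom fmodel T1, sat (M := fmodel) A (ap F f ;0 f ;; r).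
Proof.
move=> q ex.
pose P (f : qs T1) (x : nn) := sat (M := fmodel) A (x ;0 f ;; r).
have dP : Def (X := qprod (qs T1)) (fun p => P (fst p) (snd p)).
  refine (Def_cur (X := qprod (qs T1)) (Y := qenv (N :: T1 :: G))
    (f := fun p => snd p ;0 fst p ;; r) (Def_sat q) _) => c [h1 h2].
  by apply: cur_econs => //; apply: cur_econs => // u v; apply: cur_const.
exists (@qfun (qs T1) (qnum M) (fun f => mu_op (P f)) (Mor_mu dP ex)) => f.
by case: (mu_op_spec (Def_slice f dP) (ex f)).
Qed.

Lemma fmodel_induction G (A : wfm (N :: G)) (r : env fmodel G) : quantifier_free A ->
  sat (M := fmodel) A (z ;0 r) ->
  (forall n : nn, sat (M := fmodel) A (n ;0 r) ->
     sat (M := fmodel) A (sc n ;0 r)) ->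
  forall n : nn, sat (M := fmodel) A (n ;0 r).
Proof.
move=> q; apply: nn_ind.
refine (Def_cur (X := qnum M) (Y := qenv (N :: G)) (f := fun n => n ;0 r) (Def_sat q) _) => c hc.
by apply: cur_econs => // u v; apply: cur_const.
Qed.

Theorem fmodel_RCA0w G (A : wfm G) : RCA0w A -> forall r : env fmodel G, sat A r.
Proof.
case=> {G A} /=.
- by [].
- by [].
- by move=> G x y w r -> ->.
- by move=> G x r /sc_z.
- by move=> G x y r /sc_inj.
- by move=> G s t x y r; apply/sat_eqt.
- by move=> G s t u x y w r; apply/sat_eqt.
- by move=> G y w r; apply: rec_z.
- by move=> G x y w r; apply: rec_sc.
- move=> G A q r /= [h0 hs]; apply: fmodel_induction => //.
    by move: h0 => /sat_inst.
  move=> n /hs /sat_fsub; congr (sat _ _).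
  by apply: env_cons_ext.
- by move=> G s t w x y r /sat_eqt e; apply/sat_eqt; rewrite /= e.
- move=> G A q r /= /(fmodel_AC q)[F hF]; exists F => f; apply/sat_fsub.
  move: (hF f); congr (sat _ _).
  by apply: env_cons_ext => //; apply: var_cons_ind.
Qed.

End FunctionalModel.

(** * The functional model satisfies (mu) and (U) *)

Opaque lam.

Section FunctionalAxioms.
Variable M : aca.
Local Notation nn := (nn M).
Local Notation z := (@z M).
Local Notation FM := (fmodel M).
Local Notation qs := (qs M).
Implicit Types (G : list ty).
Local Notation "x ;; r" := (@econs ty (dom FM) _ _ x r) (at level 60, right associativity).
Local Notation "x ;0 r" := (@econs ty (dom FM) _ N x r) (at level 60, right associativity).





Ltac beta := repeat match goal with
  |- context [ap (fev (@lam ?G ?u ?s ?t) ?r) ?x] => rewrite (@lam_beta M G s u t r x) /= end.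

Lemma fev_pred_z G (r : env FM G) : ap (fev pred r) (z : qs N) = z.
Proof. by rewrite /pred; beta; apply: rec_z. Qed.
Lemma fev_pred_sc G (r : env FM G) (n : nn) : ap (fev pred r) (sc n : qs N) = n.
Proof. by rewrite /pred; beta; etransitivity; [apply: rec_sc|beta]. Qed.

Lemma rec_plus (F : qs (N ~> N ~> N)) (a b : nn) :
  (forall v i : qs N, ap (ap F v) i = sc v) -> rec a F b = plus a b.
Proof.
move=> hF; apply: (@nn_ind M (fun b => rec a F b = plus a b)) => [||k e].
- apply: Def_eq => c hc; first exact: (Fn_rec_curve hc (Fn_const a) (cur_const F)).
  exact: (Mor_plus (Mor_const a) (Mor_id (M := M)) hc).
- by rewrite rec_z plus_z.
- by rewrite rec_sc plus_sc hF e.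
Qed.

Lemma fev_add G (r : env FM G) (a b : qs N) : ap (ap (fev add r) a) b = plus (M := M) a b.
Proof. by rewrite /add; beta; apply: rec_plus => v i; beta. Qed.

Section Monus.
Variable F : qs (N ~> N ~> N).
Hypotheses (Fz : forall i : qs N, ap (ap F (z : qs N)) i = z)
  (Fs : forall (v : nn) (i : qs N), ap (ap F (sc v : qs N)) i = v).

Lemma Mor_rec (X : qspace M) (t u : X -> nn) : Mor t -> Mor u -> Mor (fun x => rec (t x) F (u x)).
Proof.
move=> ht hu c hc; exact: (Fn_rec_curve (hu c hc) (ht c hc) (cur_const F)).
Qed.

Lemma rec_pred_zl b : rec z F b = z.
Proof.
apply: (@nn_ind M (fun b => rec z F b = z)) => [||k e].
- by apply: Def_eq; [apply: Mor_rec; [apply: Mor_const|apply: Mor_id]|apply: Mor_const].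
- exact: rec_z.
- by rewrite rec_sc e Fz.
Qed.

Lemma rec_pred_sc a b : rec (sc a) F (sc b) = rec a F b.
Proof.
apply: (@nn_ind M (fun b => rec (sc a) F (sc b) = rec a F b)) => [||k e].
- apply: Def_eq; apply: Mor_rec; try exact: Mor_const; try exact: Mor_id.
  by apply: Mor_sc; apply: Mor_id.
- by rewrite rec_sc !rec_z Fs.
- rewrite rec_sc e rec_sc; by case: (nn_case (rec a F k)) => [->|[c ->]]; rewrite ?Fz ?Fs.
Qed.

Lemma rec_pred_le a b : rec a F b = z <-> le a b.
Proof.
move: a; apply: (@nn_ind M (fun b => forall a, rec a F b = z <-> le a b)) => [||k IH a].
- apply: Def_all; apply: Def_iff; first apply: Def_eq; try exact: Mor_const.
  + by apply: Mor_rec => c [].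
  + by apply: Def_le => c [].
- move=> a; rewrite rec_z; split=> [->|]; first exact: le_refl.
  by move=> h; apply: le_antisym h (le_z a).
- case: (nn_case a) => [->|[c ->]]; last by rewrite rec_pred_sc IH le_sc2.
  by rewrite rec_pred_zl; split=> // _; apply: le_z.
Qed.
End Monus.

(** Replaces the combinator term by a step functional of which only the two predecessor equations
    are kept. *)
Lemma fev_monus_rec G (r : env FM G) (a b : qs N) : exists F : qs (N ~> N ~> N),
  (forall i : qs N, ap (ap F (z : qs N)) i = z) /\
  (forall (v : nn) (i : qs N), ap (ap F (sc v : qs N)) i = v) /\
  ap (ap (fev monus r) a) b = rec a F b.
Proof.
exists (fev (lam (lam (pred @ v1)%tm)) (@econs ty (dom FM) _ N b (@econs ty (dom FM) _ N a r))).
split; [|split].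
- by move=> i; beta; apply: fev_pred_z.
- by move=> v i; beta; apply: fev_pred_sc.
- by rewrite /monus; beta.
Qed.

Lemma fev_monus_le G (r : env FM G) (a b : qs N) :
  ap (ap (fev monus r) a) b = z <-> le (M := M) a b.
Proof. by have [F [Fz [Fs ->]]] := fev_monus_rec r a b; apply: rec_pred_le. Qed.
Lemma fev_monus_one G (r : env FM G) (a : nn) :
  ap (ap (fev monus r) (sc a : qs N)) (sc z : qs N) = a.
Proof.
have [F [Fz [Fs ->]]] := fev_monus_rec r (sc a : qs N) (sc z : qs N).
by rewrite rec_pred_sc // rec_z.
Qed.

Lemma le_z_eq (a : nn) : le a z -> a = z.
Proof. by move=> h; apply: le_antisym h (le_z a). Qed.

Lemma fev_cap G (r : env FM G) (f g : qs T1) (n : qs N) :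
  ap (ap (ap (fev cap r) f) g) n = z <-> ap f n = z /\ ap g n = z.
Proof.
rewrite /cap; beta; rewrite /tmax; beta; rewrite fev_add.
split=> [|[-> e]].
- move=> e; have e1 : ap f n = z.
    by apply: le_z_eq; eexists; apply: e.
  move: e; rewrite e1 plus_zl => /fev_monus_le /le_z_eq; by [].
- by rewrite plus_zl; apply/fev_monus_le; rewrite e; apply: le_refl.
Qed.

Lemma fev_compl G (r : env FM G) (f : qs T1) (n : qs N) :
  ap (ap (fev compl r) f) n = z <-> ap f n <> z.
Proof.
rewrite /compl; beta; rewrite fev_monus_le; split=> [h e|ne].
- by rewrite e in h; apply: (@lt_z M z).
- by case: (nn_case (ap f n)) => // -[b ->]; apply/le_sc2; apply: le_z.
Qed.

Lemma fev_normalize G (r : env FM G) (f : qs T1) (n : qs N) :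
  ap (ap (fev normalize r) f) n = z <-> ap f n = z.
Proof.
rewrite /normalize; beta; rewrite /tmin; beta; rewrite fev_monus_le.
case: (nn_case (ap f n)) => [->|[b ->]]; first by split=> // _; apply: le_z.
rewrite fev_monus_one; split=> [/lt_irr //|/sc_z //].
Qed.

Definition of_Fn (g : nn -> nn) (hg : Fn g) : qs T1 :=
  @qfun M (qs N) (qs N) g (fun c hc => Fn_comp hg hc).

Lemma qs_CA (F : qs (N ~> N ~> N)) : exists g : qs T1, forall n : qs N,
  ap g n = z <-> forall x : qs N, ap (ap F n) x = z.
Proof.
have hF : Fn (fun k : nn => ap (ap F (p1 k : qs N)) (p2 k : qs N)).
  by apply: (cur_app (cur_app (cur_const F) (Fn_p1 M)) (Fn_p2 M)).
have [g [hg e]] := Fn_all hF; exists (of_Fn hg) => n; have e' := e n; split.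
- by move=> /e' h x; have := h x; rewrite p1_pr p2_pr.
- by move=> h; apply/e' => x; rewrite p1_pr p2_pr; apply: h.
Qed.

Lemma fmodel_CA G (r : env FM G) : sat (M := FM) Pi01_CA r.
Proof. exact: qs_CA. Qed.

(** Read as an implication, the condition has a solution even for a function without zeros; the
    least-witness operator is therefore total. *)
Definition zero_if_any (f : qs T1) (n : nn) : Prop :=
  (exists m : nn, ap f (m : qs N) = z) -> ap f (n : qs N) = z.
Definition mu_val (f : qs T1) : nn := mu_op (zero_if_any f).

Lemma Mor_ap (X : qspace M) (f : X -> qs T1) (t : X -> nn) :
  (forall c, cur X c -> cur (qs T1) (fun n => f (c n))) -> Mor t ->
  Mor (fun x => ap (f x) (t x : qs N)).
Proof. by move=> hf ht c hc; apply: (cur_app (hf c hc) (ht c hc)). Qed.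

Lemma mu_val_Def : Def (X := qprod (qs T1)) (fun p => zero_if_any (fst p) (snd p)).
Proof.
apply: Def_imp; [apply: Def_ex|]; (apply: Def_eq; last exact: Mor_const); apply: Mor_ap.
- by move=> c [[]].
- by move=> c [[]].
- by move=> c [].
- by move=> c [].
Qed.

Lemma mu_val_ex (f : qs T1) : exists n : nn, zero_if_any f n.
Proof.
rewrite /zero_if_any; case: (classic (exists m : nn, ap f (m : qs N) = z)) => [[m hm]|no]; first by exists m.
by exists z.
Qed.

Lemma fmodel_mu G (r : env FM G) : sat (M := FM) mu_ax r.
Proof.
exists (@qfun M (qs T1) (qs N) mu_val (Mor_mu mu_val_Def mu_val_ex)) => f.
by case: (mu_op_spec (Def_slice f mu_val_Def) (mu_val_ex f)).
Qed.

(** * The ultrafilter generated by a generic chain *)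

Section Ultrafilter.
Variable Y : nat -> nn -> Prop.
Hypotheses (Ydef : forall i, Def (X := qnum M) (Y i) /\ Inf (Y i))
  (Ydec : forall i m, Y (S i) m -> Y i m)
  (Ygen : forall A : nn -> nn, Fn A -> exists i, forall n,
    almost (Y i) (fun m => A (pr n m) = z) \/ almost (Y i) (fun m => A (pr n m) <> z)).

Lemma chain_le i j m : i <= j -> Y j m -> Y i m.
Proof. by elim=> // k _ IH h; apply: IH; apply: Ydec. Qed.

Lemma almost_and i j (P Q : nn -> Prop) : almost (Y i) P -> almost (Y j) Q ->
  almost (Y (i + j)) (fun m => P m /\ Q m).
Proof.
move=> [b hb] [c hc]; have [d [bd cd]] := ub2 b c; exists d => m Ym dm; split.
- apply: hb; last exact: le_trans bd dm.
  by apply: chain_le Ym; lia.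
- apply: hc; last exact: le_trans cd dm.
  by apply: chain_le Ym; lia.
Qed.

Lemma almost_unbounded i (P : nn -> Prop) : almost (Y i) P -> Inf P.
Proof.
move=> [b hb] n; have [c [bc nc]] := ub2 b n; have [m [cm Ym]] := proj2 (Ydef i) c.
exists m; split; first by apply: le_trans cm; apply/le_sc2.
by apply: hb => //; apply: le_trans bc _; apply: lt_le.
Qed.

Lemma almost_not_both i j (P : nn -> Prop) :
  almost (Y i) P -> almost (Y j) (fun m => ~ P m) -> False.
Proof.
by move=> h1 h2; have [m [_ []]] := almost_unbounded (almost_and h1 h2) z.
Qed.

Definition large (f : qs T1) : Prop := exists i, almost (Y i) (fun m => ap f (m : qs N) = z).
Definition ult_val (f : qs T1) : nn :=
  match excluded_middle_informative (large f) with left _ => z | right _ => sc z end.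

Lemma ult_val_z f : ult_val f = z <-> large f.
Proof. by rewrite /ult_val; case: excluded_middle_informative => h; split=> // /sc_z. Qed.

Lemma ult_val_eq (f g : qs T1) : (forall n : qs N, ap f n = z <-> ap g n = z) ->
  ult_val f = ult_val g.
Proof.
move=> e; rewrite /ult_val; suff -> : large f = large g by [].
apply: propositional_extensionality.
by split=> -[i [b hb]]; exists i, b => m Ym bm; apply/e; apply: hb.
Qed.

(** Uncurrying a curve of functions gives a single function of S, hence a coded sequence of sets to
    which genericity applies, with one [i] for all [n]. *)
Lemma large_dec c : cur (qs T1) c -> exists i, forall n,
  almost (Y i) (fun m => ap (c n) (m : qs N) = z) \/
  almost (Y i) (fun m => ap (c n) (m : qs N) <> z).
Proof.
move=> hc; have hA : Fn (fun k => ap (c (p1 k)) (p2 k : qs N)).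
  exact: (cur_app (cur_comp hc (Fn_p1 M)) (Fn_p2 M)).
have [i hi] := Ygen hA; exists i => n.
have e : (fun m => ap (c (p1 (pr n m))) (p2 (pr n m) : qs N)) = (fun m => ap (c n) (m : qs N)).
  by apply: functional_extensionality => m; rewrite p1_pr p2_pr.
by case: (hi n) => -[b hb]; [left|right]; exists b => m Ym bm; have := hb m Ym bm;
  rewrite p1_pr p2_pr.
Qed.

(** [large] quantifies over the external chain. Along a curve, however, a single [Y i] decides every
    set, and any other member of the chain must agree with it; largeness of [c n] then reduces to
    almost inclusion of [Y i], an arithmetical condition. *)
Lemma ult_val_Mor : Mor ult_val.
Proof.
move=> c hc; have [i hi] := large_dec hc.
have large_i n : large (c n) <-> almost (Y i) (fun m => ap (c n) (m : qs N) = z).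
  split=> [[j hj]|h]; last by exists i.
  by case: (hi n) => // /(almost_not_both hj).
pose B n := almost (Y i) (fun m => ap (c n) (m : qs N) = z).
suff h : Mor (X := qnum M) (fun n => ult_val (c n)) by apply: (h _ (Fn_id M)).
have dB (X : qspace M) (t : X -> nn) : Mor t -> Def (X := X) (fun p => B (t p)).
  move=> ht; apply: Def_ex; apply: Def_all; apply: Def_imp.
    apply: Def_comp; first by case: (Ydef i).
    by move=> d [].
  apply: Def_imp; first by apply: Def_le => d [[h1 h2] h3].
  apply: Def_eq; last exact: Mor_const.
  apply: Mor_ap => d [[h1 h2] h3] //.
  exact: (cur_comp hc (ht _ h1)).
apply: (Mor_choice (X := qnum M) (t := fun n => ult_val (c n))
  (P := fun n v => (B n -> v = z) /\ (~ B n -> v = sc z))).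
- have hf : Mor (X := qprod (qnum M)) (fun p => fst p) by move=> d [].
  have hs : Mor (X := qprod (qnum M)) (fun p => snd p) by move=> d [].
  by apply: Def_and; apply: Def_imp; try (by apply: Def_eq => //; apply: Mor_const);
    try apply: Def_not; apply: dB.
- move=> n; rewrite /ult_val; case: excluded_middle_informative => h; split=> //.
  + by case; apply/large_i.
  + by move=> h'; case: h; apply/large_i.
- move=> n m [h1 h2]; rewrite /ult_val; case: excluded_middle_informative => h.
  + by apply: h1; apply/large_i.
  + by apply: h2 => h'; apply: h; apply/large_i.
Qed.

Lemma fmodel_U_chain G (r : env FM G) : sat (M := FM) U_ax r.
Proof.
pose U : dom FM T2 := @qfun M (qs T1) (qs N) ult_val ult_val_Mor; exists U.
split; [|split; [|split; [|split]]].
- move=> f; have [i hi] := large_dec (cur_const f).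
  case: (hi z) => h; [left; apply/ult_val_z; by exists i|right; apply/ult_val_z].
  exists i; case: h => b hb; exists b => m Ym bm.
  exact: (proj2 (fev_compl (f ;; U ;; r) f m) (hb m Ym bm)).
- move=> f g /ult_val_z[i [b hb]]; apply/ult_val_z; exists i, b => m Ym bm.
  exact: (proj2 (proj1 (fev_cap (g ;; f ;; U ;; r) f g m) (hb m Ym bm))).
- move=> f g [/ult_val_z[i hi] /ult_val_z[j hj]]; apply/ult_val_z; exists (i + j).
  have [b hb] := almost_and hi hj; exists b => m Ym bm.
  exact: (proj2 (fev_cap (g ;; f ;; U ;; r) f g m) (hb m Ym bm)).
- move=> f /ult_val_z[i hi] n; have [m [nm hm]] := almost_unbounded hi n.
  exists m; split=> //; exact: (proj2 (fev_monus_le (m ;0 n ;0 f ;; U ;; r) (sc n : qs N) (m : qs N)) nm).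
- move=> f; apply: ult_val_eq => n; symmetry; exact: (fev_normalize (f ;; U ;; r) f n).
Qed.
End Ultrafilter.

Theorem fmodel_mu_U (A : sentence Lomega) : provable ACA0w_mu_U A -> sat (M := FM) A enil.
Proof.
have [Y [Ydef [Ydec Ygen]]] := generic_chain M.
move=> p; apply: (soundness _ p) => // G B [] {G B} => [G B [] {G B}|G|G] *.
- by apply: fmodel_RCA0w.
- exact: fmodel_CA.
- exact: fmodel_mu.
- exact: (fmodel_U_chain Ydef Ydec Ygen).
Qed.

End FunctionalAxioms.

(** * Extensional collapse *)

Lemma quotient (D : Type) (e : D -> D -> Prop) : (forall x, e x x) ->
  (forall x y, e x y -> e y x) -> (forall x y w, e x y -> e y w -> e x w) ->
  exists (Q : Type) (cl : D -> Q) (rep : Q -> D),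
    (forall q, cl (rep q) = q) /\ forall x y, cl x = cl y <-> e x y.
Proof.
move=> er es et.
pose Q := {P : D -> Prop | exists x, P = e x}.
pose cl x : Q := exist _ (e x) (ex_intro _ x eq_refl).
pose rep (q : Q) := proj1_sig (constructive_indefinite_description _ (proj2_sig q)).
have clE x y : cl x = cl y <-> e x y.
  split=> [h|h].
    have /= -> : proj1_sig (cl x) y = proj1_sig (cl y) y by rewrite h.
    exact: (er y).
  have eP : e x = e y.
    apply: functional_extensionality => w; apply: propositional_extensionality.
    by split; [apply: et; apply: es|apply: et].
  rewrite /cl; move: (ex_intro _ x _) (ex_intro _ y _); rewrite eP => p q.
  by congr exist; apply: proof_irrelevance.
exists Q, cl, rep; split=> // -[P h]; rewrite /rep /=.
case: constructive_indefinite_description => x /= eP; rewrite /cl; subst P.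
by congr exist; apply: proof_irrelevance.
Qed.

(** Stated for any language and any congruence because it is applied twice: to extensional equality
    at all types, and to the equality of PA. *)
Lemma collapse (L : lang) (W : model L) (e : forall s, dom W s -> dom W s -> Prop) :
  (forall s x, e s x x) -> (forall s x y, e s x y -> e s y x) ->
  (forall s x y w, e s x y -> e s y w -> e s x w) ->
  (forall G s (t : tm G s) (r r' : env W G), (forall u v, e u (r u v) (r' u v)) ->
     e s (ev t r) (ev t r')) ->
  (forall x y, eqv x y <-> e (num L) x y) ->
  exists (Q : model L) (cl : forall s, dom W s -> dom Q s),
  (forall s q, exists x : dom W s, cl s x = q) /\
  (forall s x y, cl s x = cl s y <-> e s x y) /\
  (forall x y : dom Q (num L), eqv x y <-> x = y) /\
  (forall G s (t : tm G s) (r : env W G), ev t (fun u v => cl u (r u v)) = cl s (ev t r)) /\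
  (forall G (A : fm L G) (r : env W G), sat A r <-> sat A (fun u v => cl u (r u v))).
Proof.
move=> er es et econg enum.
have q s := quotient (@er s) (@es s) (@et s).
pose Q s := proj1_sig (constructive_indefinite_description _ (q s)).
have qQ s : exists (cl : dom W s -> Q s) (rep : Q s -> dom W s),
    (forall q, cl (rep q) = q) /\ forall x y, cl x = cl y <-> e s x y.
  exact: (proj2_sig (constructive_indefinite_description _ (q s))).
pose cl s := proj1_sig (constructive_indefinite_description _ (qQ s)).
have qcl s : exists (rep : Q s -> dom W s),
    (forall q, cl s (rep q) = q) /\ forall x y, cl s x = cl s y <-> e s x y.
  exact: (proj2_sig (constructive_indefinite_description _ (qQ s))).
pose rep s := proj1_sig (constructive_indefinite_description _ (qcl s)).
have qrep s : (forall q, cl s (rep s q) = q) /\ forall x y, cl s x = cl s y <-> e s x y.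
  exact: (proj2_sig (constructive_indefinite_description _ (qcl s))).
have clrep s x : cl s (rep s x) = x by case: (qrep s).
have clE s x y : cl s x = cl s y <-> e s x y by case: (qrep s).
have repcl s x : e s (rep s (cl s x)) x by apply/clE.
pose qev G s (t : tm G s) (r : forall u, var G u -> Q u) := cl s (ev t (fun u v => rep u (r u v))).
have qvar G s (v : var G s) r : qev G s (tvar v) r = r s v by rewrite /qev ev_tvar.
have qsub G D (sg : @sub L G D) s (t : tm G s) r :
    qev D s (tsub sg t) r = qev G s t (fun u v => qev D u (sg u v) r).
  by apply/clE; rewrite ev_tsub; apply: econg => u v; apply: es; apply: repcl.
pose QM := @Model L Q qev (fun x y => x = y) qvar qsub.
have qevE G s (t : tm G s) (r : env W G) : qev G s t (fun u v => cl u (r u v)) = cl s (ev t r).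
  by apply/clE; apply: econg => u v; apply: repcl.
exists QM, cl; split; first by move=> s x; exists (rep s x).
do 3 split=> //.
move=> G A; elim: A => {G} [G t u|G|G A IA B IB|G A IA B IB|G A IA B IB|G s A IA|G s A IA] r /=.
- rewrite !qevE enum; split=> [h|/clE //]; by apply/clE.
- by [].
- by rewrite IA IB.
- by rewrite IA IB.
- by rewrite IA IB.
- have ex x : (fun u v => cl u (econs x r v)) = @econs _ Q G s (cl s x) (fun u v => cl u (r u v)).
    exact: env_cons_ext.
  split=> h x; last by rewrite IA ex.
  by rewrite -(clrep s x) -ex -IA.
- have ex x : (fun u v => cl u (econs x r v)) = @econs _ Q G s (cl s x) (fun u v => cl u (r u v)).
    exact: env_cons_ext.
  split=> -[x hx]; first by exists (cl s x); rewrite -ex -IA.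
  by exists (rep s x); rewrite IA ex clrep.
Qed.

Section Application.
Variable W : model Lomega.

(** A model only evaluates terms, so application of its elements is read off from the value of an
    open term with two variables; the substitution law carries this over to all applications. *)
Definition wap s t (f : dom W (s ~> t)%ty) (x : dom W s) : dom W t :=
  ev (m := W) (G := [s; (s ~> t)%ty]) (v1 @ v0)%tm
    (@econs ty (dom W) _ s x (@econs ty (dom W) _ (s ~> t)%ty f enil)).

Lemma ev_app G s t (f : wtm G (s ~> t)) (x : wtm G s) (r : env W G) :
  ev (m := W) (App f x) r = wap (ev (m := W) f r) (ev (m := W) x r).
Proof.
rewrite /wap.
pose sg : @sub Lomega [s; (s ~> t)%ty] G :=
  scons (L := Lomega) (x : @tm Lomega G s) (scons (L := Lomega) (f : @tm Lomega G (s ~> t)%ty) enil).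
etransitivity; first exact: (ev_tsub (m := W) sg (v1 @ v0)%tm r).
congr (ev _ _).
by apply: env_cons_ext => //; apply: var_cons_ind => // u v; case: (var_nil_elim v).
Qed.

Definition cst s (c : wtm [] s) : dom W s := ev (m := W) c enil.

Fixpoint wev G s (t : wtm G s) (r : env W G) : dom W s :=
  match t in wtm _ s return dom W s with
  | Var v => r _ v
  | Zero => cst Zero
  | Succ => cst Succ
  | Pi => cst Pi
  | Sigma => cst Sigma
  | Rec => cst Rec
  | App t u => wap (wev t r) (wev u r)
  end.

Lemma ev_wev G s (t : wtm G s) (r : env W G) : ev (m := W) t r = wev t r.
Proof.
have closed u (c : wtm [] u) (c' : wtm G u) : wsub enil c = c' -> ev (m := W) c' r = cst c.
  move=> <-; etransitivity; first exact: (ev_tsub (m := W) (enil : @sub Lomega [] G) c r).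
  by congr (ev _ _); apply: env_nil_ext.
elim: t => [u v|||a b|a b c||u v t IHt t' IHt'] /=; try exact: closed.
- exact: (ev_tvar (m := W)).
- by etransitivity; [exact: ev_app|rewrite IHt IHt'].
Qed.

Fixpoint weq s : dom W s -> dom W s -> Prop :=
  match s return dom W s -> dom W s -> Prop with
  | N => fun x y => eqv (m := W) x y
  | Arr s t => fun f g => forall x, weq (wap f x) (wap g x)
  end.

Lemma wev_shift G s u (t : wtm G s) (x : dom W u) (r : env W G) :
  wev (wshift u t) (econs x r) = wev t r.
Proof.
rewrite -!ev_wev; etransitivity; first exact: (ev_tsub (m := W) (fun s v => Var (vs v)) t (econs x r)).
by congr (ev _ _); apply: env_ext => w v; rewrite ev_wev.
Qed.

Lemma sat_eqt_weq s : forall G (t u : wtm G s) (r : env W G),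
  sat (eqt t u) r <-> weq (wev t r) (wev u r).
Proof.
elim: s => [|s1 _ s2 IH] G t u r /=; first by rewrite !ev_wev.
by split=> h x; have := h x; rewrite IH /= !wev_shift.
Qed.
End Application.

Section Collapse.
Variable W : model Lomega.
Hypothesis hW : forall G (A : fm Lomega G), RCA0w A -> forall r : env W G, sat A r.

Local Notation "x ;; r" := (@econs ty (dom W) _ _ x r) (at level 60, right associativity).

Lemma weq_refl s (x : dom W s) : weq x x.
Proof.
elim: s x => [|s1 _ s2 IH] x /=; last by move=> y; apply: IH.
have := hW (eq_refl_ax (v0 : wtm [N] N)) (x ;; enil).
by rewrite /= !ev_wev.
Qed.
Lemma weq_sym s (x y : dom W s) : weq x y -> weq y x.
Proof.
elim: s x y => [|s1 _ s2 IH] x y /=; last by move=> h w; apply: IH.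
have := hW (eq_sym_ax (v0 : wtm [N; N] N) v1) (x ;; y ;; enil).
by rewrite /= !ev_wev.
Qed.
Lemma weq_trans s (x y w : dom W s) : weq x y -> weq y w -> weq x w.
Proof.
elim: s x y w => [|s1 _ s2 IH] x y w /=; last by move=> h h' u; apply: IH (h u) (h' u).
have := hW (eq_trans_ax (v0 : wtm [N; N; N] N) v1 v2) (x ;; y ;; w ;; enil).
by rewrite /= !ev_wev.
Qed.
Lemma weq_app s t (f : dom W (s ~> t)%ty) x y : weq x y -> weq (wap f x) (wap f y).
Proof.
have := hW (extensionality (v0 : wtm [(s ~> t)%ty; s; s] (s ~> t)%ty) v1 v2) (f ;; x ;; y ;; enil).
by rewrite /= !sat_eqt_weq.
Qed.

Lemma weq_wev G s (t : wtm G s) (r r' : env W G) :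
  (forall u v, weq (r u v) (r' u v)) -> weq (wev t r) (wev t r').
Proof.
move=> h; elim: t => [u v|||a b|a b c||u v t IHt t' IHt']; try exact: (weq_refl (cst W _)).
- exact: h.
- by apply: weq_trans (IHt _) _; apply: weq_app.
Qed.

Lemma collapse_ext : exists (Q : model Lomega) (cl : forall s, dom W s -> dom Q s),
  (forall s q, exists x : dom W s, cl s x = q) /\
  (forall s x y, cl s x = cl s y <-> weq x y) /\
  (forall x y : dom Q N, eqv (m := Q) x y <-> x = y) /\
  (forall s t (f g : dom Q (s ~> t)%ty), (forall x, wap f x = wap g x) -> f = g) /\
  (forall G (A : fm Lomega G) (r : env W G), sat A r <-> sat A (fun u v => cl u (r u v))).
Proof.
have cong G s (t : wtm G s) (r r' : env W G) : (forall u v, weq (r u v) (r' u v)) ->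
    weq (ev (m := W) t r) (ev (m := W) t r').
  by move=> h; rewrite !ev_wev; apply: weq_wev.
have [Q [cl [cls [clE [eqvQ [evQ satQ]]]]]] :=
  collapse weq_refl weq_sym weq_trans cong (fun x y => iff_refl _).
exists Q, cl; do 3 (split=> //); split=> // s t f g h.
have qap f' x : wap (W := Q) (cl (s ~> t)%ty f') (cl s x) = cl t (wap f' x).
  rewrite /wap -evQ; congr (ev _ _); symmetry.
  by apply: env_cons_ext => //; apply: var_cons_ind => // u v; case: (var_nil_elim v).
have [f' ef] := cls _ f; have [g' eg] := cls _ g; rewrite -ef -eg; apply/clE => x; apply/clE.
by rewrite -!qap ef eg.
Qed.
End Collapse.

(** * Models of ACA_0^omega *)

Section SecondOrderPart.
Variable Q : model Lomega.
Hypotheses (eqvQ : forall x y : dom Q N, eqv (m := Q) x y <-> x = y)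
  (extQ : forall s t (f g : dom Q (s ~> t)%ty), (forall x, wap f x = wap g x) -> f = g)
  (hQ : forall G (A : fm Lomega G), ACA0w A -> forall r : env Q G, sat A r).

Local Notation "x ;; r" := (@econs ty (dom Q) _ _ x r) (at level 60, right associativity).
Local Notation D := (dom Q).
Local Notation nul := (@enil ty (dom Q)).
Local Notation zr := (cst Q Zero).
Local Notation su := (fun x : D N => wap (cst Q Succ) x).

Lemma weq_eq s (x y : D s) : weq x y <-> x = y.
Proof.
elim: s x y => [|s _ t IH] x y /=; first exact: eqvQ.
split=> [h|-> w]; last by apply/IH.
by apply: extQ => w; apply/IH.
Qed.

Lemma sat_eqt_eq G s (t u : wtm G s) (r : env Q G) : sat (eqt t u) r <-> wev t r = wev u r.
Proof. by rewrite sat_eqt_weq weq_eq. Qed.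

Lemma wPi s t (x : D s) (y : D t) : wap (wap (cst Q Pi) x) y = x.
Proof.
have := hQ (ACA0w_base (Pi_ax (v0 : wtm [s; t] s) (v1 : wtm [s; t] t))) (x ;; y ;; nul).
by move=> /sat_eqt_eq.
Qed.

Lemma wSigma s t u (x : D (s ~> t ~> u)%ty) (y : D (s ~> t)%ty) (w : D s) :
  wap (wap (wap (cst Q Sigma) x) y) w = wap (wap x w) (wap y w).
Proof.
pose G := [(s ~> t ~> u)%ty; (s ~> t)%ty; s].
have := hQ (ACA0w_base (Sigma_ax (Gamma := G) v0 v1 v2)) (x ;; y ;; w ;; nul).
by move=> /sat_eqt_eq.
Qed.

Lemma wRec_z y F : wap (wap (wap (cst Q Rec) zr) y) F = y.
Proof.
have := hQ (ACA0w_base (Rec_zero (Gamma := [N; (N ~> N ~> N)%ty]) v0 v1)) (y ;; F ;; nul).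
by rewrite /= eqvQ !ev_wev.
Qed.

Lemma wRec_s x y F : wap (wap (wap (cst Q Rec) (su x)) y) F =
  wap (wap F (wap (wap (wap (cst Q Rec) x) y) F)) x.
Proof.
have := hQ (ACA0w_base (Rec_succ (Gamma := [N; N; (N ~> N ~> N)%ty]) v0 v1 v2)) (x ;; y ;; F ;; nul).
by rewrite /= eqvQ !ev_wev.
Qed.

Transparent lam.
Lemma wev_lam G s u (t : wtm (u :: G) s) (r : env Q G) x :
  wap (wev (lam t) r) x = wev t (x ;; r).
Proof.
elim: t => /= [a v|||a b|a b c||a b t IHt t' IHt']; try exact: wPi.
- move: a v; apply: var_cons_ind => [|a v] /=; first by rewrite wSigma wPi.
  exact: wPi.
- by rewrite wSigma IHt IHt'.
Qed.
Opaque lam.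

Ltac wbeta := repeat match goal with
  |- context [wap (wev (@lam ?G ?u ?s ?t) ?r) ?x] => rewrite (@wev_lam G s u t r x) /= end.

Definition wFn (f : D N -> D N) : Prop := exists F : D T1, forall n, f n = wap F n.
Definition wFn2 (f : D N -> D N -> D N) : Prop :=
  exists F : D (N ~> N ~> N)%ty, forall m n, f m n = wap (wap F m) n.

Lemma wFn_lam G (t : wtm (N :: G) N) (r : env Q G) f :
  (forall n, f n = wev t (n ;; r)) -> wFn f.
Proof. by move=> e; exists (wev (lam t) r) => n; rewrite wev_lam. Qed.
Lemma wFn2_lam G (t : wtm (N :: N :: G) N) (r : env Q G) f :
  (forall m n, f m n = wev t (n ;; m ;; r)) -> wFn2 f.
Proof. by move=> e; exists (wev (lam (lam t)) r) => m n; wbeta; apply: e. Qed.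

Lemma wsc_z n : su n <> zr.
Proof.
have := hQ (ACA0w_base (succ_nonzero (v0 : wtm [N] N))) (n ;; nul).
by rewrite /= eqvQ !ev_wev.
Qed.
Lemma wsc_inj m n : su m = su n -> m = n.
Proof.
have := hQ (ACA0w_base (succ_inj (v0 : wtm [N; N] N) v1)) (m ;; n ;; nul).
by rewrite /= !eqvQ !ev_wev.
Qed.

Lemma w_ind G (A : wfm (N :: G)) (r : env Q G) : quantifier_free A ->
  sat A (zr ;; r) -> (forall n : D N, sat A (n ;; r) -> sat A (su n ;; r)) ->
  forall n : D N, sat A (n ;; r).
Proof.
move=> q h0 hs; have := hQ (ACA0w_base (QF_induction q)) r; apply; split.
- by apply/sat_inst; rewrite ev_wev.
- move=> n /hs h; apply/sat_fsub; move: h; congr (sat _ _).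
  by apply: env_cons_ext => [|u v]; rewrite ev_wev.
Qed.

Lemma w_ind_eq G (t u : wtm (N :: G) N) (r : env Q G) :
  wev t (zr ;; r) = wev u (zr ;; r) ->
  (forall n : D N, wev t (n ;; r) = wev u (n ;; r) -> wev t (su n ;; r) = wev u (su n ;; r)) ->
  forall n : D N, wev t (n ;; r) = wev u (n ;; r).
Proof.
move=> h0 hs n.
have /= := @w_ind G (eq0 t u) r I; rewrite !eqvQ !ev_wev => /(_ h0) h.
have := h _ n; rewrite eqvQ !ev_wev; apply=> m; rewrite !eqvQ !ev_wev; exact: hs.
Qed.

Lemma w_ind_imp G (t u t' u' : wtm (N :: G) N) (r : env Q G) :
  (wev t (zr ;; r) = wev u (zr ;; r) -> wev t' (zr ;; r) = wev u' (zr ;; r)) ->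
  (forall n : D N, (wev t (n ;; r) = wev u (n ;; r) -> wev t' (n ;; r) = wev u' (n ;; r)) ->
     wev t (su n ;; r) = wev u (su n ;; r) -> wev t' (su n ;; r) = wev u' (su n ;; r)) ->
  forall n : D N, wev t (n ;; r) = wev u (n ;; r) -> wev t' (n ;; r) = wev u' (n ;; r).
Proof.
move=> h0 hs n.
have /= := @w_ind G (Imp (eq0 t u) (eq0 t' u')) r (conj I I).
rewrite !eqvQ !ev_wev => /(_ h0) h.
have := h _ n; rewrite !eqvQ !ev_wev; apply=> m; rewrite !eqvQ !ev_wev; exact: hs.
Qed.

Lemma wev_lift2 G (A : fm Lomega (N :: T1 :: G)) (F : D T2) (f : D T1) (r : env Q G) :
  sat (fsub A (scons (L := Lomega) (Delta := T1 :: T2 :: G) (v1 @ v0)%tm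
     (scons (L := Lomega) (Delta := T1 :: T2 :: G) v0 (fun _ v => Var (vs (vs v))))))
    (f ;; F ;; r) <-> sat A (wap F f ;; f ;; r).
Proof.
rewrite sat_fsub; set r1 := (fun _ _ => _); suff -> : r1 = (wap F f ;; f ;; r) by [].
apply: env_cons_ext; rewrite /r1 /scons /=; first by rewrite ev_wev.
by apply: var_cons_ind => [|u v] /=; rewrite ev_wev.
Qed.

(* The numbers [a] and [b] are passed to the choice functional as the values
   at 0 and 1 of a function. *)
Lemma w_choice G (A : wfm (N :: N :: N :: G)) (r : env Q G) : quantifier_free A ->
  (forall a b : D N, exists x : D N, sat A (x ;; b ;; a ;; r)) ->
  exists h, wFn2 h /\ forall a b : D N, sat A (h a b ;; b ;; a ;; r).
Proof.
move=> q ex.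
pose sg : @sub Lomega (N :: N :: N :: G) (N :: T1 :: G) :=
  scons (L := Lomega) (v0 : @tm Lomega (N :: T1 :: G) N)
    (scons (L := Lomega) (v1 @ one : @tm Lomega (N :: T1 :: G) N)%tm
      (scons (L := Lomega) (v1 @ Zero : @tm Lomega (N :: T1 :: G) N)%tm (fun _ v => Var (vs (vs v))))).
have qs : quantifier_free (fsub A sg).
  move: (N :: T1 :: G) sg q; clear; elim: A => //= D A IA B IB E sg [h1 h2];
    by split; [apply: IA|apply: IB].
have e (x : D N) (f : D T1) :
    sat (fsub A sg) (x ;; f ;; r) <-> sat A (x ;; wap f (su zr) ;; wap f zr ;; r).
  rewrite sat_fsub; set r1 := (fun _ _ => _).
  suff -> : r1 = (x ;; wap f (su zr) ;; wap f zr ;; r) by [].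
  apply: env_cons_ext; rewrite /r1 /scons /=; first by rewrite ev_wev.
  by apply: var_cons_ind => /=; [rewrite ev_wev|apply: var_cons_ind => [|w v] /=; rewrite ev_wev].
have [|F hF] := hQ (ACA0w_base (QF_AC10 qs)) r.
  by move=> f; have [x hx] := ex (wap f zr) (wap f (su zr)); exists x; apply/e.
pose c (a b : D N) := wev (lam (Rec @ v0 @ v1 @ lam (lam (Var (vs (vs (vs (vs vz)))))))%tm : wtm [N; N] T1) (a ;; b ;; nul).
have c0 a b : wap (c a b) zr = a by rewrite /c; wbeta; rewrite wRec_z.
have c1 a b : wap (c a b) (su zr) = b by rewrite /c; wbeta; rewrite wRec_s; wbeta.
exists (fun a b => wap F (c a b)); split.
  apply: (@wFn2_lam [T2] (v2 @ lam (Rec @ v0 @ v2 @ lam (lam v3)))%tm (F ;; nul)) => a b /=.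
  congr (wap F _); apply: extQ => x; rewrite /c; wbeta.
move=> a b; have := proj1 (wev_lift2 (fsub A sg) F (c a b) r) (hF (c a b)).
by rewrite e c0 c1.
Qed.

Lemma w_CA (f : D N -> D N -> D N) : wFn2 f ->
  exists h, wFn h /\ forall n, h n = zr <-> forall m, f n m = zr.
Proof.
move=> [F hF]; have [g hg] := hQ (@ACA0w_CA []) nul F.
exists (wap g); split; first by exists g.
move=> n; have := hg n; rewrite /= !eqvQ !ev_wev /= => -[h1 h2].
split=> [/h1 h m|h]; first by have := h m; rewrite hF eqvQ !ev_wev.
by apply: h2 => m; rewrite eqvQ !ev_wev /= -hF.
Qed.


(** The equality test is not programmed but chosen: quantifier-free choice is applied to a case
    distinction that forces the value 0 or 1. *)
Lemma w_eqtest : exists E : D (N ~> N ~> N)%ty, forall a b, wap (wap E a) b = zr <-> a = b.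
Proof.
have [||h [[E hE] hA]] := @w_choice [] (Or (And (eq0 v0 Zero) (eq0 v2 v1))
  (And (eq0 v0 one) (Neg (eq0 v2 v1)))) nul; first by [].
  move=> a b /=; case: (classic (a = b)) => ab.
    by exists zr; left; rewrite !eqvQ !ev_wev.
  by exists (su zr); right; rewrite !eqvQ !ev_wev.
exists E => a b; have := hA a b; rewrite /= !eqvQ !ev_wev /= -hE.
by move=> [[-> ->]|[-> ne]]; split=> // /wsc_z.
Qed.

(** * Primitive recursive arithmetic and Cantor pairing in the model *)

Definition succE : D (N ~> N ~> N)%ty := wev (lam (lam (Succ @ v1)))%tm nul.
(** Functions built earlier enter as parameters of the environment, not as subterms, so the
    quantifier-free formulas used for induction stay short. *)
Definition plusE : D (N ~> N ~> N)%ty := wev (lam (lam (Rec @ v0 @ v1 @ v2)))%tm (succE ;; nul).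
Definition predE : D (N ~> N ~> N)%ty :=
  wev (lam (lam (Rec @ v1 @ Zero @ lam (lam v0))))%tm nul.
Definition subE : D (N ~> N ~> N)%ty := wev (lam (lam (Rec @ v0 @ v1 @ v2)))%tm (predE ;; nul).
(** The triangular numbers 1 + ... + a, where the diagonals of Cantor's enumeration begin. *)
Definition triE : D T1 :=
  wev (lam (Rec @ v0 @ Zero @ lam (lam (v3 @ v1 @ (Succ @ v0)))))%tm (plusE ;; nul).

Definition wplus a b := wap (wap plusE a) b.
Definition wsub a b := wap (wap subE a) b.
Definition wtri a := wap triE a.

Lemma wplus_z a : wplus a zr = a.
Proof. by rewrite /wplus /plusE; wbeta; rewrite wRec_z. Qed.
Lemma wplus_s a b : wplus a (su b) = su (wplus a b).
Proof. by rewrite /wplus /plusE; wbeta; rewrite wRec_s {1}/succE; wbeta. Qed.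
Lemma wpred_z i : wap (wap predE zr) i = zr.
Proof. by rewrite /predE; wbeta; rewrite wRec_z. Qed.
Lemma wpred_s a i : wap (wap predE (su a)) i = a.
Proof. by rewrite /predE; wbeta; rewrite wRec_s; wbeta. Qed.
Lemma wsub_z a : wsub a zr = a.
Proof. by rewrite /wsub /subE; wbeta; rewrite wRec_z. Qed.
Lemma wsub_s a b : wsub a (su b) = wap (wap predE (wsub a b)) b.
Proof. by rewrite /wsub /subE; wbeta; rewrite wRec_s. Qed.
Lemma wtri_z : wtri zr = zr.
Proof. by rewrite /wtri /triE; wbeta; rewrite wRec_z. Qed.
Lemma wtri_s a : wtri (su a) = wplus (wtri a) (su a).
Proof.
rewrite /wtri /triE; wbeta; rewrite wRec_s; wbeta; rewrite -/(wplus _ _).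
congr (wplus (wap _ _) _); apply: extQ => v; apply: extQ => i; by wbeta.
Qed.

Lemma w_case a : a = zr \/ exists b, a = su b.
Proof.
case: (classic (a = zr)) => [->|]; [by left|right]; exists (wap (wap predE a) zr).
(* Being a successor is existential, while induction is quantifier-free; the predecessor supplies
   the witness explicitly. *)
have := @w_ind [(N ~> N ~> N)%ty] (Or (eq0 v0 Zero) (eq0 v0 (Succ @ (v1 @ v0 @ Zero))%tm)) (predE ;; nul).
move=> /(_ (conj I I)) /=; rewrite !eqvQ !ev_wev /= => /(_ (or_introl eq_refl)) h.
case: (h _ a) => [n _|//|]; rewrite !eqvQ !ev_wev //=.
by right; rewrite wpred_s.
Qed.

Lemma wplus_zl a : wplus zr a = a.
Proof.
apply: (@w_ind_eq [(N ~> N ~> N)%ty] (v1 @ Zero @ v0)%tm v0 (plusE ;; nul)) => [|n] /=.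
  exact: wplus_z.
by rewrite -!/(wplus _ _) wplus_s => ->.
Qed.
Lemma wplus_sl a b : wplus (su a) b = su (wplus a b).
Proof.
apply: (@w_ind_eq [(N ~> N ~> N)%ty; N] (v1 @ (Succ @ v2) @ v0)%tm (Succ @ (v1 @ v2 @ v0))%tm
  (plusE ;; a ;; nul)) => [|n] /=; rewrite -!/(wplus _ _) ?wplus_z // !wplus_s => ->.
by [].
Qed.
Lemma wplus_inj a b c : wplus a b = wplus a c -> b = c.
Proof.
apply: (@w_ind_imp [(N ~> N ~> N)%ty; N; N] (v1 @ v0 @ v2)%tm (v1 @ v0 @ v3)%tm v2 v3
  (plusE ;; b ;; c ;; nul)) => [|n] /=; rewrite -!/(wplus _ _) ?wplus_zl // => IH.
by rewrite !wplus_sl => /wsc_inj /IH.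
Qed.
Lemma wsub_ss a b : wsub (su a) (su b) = wsub a b.
Proof.
apply: (@w_ind_eq [(N ~> N ~> N)%ty; N] (v1 @ (Succ @ v2) @ (Succ @ v0))%tm (v1 @ v2 @ v0)%tm
  (subE ;; a ;; nul)) => [|n] /=; rewrite -!/(wsub _ _).
  by rewrite wsub_s !wsub_z wpred_s.
move=> e; rewrite wsub_s e [RHS]wsub_s.
(* [predE] ignores its second argument, the position of the recursion; that position differs on the
   two sides. *)
have [F eF] : exists F : D N -> D N, forall x i, wap (wap predE x) i = F x.
  by exists (fun x => wap (wap predE x) zr) => x i; rewrite /predE; wbeta; congr (wap (wap _ _) _);
    apply: extQ => v; apply: extQ => j; wbeta.
by rewrite !eF.
Qed.
Lemma wsub_plus a b : wsub (wplus a b) a = b.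
Proof.
apply: (@w_ind_eq [(N ~> N ~> N)%ty; (N ~> N ~> N)%ty; N] (v1 @ (v2 @ v0 @ v3) @ v0)%tm v3
  (subE ;; plusE ;; b ;; nul)) => [|n] /=; rewrite -!/(wplus _ _) -!/(wsub _ _).
  by rewrite wplus_zl wsub_z.
by rewrite wplus_sl wsub_ss.
Qed.
Lemma wsub_same a : wsub a a = zr.
Proof. by have := wsub_plus a zr; rewrite wplus_z. Qed.
Lemma wsub_plus_r a b : wsub a (wplus a b) = zr.
Proof.
apply: (@w_ind_eq [(N ~> N ~> N)%ty; (N ~> N ~> N)%ty; N] (v1 @ v3 @ (v2 @ v3 @ v0))%tm Zero
  (subE ;; plusE ;; a ;; nul)) => [|n] /=; rewrite -!/(wplus _ _) -!/(wsub _ _).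
  by rewrite wplus_z wsub_same.
by rewrite wplus_s wsub_s => ->; rewrite wpred_z.
Qed.

(** The inverse of [wtri]: the largest d whose triangular number does not exceed the argument.
    Counting upwards, it grows by one exactly when the next triangular number is reached. *)
Lemma w_root : exists rootE : D T1, wap rootE zr = zr /\ forall n,
  (su n = wtri (su (wap rootE n)) -> wap rootE (su n) = su (wap rootE n)) /\
  (su n <> wtri (su (wap rootE n)) -> wap rootE (su n) = wap rootE n).
Proof.
have [E hE] := w_eqtest.
(* The recursor acts as a conditional on the equality test: its start value is the incremented root,
   and at any successor it returns the old root. *)
pose stepE := wev (lam (lam (Rec @ (v2 @ (Succ @ v0) @ (v3 @ (Succ @ v1))) @ (Succ @ v1) @
  lam (lam v3))))%tm (E ;; triE ;; nul).
have s1 v i : su i = wtri (su v) -> wap (wap stepE v) i = su v.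
  by move=> /hE e; rewrite /stepE; wbeta; rewrite -/(wtri _) e wRec_z.
have s2 v i : su i <> wtri (su v) -> wap (wap stepE v) i = v.
  move=> ne; rewrite /stepE; wbeta; rewrite -/(wtri _).
  have [x ->] : exists x, wap (wap E (su i)) (wtri (su v)) = su x.
    have ne' : wap (wap E (su i)) (wtri (su v)) <> zr by move=> /hE.
    by case: (w_case (wap (wap E (su i)) (wtri (su v)))).
  by rewrite wRec_s; wbeta.
exists (wev (lam (Rec @ v0 @ Zero @ v1))%tm (stepE ;; nul)); split; first by wbeta; rewrite wRec_z.
by move=> n; wbeta; rewrite wRec_s; split=> h; [apply: s1|apply: s2].
Qed.

Definition rootE : D T1 := proj1_sig (constructive_indefinite_description _ w_root).
Definition wroot n := wap rootE n.
Lemma rootE_spec : wap rootE zr = zr /\ forall n,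
  (su n = wtri (su (wroot n)) -> wroot (su n) = su (wroot n)) /\
  (su n <> wtri (su (wroot n)) -> wroot (su n) = wroot n).
Proof. exact: (proj2_sig (constructive_indefinite_description _ w_root)). Qed.
Lemma wroot_z : wroot zr = zr.
Proof. by case: rootE_spec. Qed.
Lemma wroot_eq n : su n = wtri (su (wroot n)) -> wroot (su n) = su (wroot n).
Proof. by case: rootE_spec => _ /(_ n)[]. Qed.
Lemma wroot_ne n : su n <> wtri (su (wroot n)) -> wroot (su n) = wroot n.
Proof. by case: rootE_spec => _ /(_ n)[]. Qed.

(** [wsub a d = zr] says that [a] is at most [d]. The next triangular number lies d + 1 further on,
    so the root stays constant along the diagonal. As an implication between equations the claim is
    open to quantifier-free induction. *)
Lemma wroot_tri_plus d : wroot (wtri d) = d ->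
  forall a, wsub a d = zr -> wroot (wplus (wtri d) a) = d.
Proof.
move=> hd; apply: (@w_ind_imp [(N ~> N ~> N)%ty; (N ~> N ~> N)%ty; T1; T1; N]
  (v1 @ v0 @ Var (vs (vs (vs (vs (vs vz))))))%tm Zero
  (v3 @ (v2 @ (Var (vs (vs (vs (vs vz)))) @ Var (vs (vs (vs (vs (vs vz)))))) @ v0))%tm
  (Var (vs (vs (vs (vs (vs vz))))))
  (subE ;; plusE ;; rootE ;; triE ;; d ;; nul)) => [|a] /=;
  rewrite -!/(wtri _) -!/(wplus _ _) -!/(wroot _) -!/(wsub _ _).
  by rewrite wplus_z.
move=> IH hs; have ha : wsub a d = zr by rewrite -wsub_ss wsub_s hs wpred_z.
rewrite wplus_s wroot_ne IH // wtri_s wplus_s => /wsc_inj/wplus_inj e.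
have := wsub_plus d (su zr); rewrite wplus_s wplus_z => e'.
by move: hs; rewrite e e' => /wsc_z.
Qed.

Lemma wroot_tri d : wroot (wtri d) = d.
Proof.
apply: (@w_ind_eq [T1; T1] (v1 @ (v2 @ v0))%tm v0 (rootE ;; triE ;; nul)) => [|n] /=;
  rewrite -!/(wtri _) -!/(wroot _).
  by rewrite wtri_z wroot_z.
move=> IH; have e := wroot_tri_plus IH (wsub_same n).
by rewrite wtri_s wplus_s wroot_eq e // wtri_s wplus_s.
Qed.

(** Cantor's pairing: position [a] on the diagonal [a + b], which [wroot] recovers. *)
Definition wpr a b := wplus (wtri (wplus a b)) a.
Definition wp1 c := wsub c (wtri (wroot c)).
Definition wp2 c := wsub (wroot c) (wp1 c).

Lemma wroot_pr a b : wroot (wpr a b) = wplus a b.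
Proof. apply: wroot_tri_plus; [exact: wroot_tri|exact: wsub_plus_r]. Qed.
Lemma wp1_pr a b : wp1 (wpr a b) = a.
Proof. by rewrite /wp1 wroot_pr wsub_plus. Qed.
Lemma wp2_pr a b : wp2 (wpr a b) = b.
Proof. by rewrite /wp2 wroot_pr wp1_pr wsub_plus. Qed.

Definition prE : D (N ~> N ~> N)%ty :=
  wev (lam (lam (v2 @ (v3 @ (v2 @ v1 @ v0)) @ v1)))%tm (plusE ;; triE ;; nul).
Lemma prE_app a b : wap (wap prE a) b = wpr a b.
Proof. by rewrite /prE; wbeta. Qed.

Lemma wFn_const a : wFn (fun _ => a).
Proof. exact: (@wFn_lam [N] v1 (a ;; nul)). Qed.
Lemma wFn_id : wFn (fun n => n).
Proof. exact: (@wFn_lam [] v0 nul). Qed.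
Lemma wFn_comp f g : wFn f -> wFn g -> wFn (fun n => f (g n)).
Proof.
move=> [F hF] [G hG]; apply: (@wFn_lam [T1; T1] (v1 @ (v2 @ v0))%tm (F ;; G ;; nul)) => n /=.
by rewrite hF hG.
Qed.
Lemma wFn_sc : wFn su.
Proof. by exists (cst Q Succ). Qed.
Lemma wFn_pr f g : wFn f -> wFn g -> wFn (fun n => wpr (f n) (g n)).
Proof.
move=> [F hF] [G hG].
apply: (@wFn_lam [T1; T1; (N ~> N ~> N)%ty] (v3 @ (v1 @ v0) @ (v2 @ v0))%tm (F ;; G ;; prE ;; nul)) => n /=.
by rewrite hF hG prE_app.
Qed.
Lemma wFn_p1 : wFn wp1.
Proof.
exact: (@wFn_lam [(N ~> N ~> N)%ty; T1; T1] (v1 @ v0 @ (v2 @ (v3 @ v0)))%tm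
  (subE ;; triE ;; rootE ;; nul)).
Qed.
Lemma wFn_p2 : wFn wp2.
Proof.
exact: (@wFn_lam [(N ~> N ~> N)%ty; T1; T1] (v1 @ (v3 @ v0) @ (v1 @ v0 @ (v2 @ (v3 @ v0))))%tm
  (subE ;; triE ;; rootE ;; nul)).
Qed.
Lemma wFn_ind f : wFn f -> f zr = zr -> (forall n, f n = zr -> f (su n) = zr) ->
  forall n, f n = zr.
Proof.
move=> [F hF] h0 hs n; rewrite hF.
apply: (@w_ind_eq [T1] (v1 @ v0)%tm Zero (F ;; nul)) => [|m] /=; rewrite -!hF //.
exact: hs.
Qed.
Lemma wFn_diag h : wFn2 h -> wFn (fun n => h n n).
Proof.
move=> [H hH]; apply: (@wFn_lam [(N ~> N ~> N)%ty] (v1 @ v0 @ v0)%tm (H ;; nul)) => n /=.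
by rewrite hH.
Qed.
Lemma wFn_eq f g : wFn f -> wFn g -> exists h, wFn h /\ forall n, h n = zr <-> f n = g n.
Proof.
move=> [F hF] [G hG]; have [E hE] := w_eqtest; exists (fun n => wap (wap E (f n)) (g n)); split=> //.
apply: (@wFn_lam [T1; T1; (N ~> N ~> N)%ty] (v3 @ (v1 @ v0) @ (v2 @ v0))%tm (F ;; G ;; E ;; nul)) => n /=.
by rewrite hF hG.
Qed.
Lemma wFn_imp f g : wFn f -> wFn g ->
  exists h, wFn h /\ forall n, h n = zr <-> (f n = zr -> g n = zr).
Proof.
move=> [F hF] [G hG].
pose B : wfm [N; N; N; T1; T1] := Imp (eq0 (v3 @ v1)%tm Zero) (eq0 (Var (vs (vs (vs (vs vz)))) @ v1)%tm Zero).
have [||h [h2 hA]] := @w_choice [T1; T1] (Or (And (eq0 v0 Zero) B) (And (eq0 v0 one) (Neg B)))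
  (F ;; G ;; nul); first by [].
  move=> a b /=; case: (classic (wap F b = zr -> wap G b = zr)) => ab.
    by exists zr; left; rewrite !eqvQ !ev_wev.
  by exists (su zr); right; rewrite !eqvQ !ev_wev.
exists (fun n => h n n); split; first exact: wFn_diag.
move=> n; have := hA n n; rewrite /= !eqvQ !ev_wev /= -hF -hG.
by move=> [[-> ?]|[-> ne]]; split=> // /wsc_z.
Qed.
Lemma wFn_all f : wFn f -> exists h, wFn h /\ forall n, h n = zr <-> forall m, f (wpr n m) = zr.
Proof.
move=> [F hF]; apply: w_CA.
apply: (@wFn2_lam [T1; (N ~> N ~> N)%ty] (v2 @ (v3 @ v1 @ v0))%tm (F ;; prE ;; nul)) => m n /=.
by rewrite hF prE_app.
Qed.
Lemma wFn_fun f : wFn f -> (forall n, exists m, f (wpr n m) = zr) ->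
  exists h, wFn h /\ forall n, f (wpr n (h n)) = zr.
Proof.
move=> [F hF] ex.
have [||h [h2 hA]] := @w_choice [T1; (N ~> N ~> N)%ty]
  (eq0 (v3 @ (Var (vs (vs (vs (vs vz)))) @ v1 @ v0))%tm Zero) (F ;; prE ;; nul); first by [].
  by move=> a b; have [x hx] := ex b; exists x; rewrite /= eqvQ !ev_wev /= prE_app -hF.
exists (fun n => h n n); split; first exact: wFn_diag.
by move=> n; have := hA n n; rewrite /= eqvQ !ev_wev /= prE_app -hF.
Qed.
Lemma wFn_rec f g : wFn f -> wFn g -> exists h, wFn h /\ forall a, h (wpr a zr) = f a /\
  forall n, h (wpr a (su n)) = g (wpr (wpr a n) (h (wpr a n))).
Proof.
move=> [F hF] [G hG]; have [P1 hP1] := wFn_p1; have [P2 hP2] := wFn_p2.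
pose St a := wev (lam (lam (v3 @ (Var (vs (vs (vs (vs vz)))) @ (Var (vs (vs (vs (vs vz)))) @ v2 @ v0) @ v1))))%tm
  (a ;; G ;; prE ;; nul).
have hSt a v i : wap (wap (St a) v) i = g (wpr (wpr a i) v).
  by rewrite /St; wbeta; rewrite !prE_app hG.
exists (fun k => wap (wap (wap (cst Q Rec) (wp2 k)) (f (wp1 k))) (St (wp1 k))); split.
  pose w5 := Var (Gamma := [N; T1; T1; T1; T1; (N ~> N ~> N)%ty]) (vs (vs (vs (vs (vs vz))))).
  apply: (@wFn_lam [T1; T1; T1; T1; (N ~> N ~> N)%ty]
    (Rec @ (v2 @ v0) @ (v3 @ (v1 @ v0)) @
       lam (lam (Var (vs (vs (vs (vs (vs (vs vz)))))) @
         (Var (vs (vs (vs (vs (vs (vs (vs vz))))))) @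
           (Var (vs (vs (vs (vs (vs (vs (vs vz))))))) @ (v3 @ v2) @ v0) @ v1))))%tm
    (P1 ;; P2 ;; F ;; G ;; prE ;; nul)) => k /=.
  rewrite -hP1 -hP2 -hF; congr (wap _ _); apply: extQ => v; apply: extQ => i.
  by rewrite hSt; wbeta; rewrite !prE_app -hP1 -hG.
move=> a; rewrite wp1_pr wp2_pr wRec_z; split=> // n.
by rewrite !wp1_pr !wp2_pr wRec_s hSt.
Qed.

Hypothesis countQ : exists e : nat -> D T1, forall f, exists i, e i = f.

Lemma wFn_countable : exists e : nat -> D N -> D N, (forall i, wFn (e i)) /\
  forall f, wFn f -> exists i, e i = f.
Proof.
have [e he] := countQ; exists (fun i => wap (e i)); split; first by move=> i; exists (e i).
move=> f [F hF]; have [i hi] := he F; exists i; apply: functional_extensionality => n.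
by rewrite hi hF.
Qed.

Definition aca_of_model : aca :=
  Aca wp1_pr wp2_pr wFn_const wFn_id wFn_comp wFn_sc wFn_pr wFn_p1 wFn_p2 wsc_z wsc_inj
    wFn_ind wFn_eq wFn_imp wFn_all wFn_fun wFn_rec wFn_countable.

(** * Comparison with the functional model *)

Local Notation FM := (fmodel aca_of_model).

(** A logical relation. It matches types 0 and 1 completely and compares objects of higher type
    through their action, so that every term preserves it. *)
Fixpoint lrel s : D s -> dom FM s -> Prop :=
  match s return D s -> dom FM s -> Prop with
  | N => fun x y => x = y
  | Arr s t => fun f g => forall x y, lrel x y -> lrel (wap f x) (ap g y)
  end.

(** Both sides obey the same recursion. Since the numbers may be nonstandard, the induction must be
    internal; it is available because each side, as a function of [x], lies in S. *)
Lemma lrel_rec (y : D N) (F : D (N ~> N ~> N)%ty) (G : qs aca_of_model (N ~> N ~> N)) (x : D N) :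
  lrel F G -> wap (wap (wap (cst Q Rec) x) y) F = rec (M := aca_of_model) y G x.
Proof.
move=> FG; move: x; apply: (@nn_ind aca_of_model).
- apply: Def_eq => c hc; last first.
    exact: (@Fn_rec_curve aca_of_model c (fun _ => y) (fun _ => G) hc (@Fn_const aca_of_model y) (cur_const G)).
  apply: (wFn_comp (f := fun x => wap (wap (wap (cst Q Rec) x) y) F)) => //.
  exact: (@wFn_lam [N; (N ~> N ~> N)%ty] (Rec @ v0 @ v1 @ v2)%tm (y ;; F ;; nul)).
- by rewrite wRec_z; symmetry; exact: (@rec_z aca_of_model y G).
- move=> n e; rewrite wRec_s e; symmetry; etransitivity; first exact: (@rec_sc aca_of_model y G n).
  by symmetry; apply: (FG _ _ eq_refl _ _ eq_refl).
Qed.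

Lemma lrel_wev G s (t : wtm G s) (r : env Q G) (r' : env FM G) :
  (forall u v, lrel (r u v) (r' u v)) -> lrel (wev t r) (fev t r').
Proof.
move=> h; elim: t => [u v|||a b|a b c||u v t IHt t' IHt'] //=.
- by move=> x y ->.
- by move=> x y xy x' y' _; rewrite wPi.
- move=> x y xy x' y' xy' w w' ww; rewrite wSigma; apply: xy => //; exact: xy'.
- move=> x x' <- y y' <- F G' FG; exact: lrel_rec.
- exact: IHt.
Qed.

Lemma lrel_sat G (A : wfm G) : arithmetical A -> forall (r : env Q G) (r' : env FM G),
  (forall u v, lrel (r u v) (r' u v)) -> (sat A r <-> sat (M := FM) A r').
Proof.
elim: A => {G} [G t u|G|G A IA B IB|G A IA B IB|G A IA B IB|G s A IA|G s A IA] /= ar r r' rr.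
- by rewrite eqvQ !ev_wev (lrel_wev t rr) (lrel_wev u rr).
- by [].
- by case: ar => ? ?; rewrite (IA _ r r') // (IB _ r r').
- by case: ar => ? ?; rewrite (IA _ r r') // (IB _ r r').
- by case: ar => ? ?; rewrite (IA _ r r') // (IB _ r r').
- case: ar => e ar; subst s; split=> h x; apply/(IA ar _ _ _); try exact: h.
  + by apply: var_cons_ind.
  + by apply: var_cons_ind.
- case: ar => e ar; subst s; split=> -[x h]; exists x; apply/(IA ar _ _ _); try exact: h.
  + by apply: var_cons_ind.
  + by apply: var_cons_ind.
Qed.

Lemma lrel_total (f : D T1) : exists g : dom FM T1, lrel f g.
Proof.
have hf : Fn (wap f : nn aca_of_model -> nn aca_of_model) by exists f.
by exists (of_Fn hf) => x y /= ->.
Qed.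
Lemma lrel_surj (g : dom FM T1) : exists f : D T1, lrel f g.
Proof.
have [f hf] : wFn (fun n => ap (g : qs aca_of_model T1) (n : qs aca_of_model N)).
  exact: (cur_app (cur_const g) (Fn_id aca_of_model)).
by exists f => x y /= ->; rewrite -hf.
Qed.

(** The given function is carried into the functional model and the witness found there is carried
    back. Both models have the same numbers, so the arithmetical matrix is absolute. *)
Lemma sat_forall_exists (A : wfm [T1; T1]) : arithmetical A ->
  provable ACA0w_mu_U (AllT T1 (ExT T1 A)) -> sat (AllT T1 (ExT T1 A)) (enil : env Q []).
Proof.
move=> ar /(fmodel_mu_U aca_of_model) h f.
have [f' ff] := lrel_total f; have [g' hg] := h f'; have [g gg] := lrel_surj g'; exists g.
apply/(lrel_sat ar _); last exact: hg.
by apply: var_cons_ind => //; apply: var_cons_ind => // u v; case: (var_nil_elim v).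
Qed.
End SecondOrderPart.

Theorem conservation_Pi12 (A : wfm [T1; T1]) : arithmetical A ->
  provable ACA0w_mu_U (AllT T1 (ExT T1 A)) -> provable ACA0w (AllT T1 (ExT T1 A)).
Proof.
move=> ar p; apply: NNPP => /Lomega_completeness[W [hW [nA cW]]].
have hR G (B : fm Lomega G) : RCA0w B -> forall r : env W G, sat B r.
  by move=> /ACA0w_base; apply: hW.
have [Q [cl [cls [clE [eqvQ [extQ satQ]]]]]] := collapse_ext hR.
have env_lift G (r : env Q G) : exists r' : env W G, r = fun u v => cl u (r' u v).
  exists (fun u v => proj1_sig (constructive_indefinite_description _ (cls u (r u v)))).
  apply: env_ext => u v; by case: constructive_indefinite_description.
apply: nA; apply/satQ; rewrite [X in sat _ X](env_nil_ext _ enil).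
apply: (sat_forall_exists eqvQ extQ) => //.
- by move=> G B hB r; have [r' ->] := env_lift G r; apply/satQ; apply: hW.
- have [e he] := cW T1; exists (fun i => cl T1 (e i)) => f.
  have [f' <-] := cls T1 f; have [i hi] := he f'; exists i; apply/clE.
  (* Testing indistinguishability on equality with [f'] itself turns it into extensional equality,
     hence into identity of classes. *)
  pose B : wfm [T1; T1] := eqt v0 v1.
  have := proj1 (hi _ B (@econs ty (dom W) [] T1 f' enil)); rewrite !sat_eqt_weq; apply.
  exact: (weq_refl hR).
Qed.

(** * Models of PA *)

Section PeanoOperations.
Variable P : model LPA.
Local Notation D := (dom P tt).
Local Notation "x ;; r" := (@econs unit (dom P) _ tt x r) (at level 60, right associativity).
Local Notation nul := (@enil unit (dom P)).
Local Notation x0 := (PVar vz).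
Local Notation x1 := (PVar (vs vz)).

Definition pz : D := ev (m := P) (@PZero []) nul.
Definition ps (x : D) : D := ev (m := P) (@PSucc [tt] x0) (x ;; nul).
Definition pl (x y : D) : D := ev (m := P) (@PAdd [tt; tt] x0 x1) (x ;; y ;; nul).
Definition ml (x y : D) : D := ev (m := P) (@PMul [tt; tt] x0 x1) (x ;; y ;; nul).

Fixpoint pev G s (t : ptm G s) (r : env P G) : dom P s :=
  match t in ptm _ s return dom P s with
  | PVar v => r _ v
  | PZero => pz
  | PSucc t => ps (pev t r)
  | PAdd t u => pl (pev t r) (pev u r)
  | PMul t u => ml (pev t r) (pev u r)
  end.

Lemma ev_pev G s (t : ptm G s) (r : env P G) : ev (m := P) t r = pev t r.
Proof.
elim: t => {s} [s v||t IHt|t IHt u IHu|t IHt u IHu] /=.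
- exact: (ev_tvar (m := P)).
- etransitivity; first exact: (ev_tsub (m := P) (enil : @sub LPA [] G) PZero r).
  by rewrite /pz; congr (ev _ _); apply: env_nil_ext.
- etransitivity; first exact: (ev_tsub (m := P)
    (scons (L := LPA) (t : @tm LPA G tt) enil : @sub LPA [tt] G) (PSucc x0) r).
  rewrite /ps; congr (ev _ _).
  by apply: env_cons_ext => // u v; case: (var_nil_elim v).
- etransitivity; first exact: (ev_tsub (m := P) (scons (L := LPA) (t : @tm LPA G tt)
    (scons (L := LPA) (u : @tm LPA G tt) enil) : @sub LPA [tt; tt] G) (PAdd x0 x1) r).
  rewrite /pl; congr (ev _ _).
  by apply: env_cons_ext => //; apply: var_cons_ind => // w v; case: (var_nil_elim v).
- etransitivity; first exact: (ev_tsub (m := P) (scons (L := LPA) (t : @tm LPA G tt)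
    (scons (L := LPA) (u : @tm LPA G tt) enil) : @sub LPA [tt; tt] G) (PMul x0 x1) r).
  rewrite /ml; congr (ev _ _).
  by apply: env_cons_ext => //; apply: var_cons_ind => // w v; case: (var_nil_elim v).
Qed.
End PeanoOperations.

Section PeanoCollapse.
Variable P : model LPA.
Hypothesis hP : forall G (A : fm LPA G), PA A -> forall r : env P G, sat A r.
Local Notation "x ;; r" := (@econs unit (dom P) _ tt x r) (at level 60, right associativity).
Local Notation nul := (@enil unit (dom P)).

Definition peqv s : dom P s -> dom P s -> Prop :=
  match s with tt => fun x y => eqv (m := P) x y end.

Lemma peqv_refl s (x : dom P s) : peqv x x.
Proof.
by case: s x => x; have := hP (pa_refl (PVar vz : ptm [tt] tt)) (x ;; nul); rewrite /= ev_pev.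
Qed.
Lemma peqv_sym s (x y : dom P s) : peqv x y -> peqv y x.
Proof.
case: s x y => x y.
by have := hP (pa_sym (PVar vz : ptm [tt; tt] tt) (PVar (vs vz))) (x ;; y ;; nul); rewrite /= !ev_pev.
Qed.
Lemma peqv_trans s (x y w : dom P s) : peqv x y -> peqv y w -> peqv x w.
Proof.
case: s x y w => x y w.
have := hP (pa_trans (PVar vz : ptm [tt; tt; tt] tt) (PVar (vs vz)) (PVar (vs (vs vz))))
  (x ;; y ;; w ;; nul); by rewrite /= !ev_pev.
Qed.
Lemma peqv_ev G s (t : ptm G s) (r r' : env P G) : (forall u v, peqv (r u v) (r' u v)) ->
  peqv (ev (m := P) t r) (ev (m := P) t r').
Proof.
move=> h; rewrite !ev_pev.
pose X := [tt; tt; tt; tt].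
pose y0 : ptm X tt := PVar vz.
pose y1 : ptm X tt := PVar (vs vz).
pose y2 : ptm X tt := PVar (vs (vs vz)).
pose y3 : ptm X tt := PVar (vs (vs (vs vz))).
elim: t => {s} [s v||t IHt|t IHt u IHu|t IHt u IHu] /=.
- exact: h.
- exact: (@peqv_refl tt).
- have := hP (pa_congS (PVar vz : ptm [tt; tt] tt) (PVar (vs vz))) (pev t r ;; pev t r' ;; nul).
  by rewrite /= !ev_pev; apply.
- have := hP (pa_congD y0 y1 y2 y3) (pev t r ;; pev t r' ;; pev u r ;; pev u r' ;; nul).
  by rewrite /= !ev_pev; apply.
- have := hP (pa_congM y0 y1 y2 y3) (pev t r ;; pev t r' ;; pev u r ;; pev u r' ;; nul).
  by rewrite /= !ev_pev; apply.
Qed.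

Lemma peano_collapse : exists (Q : model LPA) (cl : forall s, dom P s -> dom Q s),
  (forall s q, exists x : dom P s, cl s x = q) /\
  (forall s x y, cl s x = cl s y <-> peqv x y) /\
  (forall x y : dom Q tt, eqv (m := Q) x y <-> x = y) /\
  (forall G (A : fm LPA G) (r : env P G), sat A r <-> sat A (fun u v => cl u (r u v))).
Proof.
have [Q [cl [cls [clE [eqvQ [_ satQ]]]]]] :=
  collapse peqv_refl peqv_sym peqv_trans peqv_ev (fun x y => iff_refl _).
by exists Q, cl.
Qed.
End PeanoCollapse.

Local Opaque lam.

Section PeanoArithmetic.
Variable Q : model LPA.
Hypotheses (eqvQ : forall x y : dom Q tt, eqv (m := Q) x y <-> x = y)
  (hQ : forall G (A : fm LPA G), PA A -> forall r : env Q G, sat A r).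
Local Notation D := (dom Q tt).
Local Notation "x ;; r" := (@econs unit (dom Q) _ tt x r) (at level 60, right associativity).
Local Notation nul := (@enil unit (dom Q)).
Implicit Types (G : list unit).
Local Notation o := (pz Q).
Local Notation su := (@ps Q).
Local Notation x0 := (PVar vz).
Local Notation x1 := (PVar (vs vz)).
Local Notation "x + y" := (@pl Q x y).
Local Notation "x * y" := (@ml Q x y).

Lemma ps_o x : su x <> o.
Proof. by have := hQ (pa_nonzero (x0 : ptm [tt] tt)) (x ;; nul); rewrite /= eqvQ !ev_pev. Qed.
Lemma ps_inj x y : su x = su y -> x = y.
Proof.
by have := hQ (pa_inj (x0 : ptm [tt; tt] tt) x1) (x ;; y ;; nul); rewrite /= !eqvQ !ev_pev.
Qed.
Lemma pl_o x : x + o = x.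
Proof. by have := hQ (pa_add0 (x0 : ptm [tt] tt)) (x ;; nul); rewrite /= eqvQ !ev_pev. Qed.
Lemma pl_s x y : x + su y = su (x + y).
Proof.
by have := hQ (pa_addS (x0 : ptm [tt; tt] tt) x1) (x ;; y ;; nul); rewrite /= eqvQ !ev_pev.
Qed.
Lemma ml_o x : x * o = o.
Proof. by have := hQ (pa_mul0 (x0 : ptm [tt] tt)) (x ;; nul); rewrite /= eqvQ !ev_pev. Qed.
Lemma ml_s x y : x * su y = x * y + x.
Proof.
by have := hQ (pa_mulS (x0 : ptm [tt; tt] tt) x1) (x ;; y ;; nul); rewrite /= eqvQ !ev_pev.
Qed.

(** * Definability with parameters in a model of PA *)

Fixpoint vec (n : nat) : Type := match n with 0 => unit | S n => (vec n * D)%type end.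
Fixpoint coord n : (vec n -> D) -> Prop :=
  match n with
  | 0 => fun f => exists a, forall x, f x = a
  | S n => fun f => (forall x, f x = snd x) \/ exists g, coord g /\ forall x, f x = g (fst x)
  end.

Definition at_sort u : D -> dom Q u := match u with tt => fun x => x end.

(* Definability with parameters: each free variable of the formula denotes a
   coordinate or a constant. *)
Definition FD n (A : vec n -> Prop) : Prop :=
  exists G (B : fm LPA G) (s : forall u, var G u -> vec n -> D),
    (forall u v, coord (s u v)) /\ forall x, A x <-> sat B (fun u v => at_sort u (s u v x)).

Lemma coord_const n a : coord (n := n) (fun _ => a).
Proof. by elim: n => [|n IH] /=; [exists a|right; exists (fun _ => a)]. Qed.

Lemma coord_ext n (f g : vec n -> D) : (forall x, f x = g x) -> coord f -> coord g.
Proof. by move=> e; have -> : f = g by apply: functional_extensionality. Qed.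

Lemma FD_ext n (A B : vec n -> Prop) : (forall x, A x <-> B x) -> FD A -> FD B.
Proof. by move=> e [G [C [s [hs h]]]]; exists G, C, s; split=> // x; rewrite -e. Qed.

(** Two definitions come with separate lists of variables and parameters; both are renamed into the
    concatenated list before a connective can join them. *)
Lemma merge_params n G1 (s1 : forall u, var G1 u -> vec n -> D) G2 (s2 : forall u, var G2 u -> vec n -> D) :
  (forall u v, coord (s1 u v)) -> (forall u v, coord (s2 u v)) ->
  exists G (s : forall u, var G u -> vec n -> D) (f1 : forall u, var G1 u -> var G u)
    (f2 : forall u, var G2 u -> var G u),
    (forall u v, coord (s u v)) /\ (forall u v, s u (f1 u v) = s1 u v) /\
    (forall u v, s u (f2 u v) = s2 u v).
Proof.
move=> h1 h2; elim: G1 s1 h1 => [|t G1 IH] s1 h1.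
  by exists G2, s2, enil, (fun _ v => v); do 2 split=> //; move=> u v; case: (var_nil_elim v).
have [G [s [f1 [f2 [hs [e1 e2]]]]]] := IH (fun u v => s1 u (vs v)) (fun u v => h1 u (vs v)).
exists (t :: G), (@econs unit (fun _ => vec n -> D) G t (s1 t vz) s),
  (@econs unit (var (t :: G)) G1 t vz (fun u v => vs (f1 u v))), (fun u v => vs (f2 u v)).
split; first by apply: var_cons_ind => [|u v] /=; [apply: h1|apply: hs].
by split=> //; apply: var_cons_ind.
Qed.

Lemma FD_merge n G1 (B1 : fm LPA G1) s1 G2 (B2 : fm LPA G2) s2 :
  (forall u v, coord (n := n) (s1 u v)) -> (forall u v, coord (n := n) (s2 u v)) ->
  exists G (C1 C2 : fm LPA G) s, (forall u v, coord (n := n) (s u v)) /\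
    (forall x, sat C1 (fun u v => at_sort u (s u v x)) <-> sat B1 (fun u v => at_sort u (s1 u v x))) /\
    (forall x, sat C2 (fun u v => at_sort u (s u v x)) <-> sat B2 (fun u v => at_sort u (s2 u v x))).
Proof.
move=> h1 h2; have [G [s [f1 [f2 [hs [e1 e2]]]]]] := merge_params h1 h2.
exists G, (fsub B1 (fun u v => PVar (f1 u v) : @tm LPA G u)),
  (fsub B2 (fun u v => PVar (f2 u v) : @tm LPA G u)), s; do 2 (split=> //).
- move=> x; rewrite sat_fsub (_ : (fun _ _ => _) = (fun u v => at_sort u (s1 u v x))) //.
  by apply: env_ext => u v; rewrite ev_pev /= e1.
- move=> x; rewrite sat_fsub (_ : (fun _ _ => _) = (fun u v => at_sort u (s2 u v x))) //.
  by apply: env_ext => u v; rewrite ev_pev /= e2.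
Qed.

Lemma FD_imp n (A B : vec n -> Prop) : FD A -> FD B -> FD (fun x => A x -> B x).
Proof.
move=> [G1 [B1 [s1 [h1 e1]]]] [G2 [B2 [s2 [h2 e2]]]].
have [G [C1 [C2 [s [hs [c1 c2]]]]]] := FD_merge B1 B2 h1 h2.
by exists G, (Imp C1 C2), s; split=> // x; rewrite /= c1 c2 e1 e2.
Qed.
Lemma FD_False n : FD (n := n) (fun _ => False).
Proof. by exists [], Bot, enil; split=> // u v; case: (var_nil_elim v). Qed.

(** Several free variables may denote the last coordinate. The substitution [th] merges them into
    the one variable [vz], ready to be bound, and weakens all others. *)
Lemma FD_split n (A : vec (S n) -> Prop) : FD A ->
  exists G (B : fm LPA (tt :: G)) (s : forall u, var G u -> vec n -> D),
    (forall u v, coord (s u v)) /\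
    forall x y, A (x, y) <-> sat B (y ;; (fun u v => at_sort u (s u v x))).
Proof.
move=> [G [B [s [hs e]]]].
have ex u v : exists p : bool * (vec n -> D), coord (snd p) /\
    forall x y, s u v (x, y) = if fst p then y else snd p x.
  case: (hs u v) => [h|[g [cg h]]].
    by exists (true, fun _ => o); split=> [|x y]; [apply: coord_const|rewrite h].
  by exists (false, g); split=> // x y; rewrite h.
pose c u v := proj1_sig (constructive_indefinite_description _ (ex u v)).
have cP u v : coord (snd (c u v)) /\ forall x y, s u v (x, y) = if fst (c u v) then y else snd (c u v) x.
  exact: (proj2_sig (constructive_indefinite_description _ (ex u v))).
pose th : @sub LPA G (tt :: G) := fun u v =>
  (match u return var G u -> ptm (tt :: G) u with
   | tt => fun v => if fst (c tt v) then PVar vz else PVar (vs v) end) v.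
exists G, (fsub B th), (fun u v => snd (c u v)); split; first by move=> u v; case: (cP u v).
move=> x y; rewrite e sat_fsub.
suff -> : (fun u v => at_sort u (s u v (x, y))) = (fun u v =>
    ev (m := Q) (th u v) (y ;; (fun u v => at_sort u (snd (c u v) x)))) by [].
apply: env_ext => -[] v /=; case: (cP tt v) => _ ->; rewrite /th.
by case: (fst _); rewrite ev_pev.
Qed.

Lemma FD_all n (A : vec n -> D -> Prop) : FD (n := S n) (fun p => A (fst p) (snd p)) ->
  FD (fun x => forall y, A x y).
Proof.
move=> /FD_split[G [B [s [hs e]]]]; exists G, (All (L := LPA) tt B), s; split=> // x.
by split=> /= h y; [apply/e|apply/(e x y)]; apply: h.
Qed.

Lemma FD_not n (A : vec n -> Prop) : FD A -> FD (fun x => ~ A x).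
Proof. by move=> h; apply: FD_imp h (@FD_False n). Qed.
Lemma FD_and n (A B : vec n -> Prop) : FD A -> FD B -> FD (fun x => A x /\ B x).
Proof.
move=> hA hB; apply: (FD_ext (A := fun x => ~ (A x -> ~ B x))); first by move=> x; tauto.
by apply: FD_not; apply: FD_imp => //; apply: FD_not.
Qed.
Lemma FD_or n (A B : vec n -> Prop) : FD A -> FD B -> FD (fun x => A x \/ B x).
Proof.
move=> hA hB; apply: (FD_ext (A := fun x => ~ A x -> B x)); first by move=> x; tauto.
by apply: FD_imp => //; apply: FD_not.
Qed.
Lemma FD_iff n (A B : vec n -> Prop) : FD A -> FD B -> FD (fun x => A x <-> B x).
Proof. by move=> hA hB; apply: FD_and; apply: FD_imp. Qed.
Lemma FD_ex n (A : vec n -> D -> Prop) : FD (n := S n) (fun p => A (fst p) (snd p)) ->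
  FD (fun x => exists y, A x y).
Proof.
move=> d; apply: (FD_ext (A := fun x => ~ forall y, ~ A x y)).
  move=> x; split=> [h|[y hy] h]; last exact: (h y).
  by apply: NNPP => h'; apply: h => y hy; apply: h'; exists y.
by apply: FD_not; apply: FD_all; apply: FD_not.
Qed.

Lemma FD_reindex m n (A : vec m -> Prop) (h : vec n -> vec m) :
  (forall f, coord f -> coord (fun x => f (h x))) -> FD A -> FD (fun x => A (h x)).
Proof.
move=> hc [G [B [s [hs e]]]]; exists G, B, (fun u v x => s u v (h x)); split=> // u v.
exact: hc.
Qed.

Lemma p_ind (A : D -> Prop) : FD (n := 1) (fun x => A (snd x)) -> A o ->
  (forall y, A y -> A (su y)) -> forall y, A y.
Proof.
move=> /FD_split[G [B [s [_ e]]]] h0 hs y; pose r : env Q G := fun u v => at_sort u (s u v tt).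
have eB w : A w <-> sat B (w ;; r) := e tt w.
apply/eB; apply: (hQ (pa_ind B) r); split.
- by apply/sat_inst; rewrite ev_pev; apply/eB.
- move=> w /eB /hs /eB h; apply/sat_fsub; move: h; congr (sat _ _).
  by apply: env_cons_ext => [|u v] /=; rewrite ev_pev.
Qed.

Definition FT n (t : vec n -> D) : Prop := FD (n := S n) (fun p => snd p = t (fst p)).

Lemma FD_atom n (t : ptm [tt; tt] tt) (f g h : vec n -> D) : coord f -> coord g -> coord h ->
  FD (fun x => h x = pev t (f x ;; g x ;; nul)).
Proof.
move=> cf cg ch.
pose s := @econs unit (fun _ => vec n -> D) [tt; tt] tt h (@econs unit (fun _ => vec n -> D) [tt] tt f
  (@econs unit (fun _ => vec n -> D) [] tt g enil)).
exists [tt; tt; tt], (@Eq LPA [tt; tt; tt] x0 (tsub (l := LPA) (fun u v => PVar (vs v)) t)), s; split.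
  apply: var_cons_ind => //; apply: var_cons_ind => //; apply: var_cons_ind => // u v.
  by case: (var_nil_elim v).
move=> x; rewrite /= eqvQ ev_pev (ev_tsub (m := Q)) /= ev_pev.
suff -> : (f x ;; g x ;; nul) = (fun u v => ev (m := Q) (PVar (vs v) : ptm [tt; tt; tt] u)
  (fun u v => at_sort u (s u v x))) by [].
apply: env_cons_ext; rewrite ?ev_pev //; apply: var_cons_ind; rewrite ?ev_pev // => u v.
by case: (var_nil_elim v).
Qed.
Lemma FD_atom0 n (f h : vec n -> D) : coord f -> coord h -> FD (fun x => h x = f x).
Proof. by move=> cf ch; apply: (@FD_atom n x0 f f h). Qed.

Lemma FT_coord n (t : vec n -> D) : coord t -> FT t.
Proof. by move=> ct; apply: FD_atom0; [right; exists t|left]. Qed.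
Lemma FT_weaken n (t : vec n -> D) : FT t -> FT (n := S n) (fun p => t (fst p)).
Proof.
move=> ht; refine (FD_reindex (m := S n) (n := S (S n)) (h := fun p : vec (S (S n)) => (fst (fst p), snd p)) _ ht) => f [h|[g [cg h]]].
  by left=> x; rewrite h.
right; exists (fun p => g (fst p)); split; last by move=> x; rewrite h.
by right; exists g.
Qed.

(** A definable function need not be given by a term, so substitution goes through its graph: the
    values are introduced by existential quantifiers. *)
Lemma FD_subst2 n (A : D -> D -> Prop) (t u : vec n -> D) :
  FD (n := 2) (fun p => A (snd (fst p)) (snd p)) -> FT t -> FT u -> FD (fun x => A (t x) (u x)).
Proof.
move=> hA ht hu.
apply: (FD_ext (A := fun x => exists y, y = t x /\ exists w, w = u x /\ A y w)).
  by move=> x; split=> [[y [-> [w [->]]]]|h] //; exists (t x); split=> //; exists (u x).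
apply: FD_ex; apply: FD_and => //; apply: FD_ex; apply: FD_and; first exact: FT_weaken.
refine (FD_reindex (m := 2) (n := S (S n)) (h := fun p : vec (S (S n)) => (tt, snd (fst p), snd p)) _ hA).
move=> f [h|[g [cg h]]]; first by left=> x; rewrite h.
right; exists (fun p => g (tt, snd p)); split; last by move=> x; rewrite h.
case: cg => [h'|[k [[a ka] h']]]; first by left=> x; rewrite h'.
by apply: (coord_ext (f := fun _ => a)) (coord_const _ _) => x; rewrite h' ka.
Qed.
Lemma FD_eq n (t u : vec n -> D) : FT t -> FT u -> FD (fun x => t x = u x).
Proof.
apply: (FD_subst2 (A := fun x y => x = y)).
by apply: FD_atom0; [left|right; exists snd; split=> //; left].
Qed.
Lemma FD_subst1 n (A : D -> Prop) (t : vec n -> D) :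
  FD (n := 1) (fun p => A (snd p)) -> FT t -> FD (fun x => A (t x)).
Proof.
move=> hA ht; apply: (FD_subst2 (A := fun x _ => A x) _ ht ht).
refine (FD_reindex (m := 1) (n := 2) (h := fun p : vec 2 => fst p) _ hA) => f cf; by right; exists f.
Qed.
Lemma FT_op n (op : D -> D -> D) (t u : vec n -> D) :
  FT (n := 2) (fun p => op (snd (fst p)) (snd p)) -> FT t -> FT u -> FT (fun x => op (t x) (u x)).
Proof.
move=> hop ht hu.
apply: (FD_ext (n := S n)
  (A := fun p => exists y, y = t (fst p) /\ exists w, w = u (fst p) /\ snd p = op y w)).
  by move=> x; split=> [[y [-> [w [->]]]]|h] //; exists (t (fst x)); split=> //; exists (u (fst x)).
apply: FD_ex; apply: FD_and; first exact: (FT_weaken ht).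
apply: FD_ex; apply: FD_and; first exact: (FT_weaken (FT_weaken hu)).
refine (FD_reindex (m := 3) (n := S (S (S n)))
  (h := fun p : vec (S (S (S n))) => (tt, snd (fst p), snd p, snd (fst (fst p)))) _ hop).
move=> f [h|[g [cg h]]].
  right; exists (fun p => snd (fst p)); split; last by move=> x; rewrite h.
  by right; exists snd; split=> //; left.
case: cg => [h'|[k [[h2|[l [[a la] h2]]] h']]].
- by left=> x; rewrite h h'.
- by right; exists snd; split; [left|move=> x; rewrite h h' h2].
- by apply: (coord_ext (f := fun _ => a)) (coord_const _ _) => x; rewrite h h' h2 la.
Qed.
Lemma FT_pev n (t : ptm [tt; tt] tt) (a b : vec n -> D) : FT a -> FT b ->
  FT (fun x => pev t (a x ;; b x ;; nul)).
Proof.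
apply: (FT_op (op := fun x y => pev t (x ;; y ;; nul))); apply: FD_atom; last by left.
- right; exists (fun p => snd (fst p)); split=> //; right; exists snd; split=> //; by left.
- by right; exists snd; split=> //; left.
Qed.
Lemma FT_pl n (t u : vec n -> D) : FT t -> FT u -> FT (fun x => t x + u x).
Proof. exact: (FT_pev (PAdd x0 x1)). Qed.
Lemma FT_ml n (t u : vec n -> D) : FT t -> FT u -> FT (fun x => t x * u x).
Proof. exact: (FT_pev (PMul x0 x1)). Qed.
Lemma FT_ps n (t : vec n -> D) : FT t -> FT (fun x => su (t x)).
Proof. move=> h; exact: (FT_pev (PSucc x0) h h). Qed.
Lemma FT_fn n f (t : vec n -> D) : FT (n := 1) (fun x => f (snd x)) -> FT t -> FT (fun x => f (t x)).
Proof.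
move=> hf ht; refine (FT_op (op := fun x _ => f x) _ ht ht); exact: (FT_weaken hf).
Qed.

Ltac coords := cbn; first [left; intros; reflexivity
  | right; eexists; split; [|intros [? ?]; cbn; reflexivity]; coords
  | eexists; intros; reflexivity].
Ltac ft := first [apply: FT_coord; coords | apply: FT_pl; ft | apply: FT_ml; ft | apply: FT_ps; ft
  | apply: FT_fn; [assumption|ft] ].
Ltac fd := first [apply: FD_False | apply: FD_not; fd | apply: FD_all; fd | apply: FD_ex; fd
  | apply: FD_and; fd | apply: FD_or; fd | apply: FD_iff; fd
  | apply: FD_imp; fd | apply: FD_eq; ft | apply: FD_subst1; [assumption|ft] ].

(** * Elementary arithmetic from the axioms of PA *)

Local Notation "1" := (su o).

Lemma pl_ol x : o + x = x.
Proof. by elim/p_ind: x => [||x e]; [fd|rewrite pl_o|rewrite pl_s e]. Qed.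
Lemma pl_sl x y : su x + y = su (x + y).
Proof. by elim/p_ind: y => [||y e]; [fd|rewrite !pl_o|rewrite !pl_s e]. Qed.
Lemma pl_comm x y : x + y = y + x.
Proof. by elim/p_ind: y => [||y e]; [fd|rewrite pl_o pl_ol|rewrite pl_s pl_sl e]. Qed.
Lemma pl_assoc x y w : x + (y + w) = x + y + w.
Proof. by elim/p_ind: w => [||w e]; [fd|rewrite !pl_o|rewrite !pl_s e]. Qed.
Lemma ml_ol x : o * x = o.
Proof. by elim/p_ind: x => [||x e]; [fd|rewrite ml_o|rewrite ml_s e pl_o]. Qed.
Lemma ml_sl x y : su x * y = x * y + y.
Proof.
elim/p_ind: y => [||y e]; [fd|by rewrite !ml_o pl_o|].
by rewrite !ml_s e !pl_s -!pl_assoc (pl_comm y x).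
Qed.
Lemma ml_comm x y : x * y = y * x.
Proof. by elim/p_ind: y => [||y e]; [fd|rewrite ml_o ml_ol|rewrite ml_s ml_sl e]. Qed.
Lemma ml_distr x y w : (x + y) * w = x * w + y * w.
Proof.
elim/p_ind: w => [||w e]; [fd|by rewrite !ml_o pl_o|].
by rewrite !ml_s e -!pl_assoc; congr (_ + _); rewrite !pl_assoc (pl_comm x).
Qed.
Lemma ml_assoc x y w : x * (y * w) = x * y * w.
Proof.
elim/p_ind: w => [||w e]; [fd|by rewrite !ml_o|].
by rewrite !ml_s -e (ml_comm x (_ + _)) ml_distr (ml_comm (y * w)) (ml_comm y x).
Qed.
Lemma ml_1l x : 1 * x = x.
Proof. by rewrite ml_sl ml_ol pl_ol. Qed.
Lemma su_1 x : su x = x + 1.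
Proof. by rewrite pl_s pl_o. Qed.

Definition peano_semiring : semi_ring_theory o 1 (@pl Q) (@ml Q) eq :=
  mk_srt o 1 (@pl Q) (@ml Q) eq pl_ol pl_comm pl_assoc ml_1l ml_ol ml_comm ml_assoc ml_distr.
Add Ring peano_ring : peano_semiring.

(* [su o] is the unit of the semiring and must not be unfolded. *)
Ltac su_ring := repeat match goal with |- context [@ps _ ?x] =>
  lazymatch x with pz _ => fail | _ => rewrite (su_1 x) end end; ring.

Lemma p_case x : x = o \/ exists y, x = su y.
Proof. elim/p_ind: x => [||x _]; [fd|by left|by right; exists x]. Qed.
Lemma pl_inj x y w : x + y = x + w -> y = w.
Proof. by elim/p_ind: x => [||x IH]; [fd|rewrite !pl_ol|rewrite !pl_sl => /ps_inj]. Qed.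
Lemma pl_eq_o x y : x + y = o -> y = o.
Proof. by case: (p_case y) => [->|[w ->]] //; rewrite pl_s => /ps_o. Qed.
Lemma pl_self x y : x + y = x -> y = o.
Proof. by rewrite -{2}(pl_o x) => /pl_inj. Qed.
Lemma ml_eq_o x y : x * y = o -> x = o \/ y = o.
Proof.
case: (p_case y) => [->|[w ->]]; first by right.
by rewrite ml_s => /pl_eq_o; left.
Qed.

Definition ltn x y := exists k, x + su k = y.

Lemma ltn_irr x : ~ ltn x x.
Proof. by move=> [k /pl_self /ps_o]. Qed.
Lemma ltn_o x : ~ ltn x o.
Proof. by move=> [k]; rewrite pl_s => /ps_o. Qed.
Lemma ltn_s x y : ltn x (su y) <-> ltn x y \/ x = y.
Proof.
split=> [[k]|[[k <-]|->]]; last by exists o; rewrite pl_s pl_o.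
  rewrite pl_s => /ps_inj <-; case: (p_case k) => [->|[l ->]]; first by right; rewrite pl_o.
  by left; exists l.
by exists (su k); rewrite !pl_s.
Qed.
Lemma ltn_self_s x : ltn x (su x).
Proof. by apply/ltn_s; right. Qed.
Lemma ltn_trans x y w : ltn x y -> ltn y w -> ltn x w.
Proof. by move=> [k <-] [l <-]; exists (k + su l); rewrite -pl_assoc !pl_sl !pl_s. Qed.
Lemma ltn_total x y : ltn x y \/ x = y \/ ltn y x.
Proof.
elim/p_ind: y => [||y [h|[->|[k <-]]]].
- by rewrite /ltn; fd.
- by case: (p_case x) => [->|[y ->]]; [right; left|right; right; exists y; rewrite pl_ol].
- by left; apply/ltn_s; left.
- by left; apply: ltn_self_s.
- case: (p_case k) => [->|[l ->]]; first by right; left; rewrite pl_s pl_o.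
  by right; right; exists l; rewrite pl_sl [RHS]pl_s.
Qed.
Lemma ltn_ss x y : ltn (su x) (su y) <-> ltn x y.
Proof.
split=> -[k]; first by rewrite pl_sl => /ps_inj <-; exists k.
by move=> <-; exists k; rewrite pl_sl.
Qed.
Lemma ltn_plus_l x y w : ltn x y -> ltn x (y + w).
Proof. by move=> [k <-]; exists (k + w); rewrite -pl_assoc pl_sl. Qed.

Lemma least_def (A : D -> Prop) : FD (n := 1) (fun x => A (snd x)) -> (exists x, A x) ->
  exists x, A x /\ forall y, ltn y x -> ~ A y.
Proof.
move=> dA [x Ax]; apply: NNPP => no.
suff h : forall n y, ltn y n -> ~ A y by apply: (h _ _ (ltn_self_s x)).
elim/p_ind=> [|y /ltn_o //|n IH y /ltn_s[/IH //|-> An]]; last by apply: no; exists n.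
by rewrite /ltn; fd.
Qed.

(** Injective because [a] is smaller than the gap between the squares of [a + b] and its successor.
    It is a polynomial, with no halving, at the price of numbers that code no pair. *)
Definition pair a b := (a + b) * (a + b) + a.

Lemma pair_lt a b c d : ltn (a + b) (c + d) -> pair a b <> pair c d.
Proof.
rewrite /pair => -[k <-] e.
(* With c + d = a + b + k + 1, the successor of this number is the excess of [pair c d] over
   [pair a b], and a successor is not zero. *)
apply: (@ps_o (a + b + b + (a + b) * k + (a + b) * k + k + k + k * k + c)).
apply: (@pl_self a); apply: (@pl_inj ((a + b) * (a + b))); rewrite [RHS]e; su_ring.
Qed.

Lemma pair_inj a b c d : pair a b = pair c d -> a = c /\ b = d.
Proof.
case: (ltn_total (a + b) (c + d)) => [/pair_lt //|[e|/pair_lt h e]]; last by case: h.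
rewrite /pair e => /pl_inj ac; split=> //; apply: (@pl_inj a); by rewrite {2}ac.
Qed.

(** * Coding definable bounded sets by divisibility *)

Definition dv p c := exists q, c = p * q.

Lemma dv_sub p x y : dv p (x + y) -> dv p x -> dv p y.
Proof.
move=> [v ev'] [u eu]; rewrite eu in ev'; case: (ltn_total u v) => [[k ek]|[ek|[k ek]]].
- by exists (su k); apply: (@pl_inj (p * u)); rewrite ev' -ek; ring.
- by exists o; apply: (@pl_inj (p * u)); rewrite ev' -ek; ring.
- exists o; rewrite ml_o; apply: (@pl_eq_o (p * su k)); apply: (@pl_self (p * v)).
  by rewrite -[RHS]ev' -ek; ring.
Qed.

Lemma dv_mult p x y : dv p x -> dv p (x * y).
Proof. by move=> [u ->]; exists (u * y); ring. Qed.

Lemma common_multiple B : exists d, d <> o /\ forall k, ltn k B -> dv (su k) d.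
Proof.
elim/p_ind: B => [||B [d [nd hd]]].
- by rewrite /ltn /dv; fd.
- by exists 1; split; [apply: ps_o|move=> k /ltn_o].
- exists (d * su B); split; first by move=> /ml_eq_o[|/ps_o].
  move=> k /ltn_s[/hd /dv_mult //|->]; exists d; exact: ml_comm.
Qed.

(* The moduli of Goedel's beta function: [modulus d m] for distinct [m] below B
   are pairwise coprime when d is a common multiple of 1, ..., B. *)
Definition modulus d m := su (su m * d).

(** The modulus is 1 + (m + 1)d, so its multiple by [x] is [x * d * su m + x]. If it divides the
    first summand, it divides [x]. *)
Lemma modulus_coprime d m x : dv (modulus d m) (x * d) -> dv (modulus d m) x.
Proof.
move=> h; apply: (@dv_sub _ (x * d * su m)); last exact: dv_mult.
by exists x; rewrite /modulus; su_ring.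
Qed.

(** Writing [d] as [su k * e] and multiplying by [e] turns the factor [su k * d] into the square of
    [d], which is cancelled one factor at a time. *)
Lemma modulus_cancel d m k c : dv (su k) d -> dv (modulus d m) (c * (su k * d)) ->
  dv (modulus d m) c.
Proof.
move=> [e ed] h; apply: (@modulus_coprime d); apply: (@modulus_coprime d).
have -> : c * d * d = c * (su k * d) * e by rewrite {2}ed; ring.
exact: dv_mult.
Qed.

(** Two moduli differ by [su k * d], where [su k] is the distance of their indices and hence divides
    [d]. This cancellation form of coprimality avoids primes and Bezout coefficients. *)
Lemma modulus_distinct B d m n c : (forall k, ltn k B -> dv (su k) d) -> ltn m B -> ltn n B ->
  m <> n -> dv (modulus d m) (c * modulus d n) -> dv (modulus d m) c.
Proof.
have bound k x : ltn (x + su k) B -> ltn k B.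
  move=> [l <-]; exists (x + su l); su_ring.
move=> hd mB nB ne h; case: (ltn_total m n) => [[k ek]|[//|[k ek]]].
- apply: (@modulus_cancel d m k); first by apply: hd; apply: (@bound k m); rewrite ek.
  apply: (@dv_sub _ (c * modulus d m)); last by exists c; ring.
  suff -> : c * modulus d m + c * (su k * d) = c * modulus d n by [].
  by rewrite -ek /modulus; su_ring.
- apply: (@modulus_cancel d m k); first by apply: hd; apply: (@bound k n); rewrite ek.
  apply: (dv_sub _ h).
  by exists c; rewrite -ek /modulus; su_ring.
Qed.

(** [c] is the product of the moduli of the members of [A] below [B]; by the cancellation law no
    other modulus below [B] divides it. *)
Lemma code_set (A : D -> Prop) B : FD (n := 1) (fun x => A (snd x)) ->
  exists c d, forall m, ltn m B -> (dv (modulus d m) c <-> A m).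
Proof.
move=> dA; have [d [nd hd]] := common_multiple B.
suff [c hc] : exists c, forall m, ltn m B -> (dv (modulus d m) c <-> ltn m B /\ A m).
  by exists c, d => m mB; rewrite hc //; tauto.
move: {2}B => n; elim/p_ind: n => [||n [c hc]].
- by rewrite /ltn /dv /modulus; fd.
(* The empty product. No modulus divides 1, since [d] is nonzero and a modulus is therefore at least
   2. *)
- exists 1 => m _; split; last by case=> /ltn_o.
  move=> [q]; case: (p_case q) => [->|[r ->]]; first by rewrite ml_o => /ps_o.
  rewrite /modulus ml_sl pl_s => /ps_inj h; have r0 := pl_eq_o (eq_sym h).
  move: h; rewrite r0 pl_o => h.
  case: (ml_eq_o (eq_sym h)) => [/ml_eq_o[/ps_o|]|/ps_o] //.
- case: (classic (A n /\ ltn n B)) => [[An nB]|no].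
    exists (c * modulus d n) => m mB; split.
      case: (classic (m = n)) => [-> _|ne h]; first by split=> //; apply: ltn_self_s.
      have [mn Am] := proj1 (hc m mB) (modulus_distinct hd mB nB ne h).
      by split=> //; apply/ltn_s; left.
    move=> [/ltn_s[mn|->] Am]; last by exists c; ring.
    by apply: dv_mult; apply/hc.
  exists c => m mB; rewrite hc //; split=> -[mn Am]; split=> //.
    by apply/ltn_s; left.
  by move: mn => /ltn_s[//|e]; case: no; subst.
Qed.

Lemma code_set_bounded (A : D -> Prop) B : FD (n := 1) (fun x => A (snd x)) ->
  exists c d, forall m, ltn m B /\ dv (modulus d m) c <-> ltn m B /\ A m.
Proof.
move=> /(@code_set _ B)[c [d h]]; exists c, d => m.
by split=> -[mB]; [rewrite h|rewrite -h].
Qed.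

(** * Primitive recursion through coded finite approximations *)

Section Recursion.
Variables f g : D -> D.
Hypotheses (hf : FT (n := 1) (fun x => f (snd x))) (hg : FT (n := 1) (fun x => g (snd x))).

Definition in_code c d B m := ltn m B /\ dv (modulus d m) c.
(* The set coded by (c, d, B) contains the graph up to n of the function
   defined by recursion, and is a function there. *)
Definition approx a n c d B := in_code c d B (pair o (f a)) /\
  (forall i v, ltn i n -> in_code c d B (pair i v) -> in_code c d B (pair (su i) (g (pair (pair a i) v)))) /\
  (forall i v w, ltn i (su n) -> in_code c d B (pair i v) -> in_code c d B (pair i w) -> v = w).
Definition rec_value a n y := exists c d B, approx a n c d B /\ in_code c d B (pair n y).

Lemma rec_value_FD n (t u w : vec n -> D) : FT t -> FT u -> FT w ->
  FD (fun x => rec_value (t x) (u x) (w x)).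
Proof.
move=> ht hu hw.
have h3 : FD (n := 3) (fun x => rec_value (snd (fst (fst x))) (snd (fst x)) (snd x)).
  by rewrite /rec_value /approx /in_code /pair /ltn /dv /modulus; fd.
apply: (FD_ext (A := fun x => exists a, a = t x /\ exists b, b = u x /\ exists c, c = w x /\ rec_value a b c)).
  move=> x; split=> [[a [-> [b [-> [c [->]]]]]]|h] //.
  by exists (t x); split=> //; exists (u x); split=> //; exists (w x).
apply: FD_ex; apply: FD_and => //.
apply: FD_ex; apply: FD_and; first exact: (FT_weaken hu).
apply: FD_ex; apply: FD_and; first exact: (FT_weaken (FT_weaken hw)).
refine (FD_reindex (m := 3) (n := S (S (S n)))
  (h := fun p : vec (S (S (S n))) => (tt, snd (fst (fst p)), snd (fst p), snd p)) _ h3).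
move=> k [h|[k1 [[h1|[k2 [[h2|[k3 [[a ea] h2]]] h1]]] h]]].
- by left=> x; rewrite h.
- by right; exists snd; split; [left|move=> x; rewrite h h1].
- by right; exists (fun p => snd (fst p)); split; [right; exists snd; split; [left|]|
    move=> x; rewrite h h1 h2].
- by apply: (coord_ext (f := fun _ => a)) (coord_const _ _) => x; rewrite h h1 h2 ea.
Qed.

Lemma approx_le a n c d B : approx a (su n) c d B -> approx a n c d B.
Proof.
move=> [h0 [hs hu]]; split=> //; split.
- by move=> i v hi; apply: hs; apply: ltn_trans hi (ltn_self_s n).
- by move=> i v w hi; apply: hu; apply: ltn_trans hi (ltn_self_s _).
Qed.

Lemma approx_ex a n c d B : approx a n c d B -> exists v, in_code c d B (pair n v).
Proof.
move=> [h0 [hs _]]; suff h : forall i, ltn i (su n) -> exists v, in_code c d B (pair i v).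
  by apply: h; apply: ltn_self_s.
elim/p_ind=> [|_|i IH /ltn_ss hi].
- by rewrite /in_code /pair /ltn /dv /modulus; fd.
- by exists (f a).
- have [v hv] : exists v, in_code c d B (pair i v) by apply: IH; apply/ltn_s; left.
  by exists (g (pair (pair a i) v)); apply: hs.
Qed.

(** Two different codes are shown, by induction on [i], to share a value at each index; since each
    is single-valued, their values at [n] coincide. *)
Lemma rec_value_unique a n y y' : rec_value a n y -> rec_value a n y' -> y = y'.
Proof.
move=> [c [d [B [[h0 [hs hu]] hy]]]] [c' [d' [B' [[h0' [hs' hu']] hy']]]].
suff [v [hv hv']] : exists v, in_code c d B (pair n v) /\ in_code c' d' B' (pair n v).
  by rewrite (hu n y v (ltn_self_s n) hy hv) (hu' n y' v (ltn_self_s n) hy' hv').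
suff h : forall i, ltn i (su n) -> exists v, in_code c d B (pair i v) /\ in_code c' d' B' (pair i v).
  by apply: h; apply: ltn_self_s.
elim/p_ind=> [|_|i IH /ltn_ss hi].
- by rewrite /in_code /pair /ltn /dv /modulus; fd.
- by exists (f a).
- have [v [hv hv']] : exists v, in_code c d B (pair i v) /\ in_code c' d' B' (pair i v).
    by apply: IH; apply/ltn_s; left.
  by exists (g (pair (pair a i) v)); split; [apply: hs|apply: hs'].
Qed.

Lemma rec_value_ex a n : exists y, rec_value a n y.
Proof.
elim/p_ind: n => [||n [y [c [d [B [ap my]]]]]].
  by apply: FD_ex; apply: rec_value_FD; ft.
  have [|c [d h]] := @code_set_bounded (fun m => m = pair o (f a)) (su (pair o (f a))).
    by rewrite /pair; fd.
  have h' m : in_code c d (su (pair o (f a))) m <-> m = pair o (f a).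
    by rewrite /in_code h; split=> [[]|->] //; split=> //; apply: ltn_self_s.
  exists (f a), c, d, (su (pair o (f a))); split; last by apply/h'.
  split; [by apply/h'|split=> [i v /ltn_o //|i v w _]].
  by move=> /h' /pair_inj[_ ->] /h' /pair_inj[_ ->].
have [h0 [hs hu]] := ap.
pose y' := g (pair (pair a n) y); pose e' := pair (su n) y'.
(* The old code is single-valued only up to [n] and may contain arbitrary pairs at later indices, so
   it is cut off there before the new pair is added. *)
pose A m := exists i v, m = pair i v /\
  ((ltn i (su n) /\ in_code c d B m) \/ (i = su n /\ v = y')).
have [|c' [d' h]] := @code_set_bounded A (B + su e').
  by rewrite /A /in_code /pair /ltn /dv /modulus; fd.
have h' i v : in_code c' d' (B + su e') (pair i v) <->
    (ltn i (su n) /\ in_code c d B (pair i v)) \/ (i = su n /\ v = y').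
  rewrite /in_code h; split.
    by move=> [_ [j [w [/pair_inj[<- <-]]]]].
  move=> hv; split; last by exists i, v.
  case: hv => [[_ [vB _]]|[-> ->]]; first exact: ltn_plus_l.
  by rewrite pl_comm; apply: ltn_plus_l; apply: ltn_self_s.
have n0 i : i = su n -> ~ ltn i (su n) by move=> ->; apply: ltn_irr.
exists y', c', d', (B + su e'); split; last by apply/h'; right.
split; [|split].
- apply/h'; left; split=> //; case: (p_case n) => [->|[l ->]]; first exact: ltn_self_s.
  by exists (su l); rewrite pl_ol.
- move=> i v hi /h' [[_ hv]|[/n0 //]]; apply/h'; move: hi => /ltn_s[hi|ei].
  + by left; split; [apply/ltn_ss|apply: hs].
  + subst i; right; split=> //; rewrite /y' (hu n v y) //; exact: ltn_self_s.
- move=> i v w _ /h' [[hi hv]|[ei ->]] /h' [[hi' hw]|[ei' ->]] //.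
  + exact: (hu i).
  + by case: (n0 i).
  + by case: (n0 i).
Qed.

Lemma rec_value_o a y : rec_value a o y -> y = f a.
Proof.
by move=> [c [d [B [[h0 [hs hu]] hy]]]]; apply: (hu o) => //; apply: ltn_self_s.
Qed.
Lemma rec_value_s a n y y' : rec_value a n y -> rec_value a (su n) y' -> y' = g (pair (pair a n) y).
Proof.
move=> vy [c [d [B [ap hy]]]]; have [v hv] := approx_ex (approx_le ap).
have -> : y = v by apply: rec_value_unique vy _; exists c, d, B; split=> //; apply: approx_le.
case: ap => h0 [hs hu]; apply: (hu (su n)) => //; first exact: ltn_self_s.
by apply: hs => //; apply: ltn_self_s.
Qed.
End Recursion.

(** * The definable functions as a model of ACA_0 *)

Definition pFn (f : D -> D) : Prop := FT (n := 1) (fun x => f (snd x)).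

Lemma pFn_by (f : D -> D) (A : D -> D -> Prop) :
  FD (n := 2) (fun p => A (snd (fst p)) (snd p)) -> (forall x y, A x y <-> y = f x) -> pFn f.
Proof. by move=> d e; apply: (FD_ext (n := 2)) d => -[[u x] y]; apply: e. Qed.

Lemma pFn_const a : pFn (fun _ => a).
Proof. by rewrite /pFn; ft. Qed.
Lemma pFn_id : pFn (fun n => n).
Proof. by rewrite /pFn; ft. Qed.
Lemma pFn_comp f g : pFn f -> pFn g -> pFn (fun n => f (g n)).
Proof. move=> hf hg; exact: (FT_fn (n := 1) (t := fun x => g (snd x)) hf hg). Qed.
Lemma pFn_sc : pFn su.
Proof. by rewrite /pFn; ft. Qed.
Lemma FT_pair n (t u : vec n -> D) : FT t -> FT u -> FT (fun x => pair (t x) (u x)).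
Proof. by move=> ht hu; apply: FT_pl => //; apply: FT_ml; apply: FT_pl. Qed.
Lemma pFn_pair f g : pFn f -> pFn g -> pFn (fun n => pair (f n) (g n)).
Proof. exact: FT_pair. Qed.

Definition unpair m : D * D :=
  match excluded_middle_informative (exists p : D * D, pair (fst p) (snd p) = m) with
  | left h => proj1_sig (constructive_indefinite_description _ h)
  | right _ => (o, o)
  end.
Definition pp1 m := fst (unpair m).
Definition pp2 m := snd (unpair m).

Lemma unpair_pair a b : unpair (pair a b) = (a, b).
Proof.
rewrite /unpair; case: excluded_middle_informative => [h|[]]; last by exists (a, b).
by case: constructive_indefinite_description => -[x y] /= /pair_inj[-> ->].
Qed.
Lemma pp1_pair a b : pp1 (pair a b) = a.
Proof. by rewrite /pp1 unpair_pair. Qed.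
Lemma pp2_pair a b : pp2 (pair a b) = b.
Proof. by rewrite /pp2 unpair_pair. Qed.
Lemma unpair_cases m : (exists a b, m = pair a b) \/
  (~ exists a b, pair a b = m) /\ unpair m = (o, o).
Proof.
case: (classic (exists p : D * D, pair (fst p) (snd p) = m)) => [[[a b] /= <-]|no].
  by left; exists a, b.
right; split; first by move=> [a [b e]]; apply: no; exists (a, b).
by rewrite /unpair; case: excluded_middle_informative.
Qed.
Lemma pFn_pp1 : pFn pp1.
Proof.
apply: (@pFn_by _ (fun m y => (exists b, pair y b = m) \/ (~ exists a b, pair a b = m) /\ y = o)).
  by rewrite /pair; fd.
move=> m y; rewrite /pp1; case: (unpair_cases m) => [[a [b ->]]|[no ->]] /=.
  rewrite unpair_pair /=; split=> [[[b' /pair_inj[]]|[[]]] //|->]; last by left; exists b.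
  by exists a, b.
split=> [[[b e]|[]] //|->]; last by right.
by case: no; exists y, b.
Qed.
Lemma pFn_pp2 : pFn pp2.
Proof.
apply: (@pFn_by _ (fun m y => (exists b, pair b y = m) \/ (~ exists a b, pair a b = m) /\ y = o)).
  by rewrite /pair; fd.
move=> m y; rewrite /pp2; case: (unpair_cases m) => [[a [b ->]]|[no ->]] /=.
  rewrite unpair_pair /=; split=> [[[b' /pair_inj[]]|[[]]] //|->]; last by left; exists a.
  by exists a, b.
split=> [[[b e]|[]] //|->]; last by right.
by case: no; exists b, y.
Qed.

Lemma pFn_ind f : pFn f -> f o = o -> (forall n, f n = o -> f (su n) = o) -> forall n, f n = o.
Proof. by move=> hf; apply: p_ind; fd. Qed.

Definition char (A : D -> Prop) x : D :=
  match excluded_middle_informative (A x) with left _ => o | right _ => 1 end.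
Lemma char_o A x : char A x = o <-> A x.
Proof. by rewrite /char; case: excluded_middle_informative => h; split=> // /ps_o. Qed.
Lemma pFn_char (A : D -> Prop) : FD (n := 1) (fun x => A (snd x)) -> pFn (char A).
Proof.
move=> hA; apply: (@pFn_by _ (fun x y => A x /\ y = o \/ ~ A x /\ y = 1)); first by fd.
move=> x y; rewrite /char; case: excluded_middle_informative => h; split;
  by [tauto|move=> ->; tauto].
Qed.
Lemma pFn_eq f g : pFn f -> pFn g -> exists h, pFn h /\ forall n, h n = o <-> f n = g n.
Proof.
move=> hf hg; exists (char (fun n => f n = g n)); split; last by move=> n; apply: char_o.
by apply: pFn_char; fd.
Qed.
Lemma pFn_imp f g : pFn f -> pFn g ->
  exists h, pFn h /\ forall n, h n = o <-> (f n = o -> g n = o).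
Proof.
move=> hf hg; exists (char (fun n => f n = o -> g n = o)); split; last by move=> n; apply: char_o.
by apply: pFn_char; fd.
Qed.
Lemma pFn_all f : pFn f -> exists h, pFn h /\ forall n, h n = o <-> forall m, f (pair n m) = o.
Proof.
move=> hf; exists (char (fun n => forall m, f (pair n m) = o)); split; last by move=> n; apply: char_o.
by apply: pFn_char; rewrite /pair; fd.
Qed.
(** Taking the least witness makes the chosen function definable. *)
Lemma pFn_fun f : pFn f -> (forall n, exists m, f (pair n m) = o) ->
  exists h, pFn h /\ forall n, f (pair n (h n)) = o.
Proof.
move=> hf ex.
pose A n m := f (pair n m) = o /\ forall k, ltn k m -> f (pair n k) <> o.
have exA n : exists m, A n m.
  by apply: (@least_def (fun m => f (pair n m) = o)) => //; rewrite /pair; fd.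
pose h n := proj1_sig (constructive_indefinite_description _ (exA n)).
have hP n : A n (h n) by exact: (proj2_sig (constructive_indefinite_description _ (exA n))).
exists h; split; last by move=> n; case: (hP n).
apply: (@pFn_by _ A); first by rewrite /A /pair /ltn; fd.
move=> n m; split=> [[Am lm]|-> //]; have [Ah lh] := hP n.
case: (ltn_total m (h n)) => [/lh //|[//|/lm //]].
Qed.
Lemma pFn_rec f g : pFn f -> pFn g -> exists h, pFn h /\ forall a, h (pair a o) = f a /\
  forall n, h (pair a (su n)) = g (pair (pair a n) (h (pair a n))).
Proof.
move=> hf hg; have ex k := rec_value_ex hf hg (pp1 k) (pp2 k).
pose h k := proj1_sig (constructive_indefinite_description _ (ex k)).
have hP k : rec_value f g (pp1 k) (pp2 k) (h k).
  exact: (proj2_sig (constructive_indefinite_description _ (ex k))).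
exists h; split.
  apply: (@pFn_by _ (fun k y => rec_value f g (pp1 k) (pp2 k) y)).
    have h1 := pFn_pp1; have h2 := pFn_pp2.
    by apply: (rec_value_FD hf hg); ft.
  by move=> k y; split=> [/rec_value_unique|-> //]; apply.
move=> a; split.
  by apply: (@rec_value_o f g a); have := hP (pair a o); rewrite pp1_pair pp2_pair.
move=> n; apply: (@rec_value_s f g a n).
- by have := hP (pair a n); rewrite pp1_pair pp2_pair.
- by have := hP (pair a (su n)); rewrite pp1_pair pp2_pair.
Qed.

Hypothesis countQ : exists e : nat -> D, forall x, exists i, e i = x.

Lemma env_countable G : exists e : nat -> env Q G, forall r, exists i, e i = r.
Proof.
have [d hd] := countQ; elim: G => [|[] G [e he]].
  by exists (fun _ => enil) => r; exists 0; apply: env_nil_ext.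
exists (fun i => d (fst (Cantor.of_nat i)) ;; e (snd (Cantor.of_nat i))) => r.
have [i hi] := hd (r tt vz); have [j hj] := he (fun u v => r u (vs v)).
exists (Cantor.to_nat (i, j)); rewrite Cantor.cancel_of_to /= hi hj.
exact: env_cons_ext.
Qed.

Lemma unit_list G : G = repeat tt (length G).
Proof. by elim: G => [|[] G IH] //=; rewrite -IH. Qed.

Definition defines G (B : fm LPA (tt :: G)) (r : env Q G) (f : D -> D) : Prop :=
  pFn f /\ forall x y : D, y = f x <-> sat B (pair x y ;; r).

Lemma defines_unique G (B : fm LPA (tt :: G)) r f f' : defines B r f -> defines B r f' -> f = f'.
Proof.
by move=> [_ h] [_ h']; apply: functional_extensionality => x; apply/h'; apply/h.
Qed.

Lemma pFn_defines f : pFn f -> exists G (B : fm LPA (tt :: G)) r, defines B r f.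
Proof.
move=> hf.
have d : FD (n := 1) (fun m => exists x, snd m = pair x (f x)) by rewrite /pair; fd.
have [G [B [s [_ e]]]] := FD_split d.
exists G, B, (fun u v => at_sort u (s u v tt)); split=> // x y.
by rewrite -e /=; split=> [->|[w /pair_inj[-> ->]] //]; exists x.
Qed.

(** A formula for the coded graph, together with values of its parameters, determines the function.
    An index codes the length of the context, the formula and the environment; an index that defines
    no function is sent to the identity. *)
Lemma pFn_countable : exists e : nat -> D -> D, (forall i, pFn (e i)) /\
  forall f, pFn f -> exists i, e i = f.
Proof.
pose eF G := proj1_sig (constructive_indefinite_description _ (LPA_fm_countable G)).
have hF G : forall B, exists i, eF G i = Some B.
  exact: (proj2_sig (constructive_indefinite_description _ (LPA_fm_countable G))).
pose eE G := proj1_sig (constructive_indefinite_description _ (env_countable G)).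
have hE G : forall r, exists i, eE G i = r.
  exact: (proj2_sig (constructive_indefinite_description _ (env_countable G))).
pose R i f := let G := repeat tt (fst (Cantor.of_nat i)) in
  let j := Cantor.of_nat (snd (Cantor.of_nat i)) in
  match eF (tt :: G) (fst j) with Some B => defines B (eE G (snd j)) f | None => False end.
have Runique i f f' : R i f -> R i f' -> f = f'.
  by rewrite /R; case: (eF _ _) => // B; apply: defines_unique.
pose e i : D -> D := match excluded_middle_informative (exists f, R i f) with
  | left h => proj1_sig (constructive_indefinite_description _ h)
  | right _ => fun n => n end.
have Re i f : R i f -> e i = f.
  move=> h; rewrite /e; case: excluded_middle_informative => [h'|[]]; last by exists f.
  by case: constructive_indefinite_description => f' h1 /=; apply: Runique h1 h.
exists e; split.
  move=> i; rewrite /e; case: excluded_middle_informative => [h|_]; last exact: pFn_id.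
  case: constructive_indefinite_description => f /=; rewrite /R; case: (eF _ _) => // B; by case.
move=> f /pFn_defines[G]; rewrite (unit_list G) => -[B [r h]].
have [j hj] := hF _ B; have [k hk] := hE _ r.
exists (Cantor.to_nat (length G, Cantor.to_nat (j, k))); apply: Re.
by rewrite /R !Cantor.cancel_of_to /= hj hk.
Qed.

Definition aca_of_peano : aca :=
  Aca pp1_pair pp2_pair pFn_const pFn_id pFn_comp pFn_sc pFn_pair pFn_pp1 pFn_pp2 ps_o ps_inj
    pFn_ind pFn_eq pFn_imp pFn_all pFn_fun pFn_rec pFn_countable.

(** * Translated sentences in the functional model *)

Local Notation M := aca_of_peano.
Local Notation FM := (fmodel M).

Lemma Mor_pl (X : qspace M) (t u : X -> nn M) : Mor t -> Mor u ->
  Mor (fun x => (t x : D) + (u x : D) : nn M).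
Proof. by move=> ht hu c hc; apply: (FT_pl (ht c hc) (hu c hc)). Qed.
Lemma Mor_ml (X : qspace M) (t u : X -> nn M) : Mor t -> Mor u ->
  Mor (fun x => (t x : D) * (u x : D) : nn M).
Proof. by move=> ht hu c hc; apply: (FT_ml (ht c hc) (hu c hc)). Qed.

(** [plus] was picked by [epsilon] among functions satisfying the recursion equations; induction in
    the model identifies it with the addition of [Q]. *)
Lemma plus_pl (a b : D) : plus (M := M) a b = a + b.
Proof.
move: b; apply: (@nn_ind M (fun b => plus (M := M) a b = (a : D) + (b : D))) => [||b e].
- apply: Def_eq; first by apply: Mor_plus; [apply: Mor_const|apply: Mor_id].
  by apply: Mor_pl; [apply: Mor_const|apply: Mor_id].
- by rewrite plus_z; symmetry; apply: pl_o.
- by rewrite plus_sc e; symmetry; apply: pl_s.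
Qed.

Lemma rec_ml (F : qs M (N ~> N ~> N)) (a b : D) :
  (forall v i : qs M N, ap (ap F v) i = (v : D) + a) -> rec (M := M) (@z M) F b = a * b.
Proof.
move=> hF; move: b; apply: (@nn_ind M (fun b => rec (M := M) (@z M) F b = a * (b : D))) => [||b e].
- apply: Def_eq; last by apply: Mor_ml; [apply: Mor_const|apply: Mor_id].
  by move=> c hc; apply: (Fn_rec_curve hc (Fn_const (@z M)) (cur_const F)).
- by rewrite rec_z; symmetry; apply: ml_o.
- by rewrite rec_sc e hF; symmetry; apply: ml_s.
Qed.

Definition of_sort u : dom Q u -> D := match u with tt => fun x => x end.

Definition tr_env G (r : env Q G) (r' : env FM (ctxN G)) : Prop :=
  forall u (v : var G u), r' N (tr_var v) = of_sort (r u v) :> D.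

Lemma fev_mul (G : list ty) (r : env FM G) (a b : qs M N) : ap (ap (fev mul r) a) b = (a : D) * (b : D).
Proof.
rewrite /mul.
repeat match goal with |- context [ap (fev (@lam ?G ?u ?s ?t) ?r) ?x] =>
  rewrite (@lam_beta M G s u t r x) /= end.
apply: rec_ml => v i.
repeat match goal with |- context [ap (fev (@lam ?G ?u ?s ?t) ?r) ?x] =>
  rewrite (@lam_beta M G s u t r x) /= end.
by rewrite fev_add; exact: plus_pl.
Qed.

Lemma fev_tr_tm G s (t : ptm G s) (r : env Q G) (r' : env FM (ctxN G)) : tr_env r r' ->
  fev (tr_tm t) r' = of_sort (pev t r) :> D.
Proof.
move=> h; elim: t => {s} [s v||t IHt|t IHt u IHu|t IHt u IHu].
- exact: h.
- by [].
- change (su (fev (tr_tm t) r' : D) = su (pev t r)); by rewrite IHt.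
- change (ap (ap (fev add r') (fev (tr_tm t) r')) (fev (tr_tm u) r') = pev t r + pev u r :> D).
  by rewrite IHt IHu fev_add; exact: plus_pl.
- change (ap (ap (fev mul r') (fev (tr_tm t) r')) (fev (tr_tm u) r') = pev t r * pev u r :> D).
  by rewrite IHt IHu; apply: fev_mul.
Qed.

Lemma sat_tr_fm G (A : fm LPA G) : forall (r : env Q G) (r' : env FM (ctxN G)), tr_env r r' ->
  (sat A r <-> sat (M := FM) (tr_fm A) r').
Proof.
have cons_env G' (r : env Q G') (r' : env FM (ctxN G')) x : tr_env r r' ->
    tr_env (x ;; r) (@econs ty (dom FM) _ N x r').
  by move=> h; apply: var_cons_ind.
elim: A => {G} [G t u|G|G A IA B IB|G A IA B IB|G A IA B IB|G [] A IA|G [] A IA] r r' h /=.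
- by rewrite eqvQ !ev_pev (fev_tr_tm t h) (fev_tr_tm u h).
- by [].
- by rewrite (IA r r') // (IB r r').
- by rewrite (IA r r') // (IB r r').
- by rewrite (IA r r') // (IB r r').
- split=> k x; first exact: (proj1 (IA _ _ (cons_env _ _ _ x h)) (k x)).
  exact: (proj2 (IA _ _ (cons_env _ _ _ x h)) (k x)).
- split=> -[x k]; exists x; first exact: (proj1 (IA _ _ (cons_env _ _ _ x h)) k).
  exact: (proj2 (IA _ _ (cons_env _ _ _ x h)) k).
Qed.

Lemma sat_of_tr_provable (B : sentence LPA) : provable ACA0w_mu_U (tr_fm B) ->
  sat B (enil : env Q []).
Proof.
move=> /(fmodel_mu_U M) h; apply/(sat_tr_fm B _ (r' := enil)); last exact: h.
by move=> u v; case: (var_nil_elim v).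
Qed.
End PeanoArithmetic.

Theorem conservation_PA (B : sentence LPA) : provable ACA0w_mu_U (tr_fm B) -> provable PA B.
Proof.
move=> p; apply: NNPP => /LPA_completeness[P [hP [nB cP]]].
have [Q [cl [cls [clE [eqvQ satQ]]]]] := peano_collapse hP.
have env_lift G (r : env Q G) : exists r' : env P G, r = fun u v => cl u (r' u v).
  exists (fun u v => proj1_sig (constructive_indefinite_description _ (cls u (r u v)))).
  apply: env_ext => u v; by case: constructive_indefinite_description.
apply: nB; apply/satQ; rewrite [X in sat _ X](env_nil_ext _ enil).
apply: (sat_of_tr_provable eqvQ) => //.
- by move=> G A hA r; have [r' ->] := env_lift G r; apply/satQ; apply: hP.
- have [e he] := cP tt; exists (fun i => cl tt (e i)) => x.
  have [x' <-] := cls tt x; have [i hi] := he x'; exists i; apply/clE.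
  (* As at higher types, equality with [x'] as a parameter turns indistinguishability into identity
     of classes. *)
  have := proj1 (hi _ (peq (PVar vz) (PVar (vs vz))) (@econs unit (dom P) [] tt x' enil)).
  rewrite /= !ev_pev; apply; exact: (@peqv_refl P hP tt).
Qed.

Theorem theorem9 :
  (forall A : wfm [T1; T1], arithmetical A ->
     provable ACA0w_mu_U (AllT T1 (ExT T1 A)) ->
     provable ACA0w (AllT T1 (ExT T1 A))) /\
  (forall B : sentence LPA,
     provable ACA0w_mu_U (tr_fm B) -> provable PA B).
Proof. split; [exact: conservation_Pi12|exact: conservation_PA]. Qed.
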